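(* Let $n\ge 2$ and $N\ge n^n$ be integers. Every polytope $P$ in $\mathbb{R}^n$ with at most $N$ facets satisfies $$\Delta_v(D_n,P)\ge\Bigl(\tfrac14+O\bigl(N^{-\frac{2}{n-1}}\bigr)\Bigr)N^{-\frac{2}{n-1}}|D_n| ,$$ and therefore, as $n\to\infty$, $\mathrm{ldiv}_{n-1}\ge (4\pi e)^{-1}+o(1)$.
   Context: $D_n$ is the centered Euclidean unit ball of $\mathbb{R}^n$; $|A|$ is volume; $|\partial A|$ is surface area; $\Delta_v(A,B)=|A\,\Delta\, B|$ is the volume of the symmetric difference. The implied constant in $O(N^{-2/(n-1)})$ is absolute. The constant $\mathrm{ldiv}_{n-1}>0$ depends only on the dimension and is defined by the following known limit (Ludwig): for every convex body $K\subset\mathbb{R}^n$ with $C^2$ boundary and everywhere positive Gaussian curvature $\kappa$, $$\lim_{N\to\infty}N^{\frac{2}{n-1}}\min\{\Delta_v(P,K): P \text{ a polytope with at most } N\text{ facets}\}=\tfrac12\,\mathrm{ldiv}_{n-1}\Bigl(\int_{\partial K}\kappa(x)^{\frac1{n+1}}d\mu_{\partial K}(x)\Bigr)^{\frac{n+1}{n-1}},$$ where $\mu_{\partial K}$ is the surface measure of $\partial K$. In particular, for $K=D_n$ the right-hand side is $\frac12\mathrm{ldiv}_{n-1}|\partial D_n|^{\frac{n+1}{n-1}}$. *)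

(* Defs.v *)
From HB Require Import structures.
From mathcomp Require Import all_boot all_order all_algebra.
From mathcomp Require Import all_classical all_reals all_analysis.

Set Implicit Arguments.
Unset Strict Implicit.
Unset Printing Implicit Defensive.

Import Order.TTheory GRing.Theory Num.Theory.
Import numFieldNormedType.Exports.

Local Open Scope classical_set_scope.
Local Open Scope ring_scope.

(* The norm `|x| that the library puts on 'rV[R]_n is the sup norm; the
   Euclidean norm is therefore defined here.  Both give the same topology. *)
Definition dotp (R : realType) (n : nat) (u v : 'rV[R]_n) : R :=
  \sum_(i < n) u 0 i * v 0 i.

Definition enorm (R : realType) (n : nat) (x : 'rV[R]_n) : R :=
  Num.sqrt (dotp x x).

Definition unit_ball (R : realType) (n : nat) : set 'rV[R]_n :=
  [set x | enorm x <= 1].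
Arguments unit_ball : clear implicits.

(* n-dimensional Lebesgue measure of Borel sets, as the n-fold product of the
   one-dimensional one: as for the library's product measure m1 \x m2, the
   measure of A is the integral of the measures of its sections.  It is only
   ever applied to Borel sets. *)
Fixpoint vol (R : realType) (n : nat) : set 'rV[R]_n -> \bar R :=
  match n return set 'rV[R]_n -> \bar R with
  | 0 => fun A => (\1_A (0 : 'rV[R]_0))%:E
  | m.+1 => fun A =>
      (\int[@lebesgue_measure R]_x
         vol [set y : 'rV[R]_m | A (row_mx (x%:M : 'rV[R]_1) y)])%E
  end.

Definition symdiff_vol (R : realType) (n : nat) (A B : set 'rV[R]_n) : \bar R :=
  vol (A `+` B).

(* Polytopes are bounded intersections of finitely many closed half-spaces;
   they may be lower-dimensional or empty. *)
Definition polytope (R : realType) (n : nat) (P : set 'rV[R]_n) : Prop :=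
  bounded_set P /\
  exists (m : nat) (u : 'I_m -> 'rV[R]_n) (b : 'I_m -> R),
    (forall i, u i != 0) /\ P = [set x | forall i, dotp (u i) x <= b i].

Definition affinely_independent (R : realType) (n k : nat)
    (p : 'I_k.+1 -> 'rV[R]_n) : Prop :=
  row_free (\matrix_(i < k) (p (lift ord0 i) - p ord0)).

Definition affine_dim (R : realType) (n : nat) (A : set 'rV[R]_n) (k : nat)
    : Prop :=
  (exists p : 'I_k.+1 -> 'rV[R]_n,
     (forall i, A (p i)) /\ affinely_independent p) /\
  ~ (exists p : 'I_k.+2 -> 'rV[R]_n,
     (forall i, A (p i)) /\ affinely_independent p).

Definition face (R : realType) (n : nat) (P : set 'rV[R]_n) (u : 'rV[R]_n)
    : set 'rV[R]_n :=
  [set x | P x /\ forall y, P y -> dotp u y <= dotp u x].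

Definition facets (R : realType) (n : nat) (P : set 'rV[R]_n)
    : set (set 'rV[R]_n) :=
  [set F | (exists u, F = face P u) /\
           exists k, affine_dim F k /\ affine_dim P k.+1].

Definition polytopes_upto (R : realType) (n N : nat) : set (set 'rV[R]_n) :=
  [set P | polytope P /\ (facets P #<= `I_N)%card].
Arguments polytopes_upto : clear implicits.

Definition convex_body (R : realType) (n : nat) (K : set 'rV[R]_n) : Prop :=
  [/\ compact K, @convex_set R 'rV[R]_n K & K° !=set0].

Definition bd (R : realType) (n : nat) (K : set 'rV[R]_n) : set 'rV[R]_n :=
  closure K `\` K°.

Definition pderiv (R : realType) (n : nat) (i : 'I_n) (F : 'rV[R]_n -> R)
    : 'rV[R]_n -> R :=
  fun x => 'D_(delta_mx 0 i) F x.

Definition grad (R : realType) (n : nat) (F : 'rV[R]_n -> R) (x : 'rV[R]_n)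
    : 'rV[R]_n :=
  \row_i pderiv i F x.

Definition hess (R : realType) (n : nat) (F : 'rV[R]_n -> R) (x : 'rV[R]_n)
    : 'M[R]_n :=
  \matrix_(i, j) pderiv j (pderiv i F) x.

Definition C2_on (R : realType) (n : nat) (U : set 'rV[R]_n)
    (F : 'rV[R]_n -> R) : Prop :=
  forall x, U x ->
    [/\ {for x, continuous F},
        forall i, derivable F x (delta_mx 0 i) /\
                  {for x, continuous (pderiv i F)} &
        forall i j, derivable (pderiv i F) x (delta_mx 0 j) /\
                    {for x, continuous (pderiv j (pderiv i F))}].

(* Near x, the set K is the sublevel set {F <= 0} of a C^2 function with
   nonvanishing gradient; grad F x is then an outer normal of K at x. *)
Definition C2_equation (R : realType) (n : nat) (K : set 'rV[R]_n)
    (x : 'rV[R]_n) (U : set 'rV[R]_n) (F : 'rV[R]_n -> R) : Prop :=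
  [/\ open U, U x, C2_on U F,
      forall y, U y -> (K y <-> F y <= 0) & grad F x != 0].

Definition C2_boundary (R : realType) (n : nat) (K : set 'rV[R]_n) : Prop :=
  forall x, bd K x -> exists U F, C2_equation K x U F.

(* k is the determinant of the second fundamental form of bd K at x.  The rows
   of B are an orthonormal basis of the tangent space, and in this basis the
   second fundamental form of {F = 0} (for the sign convention in which it is
   nonnegative on convex sets) is B *m hess F x *m B^T / |grad F x|. *)
Definition gauss_curvature (R : realType) (n : nat) (K : set 'rV[R]_n)
    (x : 'rV[R]_n) (k : R) : Prop :=
  exists (U : set 'rV[R]_n) (F : 'rV[R]_n -> R) (B : 'M[R]_(n.-1, n)),
    [/\ C2_equation K x U F,
        B *m B^T = 1%:M,
        B *m (grad F x)^T = 0 &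
        k = \det ((enorm (grad F x))^-1 *: (B *m hess F x *m B^T))].

(* Points outside K, at distance at most e from K, whose nearest point in K
   belongs to S. *)
Definition local_shell (R : realType) (n : nat) (K S : set 'rV[R]_n) (e : R)
    : set 'rV[R]_n :=
  [set y | ~ K y /\
     exists x, [/\ K x, S x, forall z, K z -> enorm (y - x) <= enorm (y - z)
                 & enorm (y - x) <= e]].

(* Surface measure on the boundary of a convex body, after Minkowski: the
   derivative at 0 of the volume of the local parallel sets.  By the local
   Steiner formula the limit exists for all Borel sets S. *)
Definition surface_measure (R : realType) (n : nat) (K S : set 'rV[R]_n)
    : \bar R :=
  lim (((e^-1)%:E * vol (local_shell K S e))%E @[e --> (0 : R)^'+]).

Definition borel_rV (R : realType) (n : nat) :=
  g_sigma_algebraType (@open 'rV[R]_n).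

Definition boundary_integral (R : realType) (n : nat) (K : set 'rV[R]_n)
    (f : 'rV[R]_n -> R) : R :=
  fine (\int[(surface_measure K : set (borel_rV R n) -> \bar R)]_(x in
           (bd K : set (borel_rV R n))) (f x)%:E)%E.

(* c is the constant ldiv_{n-1} of Ludwig's theorem in R^n. *)
Definition is_ldiv (R : realType) (n : nat) (c : R) : Prop :=
  0 < c /\
  forall (K : set 'rV[R]_n) (kappa : 'rV[R]_n -> R),
    convex_body K -> C2_boundary K ->
    (forall x, bd K x -> gauss_curvature K x (kappa x) /\ 0 < kappa x) ->
    ((N%:R `^ (2 / (n%:R - 1)))%:E *
       ereal_inf [set symdiff_vol P K | P in polytopes_upto R n N])%E
      @[N --> \oo] -->
    (2^-1 * c *
       boundary_integral K (fun x => kappa x `^ (1 / (n%:R + 1)))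
         `^ ((n%:R + 1) / (n%:R - 1)))%:E.

(* Main.v *)
From HB Require Import structures.
Require Import Defs.
From mathcomp Require Import all_boot all_order all_algebra.
From mathcomp Require Import all_classical all_reals all_analysis.
From mathcomp Require Import measurable_realfun ring lra.
Import Order.TTheory GRing.Theory Num.Theory.
Import numFieldNormedType.Exports.
Local Open Scope classical_set_scope.
Local Open Scope ring_scope.

(** Why the theorem is true.  Write n = d + 1, t = N^(-2/d), kappa_k for the
    volume of the k-dimensional unit ball and Delta for the volume of the
    symmetric difference of P and the unit ball.

    If the origin is not interior to P, a half-space through the centre is
    missed and Delta >= kappa_n / 2.  Otherwise P is given by inequalities
    dotp (w i) x <= 1, and an irredundant subsystem has one facet for each
    inequality, hence at most N members ([irredundant_system]).  The points at
    which the i-th inequality is the most demanding form a convex cone, the cone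
    over the i-th facet.  The cones are disjoint and cover the polytope up to a
    point, so it is enough to find a lower bound for Delta in each cone that
    can be summed.

    After a rotation the cone consists of the points (h, h y) with h > 0 and y
    in a convex base Y, and the facet lies at height h = b.  On the ray over y
    the sphere has height (1 + |y|^2)^(-1/2), so the volume between facet and
    sphere is the integral over Y of |b^n - (1 + |y|^2)^(-n/2)| / n
    ([vol_cone_diff]), which is essentially b^n / 2 times the integral of |g|,
    where g = b^2 (1 + |y|^2) - 1.  The height b is at the disposal of the
    polytope, so g may have any constant term; but for 0 < lam < 1

      g (lam x + (1 - lam) y) =
        lam g x + (1 - lam) g y - lam (1 - lam) b^2 |x - y|^2.

    Integrate this over x and y in Y.  By convexity the contracted points stay
    in Y, and the change of variables costs the Jacobian lam^-d.  So
    (1 + lam^-d) times the integral of |g| is at least 2 lam (1 - lam) b^2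
    times the second moment of Y about its centroid, whatever b may be.  With
    lam = d / (d + 1) the factor lam^-d remains below e.  By the bathtub
    principle that second moment is at least
    r^2 |Y| - (2 / (d + 2)) kappa_d r^(d+2) for every r > 0
    ([quadratic_cell_bound]).  This bound is linear in |Y|, so with a common r
    the cells can be added up, and they fill the volume of the ball up to Delta
    ([cells_sum_bound]).  The choice r^2 = rho t with rho slightly smaller than
    (1 + 1/d) (1 + 2/d) keeps the sum of the N error terms below the fraction
    2 / (d + 2) of the main term, because kappa_n >= 4 kappa_d / (d + 2), and
    yields Delta >= t kappa_n / 4 once t is below an absolute constant
    ([symdiff_lower_bound]).  For larger t
    the error term of the theorem is of constant order.

    For the second statement, apply the limit that defines ldiv to the unit
    ball.  Its curvature is 1 and its surface measure of S is n times the volume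
    of the sector over S, so the boundary integral is at most n kappa_n, and the
    first statement gives ldiv >= (2n)^-1 (n kappa_n)^(-2/(n-1)).  Chernoff's
    bound kappa_n <= (2 pi e / n)^(n/2) turns this into
    (4 pi e)^-1 (2 pi e n)^(-1/(n-1)), and the last factor tends to 1
    ([ldiv_lower_bound], [powR_root_ge]). *)

Set Implicit Arguments.
Unset Strict Implicit.
Unset Printing Implicit Defensive.

(** * Borel sets of row vectors *)

Section BorelRowVectors.
Context {R : realType}.

Lemma measurable_set_lt d (T : measurableType d) (f g : T -> R) :
  measurable_fun setT f -> measurable_fun setT g ->
  measurable [set x | f x < g x].
Proof.
move=> mf mg; have := measurable_fun_ltr mf mg measurableT (Y:=[set true]).
by rewrite setTI; apply.
Qed.

Lemma measurable_set_le d (T : measurableType d) (f g : T -> R) :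
  measurable_fun setT f -> measurable_fun setT g ->
  measurable [set x | f x <= g x].
Proof.
move=> mf mg; have := measurable_fun_ler mf mg measurableT (Y:=[set true]).
by rewrite setTI; apply.
Qed.

Lemma ball_rVP n (x y : 'rV[R]_n) e :
  0 < e -> ball x e y <-> forall i, `|x 0 i - y 0 i| < e.
Proof.
move=> e0; split => [[_ h] i|h]; first exact: h.
by split => // i j; rewrite ord1; exact: h.
Qed.

Lemma exists_rat_rV n (x : 'rV[R]_n) (e : R) : 0 < e ->
  exists q : 'rV[rat]_n, forall i, `|x 0 i - ratr (q 0 i)| < e.
Proof.
move=> e0.
have h (i : 'I_n) : exists q : rat, `|x 0 i - ratr q| < e.
  have /rat_in_itvoo[q] : x 0 i - e < x 0 i + e by rewrite ltrD2l gtrN.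
  rewrite in_itv/= => /andP[q1 q2]; exists q.
  by rewrite ltr_distlC; apply/andP; split => //; lra.
have [f fP] := choice h.
by exists (\row_i f i) => i; rewrite mxE.
Qed.

(** Open sets are countable unions of rational cubes, so the Borel sets of row
    vectors are generated by the coordinates. *)
Lemma measurable_fun_rV d (T : measurableType d) n (f : T -> 'rV[R]_n) :
  (forall i, measurable_fun setT (fun x => f x 0 i : R)) ->
  measurable_fun setT (f : T -> borel_rV R n).
Proof.
move=> mf; apply: (@measurability _ _ T (borel_rV R n) setT f (@open 'rV[R]_n) erefl).
move=> _ [U oU <-].
rewrite setTI.
pose C (p : 'rV[rat]_n * nat) : set 'rV[R]_n :=
  [set x | forall i, `|x 0 i - ratr (p.1 0 i)| < p.2.+1%:R^-1].
have -> : f @^-1` U = \bigcup_p (if `[< C p `<=` U >] then f @^-1` C p else set0).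
  apply/seteqP; split => x /=; last first.
    by move=> [p _]; case: asboolP => // CU /CU.
  move=> Ux; have /nbhs_ballP[e /= e0 eU] : nbhs (f x) U.
    by move: oU; rewrite openE; apply.
  have [k ke] : exists k : nat, k.+1%:R^-1 < e / 2.
    have h0 : 0 < e / 2 by apply: divr_gt0.
    exists (Num.truncn (e / 2)^-1).
    by rewrite invf_plt ?posrE//; exact: truncnS_gt.
  have [q qP] := @exists_rat_rV n (f x) k.+1%:R^-1 (ltac:(by rewrite invr_gt0)).
  exists (q, k) => //.
  have -> : `[< C (q, k) `<=` U >] = true.
    apply/asboolP => z /= Cz; apply: eU; apply/ball_rVP => // i.
    have := Cz i; have := qP i => /= h1 h2.
    have -> : f x 0 i - z 0 i = (f x 0 i - ratr (q 0 i)) - (z 0 i - ratr (q 0 i)) by lra.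
    apply: (le_lt_trans (ler_normB _ _)).
    by rewrite (splitr e) ltrD// (lt_trans _ ke).
  by [].
apply: countable_bigcupT_measurable; first exact: countableP.
move=> p; case: asboolP => // _.
have -> : f @^-1` C p = \bigcap_(i in [set` [set: 'I_n]%SET])
    [set x | `|f x 0 i - ratr (p.1 0 i)| < p.2.+1%:R^-1].
  apply/seteqP; split => x /=; first by move=> h i _; exact: h.
  by move=> h i; apply: h; rewrite /= inE.
apply: fin_bigcap_measurable => // i _.
have mg : measurable_fun setT (fun x => f x 0 i - ratr (p.1 0 i)).
  exact: measurable_funB.
apply: measurable_set_lt => //; exact: measurableT_comp.
Qed.

Lemma open_measurable_rV n (U : set 'rV[R]_n) :
  open U -> measurable (U : set (borel_rV R n)).
Proof. by move=> oU; apply: sub_sigma_algebra. Qed.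

Lemma continuous_measurable_rV n (f : 'rV[R]_n -> R) :
  continuous f -> measurable_fun setT (f : borel_rV R n -> R).
Proof.
move=> cf; apply: (@measurability _ _ (borel_rV R n) R setT f _
  (measurable_realfun.RGenOInfty.measurableE R)).
move=> /= _ [_ [a ->]] <-; rewrite setTI; apply: open_measurable_rV.
by apply: open_comp => //; exact: interval_open.
Qed.

End BorelRowVectors.

(** * Volume as a sigma-finite measure *)

Section VolumeMeasure.
Context {R : realType}.

Definition consrV m (p : R * 'rV[R]_m) : 'rV[R]_m.+1 :=
  row_mx (p.1%:M : 'rV[R]_1) p.2.

Definition unconsrV m (x : 'rV[R]_m.+1) : R * 'rV[R]_m :=
  (x 0 0, \row_j x 0 (lift ord0 j)).

Lemma consrV0 m (p : R * 'rV[R]_m) : consrV p 0 0 = p.1.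
Proof.
transitivity ((p.1%:M : 'rV[R]_1) 0 0); last by rewrite mxE eqxx mulr1n.
rewrite -(row_mxEl (p.1%:M : 'rV[R]_1) p.2); congr (_ _ _); exact: val_inj.
Qed.

Lemma consrVS m (p : R * 'rV[R]_m) j : consrV p 0 (lift ord0 j) = p.2 0 j.
Proof.
rewrite -(row_mxEr (p.1%:M : 'rV[R]_1) p.2); congr (_ _ _); exact: val_inj.
Qed.

Lemma consrVK m : cancel (@consrV m) (@unconsrV m).
Proof.
move=> [a y]; rewrite /unconsrV consrV0; congr pair.
by apply/rowP => j; rewrite mxE consrVS.
Qed.

Lemma measurable_coord n i : measurable_fun setT (fun x : borel_rV R n => (x : 'rV[R]_n) 0 i : R).
Proof. apply: (@continuous_measurable_rV _ n (fun x => x 0 i)); exact: coord_continuous. Qed.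

Lemma measurable_consrV m :
  measurable_fun setT (@consrV m : R * borel_rV R m -> borel_rV R m.+1).
Proof.
apply: measurable_fun_rV => i; have [j ->|->] := unliftP ord0 i.
  rewrite [X in measurable_fun _ X](_ : _ =
    (fun x : borel_rV R m => (x : 'rV[R]_m) 0 j : R) \o snd).
    by apply: measurableT_comp; [exact: measurable_coord|exact: measurable_snd].
  by apply/funext => p /=; rewrite consrVS.
rewrite [X in measurable_fun _ X](_ : _ = fst); first exact: measurable_fst.
by apply/funext => p /=; rewrite consrV0.
Qed.

Lemma measurable_unconsrV m :
  measurable_fun setT (@unconsrV m : borel_rV R m.+1 -> R * borel_rV R m).
Proof.
apply: measurable_fun_pair; first exact: measurable_coord.
apply: measurable_fun_rV => i.
rewrite [X in measurable_fun _ X](_ : _ =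
    (fun x : borel_rV R m.+1 => (x : 'rV[R]_m.+1) 0 (lift ord0 i) : R)).
  exact: measurable_coord.
by apply/funext => p /=; rewrite mxE.
Qed.

Lemma vol_consrV m (A : set 'rV[R]_m.+1) :
  vol A = (\int[@lebesgue_measure R]_x vol [set y | A (consrV (x, y))])%E.
Proof. by []. Qed.

Lemma vol_ge0 n (A : set 'rV[R]_n) : (0 <= vol A)%E.
Proof.
case: n A => [|n] A /=; first by rewrite lee_fin.
elim: n A => [|n IH] A; apply: integral_ge0 => x _; last exact: IH.
by rewrite lee_fin.
Qed.

Lemma vol_set0 n : @vol R n set0 = 0%E.
Proof.
elim: n => [|n IH]; first by rewrite /= indicE in_set0.
by rewrite vol_consrV; apply: integral0_eq => x _; exact: IH.
Qed.

Lemma measurable_preim_consrV m (A : set (borel_rV R m.+1)) : measurable A ->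
  measurable (@consrV m @^-1` A : set (R * borel_rV R m)).
Proof. by move=> mA; rewrite -[X in measurable X]setTI; exact: measurable_consrV. Qed.

Section VolStep.
Context (m : nat).
Let V : set (borel_rV R m) -> \bar R := @vol R m.
Hypothesis Vsigma : semi_sigma_additive V.
Hypothesis Vfin : sigma_finite setT V.

Let V0 : V set0 = 0%E. Proof. exact: vol_set0. Qed.
Let V_ge0 A : (0 <= V A)%E. Proof. exact: vol_ge0. Qed.
HB.instance Definition _ := isMeasure.Build _ _ _ V V0 V_ge0 Vsigma.
HB.instance Definition _ := Measure_isSigmaFinite.Build _ _ _ V Vfin.

Let volE (A : set 'rV[R]_m.+1) : vol A = (@lebesgue_measure R \x V)%E (@consrV m @^-1` A).
Proof.
rewrite vol_consrV; apply: eq_integral => x _ /=; congr (vol _).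
by apply/seteqP; split => y /=; rewrite /xsection/= inE.
Qed.

Lemma vol_sigma_additive_step :
  semi_sigma_additive (@vol R m.+1 : set (borel_rV R m.+1) -> \bar R).
Proof.
move=> F mF tF mUF; rewrite volE preimage_bigcup.
rewrite [X in X @ _ --> _](_ : _ = (fun n =>
  \sum_(0 <= i < n) (@lebesgue_measure R \x V)%E (@consrV m @^-1` F i))%E); last first.
  by apply/funext => n; apply: eq_bigr => i _; rewrite volE.
apply: measure_semi_sigma_additive.
- by move=> n; exact: measurable_preim_consrV.
- apply/trivIsetP => /= i j _ _ ij; rewrite -preimage_setI.
  by move/trivIsetP : tF => /(_ _ _ _ _ ij) ->//; rewrite preimage_set0.
- by rewrite -preimage_bigcup; exact: measurable_preim_consrV.
Qed.

Lemma vol_sigma_finite_step :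
  sigma_finite setT (@vol R m.+1 : set (borel_rV R m.+1) -> \bar R).
Proof.
have [F FT Ffin] : sigma_finite setT (@lebesgue_measure R \x V)%E.
  have /sigma_finiteP[F [TF ndF Foo]] := sigma_finiteT (@lebesgue_measure R).
  have /sigma_finiteP[G [TG ndG Goo]] := sigma_finiteT V.
  exists (fun n => F n `*` G n).
    rewrite -setXTT TF TG predeqE => -[x y]; split.
      move=> [/= [n _ Fnx] [k _ Gky]]; exists (maxn n k) => //; split.
      - by move: x Fnx; exact/subsetPset/ndF/leq_maxl.
      - by move: y Gky; exact/subsetPset/ndG/leq_maxr.
    by move=> [n _ []/= ? ?]; split; exists n.
  move=> k; have [? ?] := Foo k; have [? ?] := Goo k.
  split; first exact: measurableX.
  by rewrite product_measure1E// lte_mul_pinfty// ge0_fin_numE.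
exists (fun k => @unconsrV m @^-1` F k).
  apply/seteqP; split => // x _.
  have : (\bigcup_i F i) (unconsrV x) by rewrite -FT.
  by move=> [k _ Fk]; exists k.
move=> k; have [mF Fk] := Ffin k; split.
  by rewrite -[X in measurable X]setTI; exact: measurable_unconsrV.
rewrite volE -comp_preimage [X in X @^-1` _](_ : _ = id)//.
by apply/funext => p /=; rewrite consrVK.
Qed.

End VolStep.

Lemma vol_sigma n :
  semi_sigma_additive (@vol R n : set (borel_rV R n) -> \bar R) /\
  sigma_finite setT (@vol R n : set (borel_rV R n) -> \bar R).
Proof.
elim: n => [|n [IH1 IH2]]; last first.
  by split; [exact: vol_sigma_additive_step|exact: vol_sigma_finite_step].
have volE : (@vol R 0 : set (borel_rV R 0) -> \bar R) = dirac (0 : borel_rV R 0).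
  by [].
split; first by rewrite volE; exact: measure_semi_sigma_additive.
by rewrite volE; exact: sigma_finiteT.
Qed.

Definition volm n : set (borel_rV R n) -> \bar R := @vol R n.

Section VolmInstance.
Variable n : nat.
Let volm0 : @volm n set0 = 0%E. Proof. exact: vol_set0. Qed.
Let volm_ge0 A : (0 <= @volm n A)%E. Proof. exact: vol_ge0. Qed.
Let volm_sigma : semi_sigma_additive (@volm n). Proof. exact: (vol_sigma n).1. Qed.
HB.instance Definition _ := isMeasure.Build _ _ _ (@volm n)
  volm0 volm_ge0 volm_sigma.
Let volm_fin : sigma_finite setT (@volm n). Proof. exact: (vol_sigma n).2. Qed.
HB.instance Definition _ := Measure_isSigmaFinite.Build _ _ _ (@volm n) volm_fin.
End VolmInstance.

End VolumeMeasure.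

(** * Volume under scaling and translation *)

Section AffineInvariance.
Context {R : realType}.
Local Notation leb := (@lebesgue_measure R).

Lemma measurable_affR (l a : R) :
  measurable_fun setT (fun x : measurableTypeR R => l * x + a : measurableTypeR R).
Proof. by apply: measurable_funD => //; exact: measurable_funM. Qed.

(** Both sides are measures that agree on the half-open intervals. *)
Lemma lebesgue_affine (l a : R) (A : set R) : 0 < l -> measurable A ->
  leb [set x | A (l * x + a)] = ((l^-1)%:E * leb A)%E.
Proof.
move=> l0 mA.
pose T : measurableTypeR R -> measurableTypeR R := fun x => l * x + a.
have mT : measurable_fun setT T by exact: measurable_affR.
have l0' : 0 <= l by exact: ltW.
pose mu := mscale (NngNum l0')
  (measure_function_pushforward__canonical__measure_function_Measure leb mT).
have h : forall A, measurable A -> leb A = mu A.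
  move=> {A mA} A mA.
  apply: lebesgue_measure_unique => //= _ [[b c]] _ <-.
  rewrite /mu /mscale/= /pushforward.
  have -> : T @^-1` `]b, c] = `](b - a) / l, (c - a) / l]%classic.
    apply/seteqP; split => x /=; rewrite !in_itv/= /T ltr_pdivrMr// ler_pdivlMr//;
      by move=> /andP[? ?]; apply/andP; split; lra.
  rewrite !lebesgue_measure_itv/= !lte_fin ltr_pM2r ?invr_gt0// ltrD2r.
  case: ifPn => // bc; last by rewrite mule0.
  by rewrite -!EFinD -EFinM; congr EFin; field; rewrite gt_eqF.
rewrite (h _ mA) /mu /mscale/= muleA -EFinM mulVf ?gt_eqF// mul1e.
by [].
Qed.

Lemma ge0_integral_affine (l a : R) (f : R -> \bar R) : 0 < l ->
  measurable_fun setT f -> (forall x, (0 <= f x)%E) ->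
  (\int[leb]_x f (l * x + a)%R = (l^-1)%:E * \int[leb]_x f x)%E.
Proof.
move=> l0 mf f0.
have l0' : 0 <= l^-1 by rewrite invr_ge0 ltW.
transitivity (\int[mscale (NngNum l0') leb]_x f x)%E; last first.
  by rewrite ge0_integral_mscale.
pose T : measurableTypeR R -> measurableTypeR R := fun x => l * x + a.
have mT : measurable_fun setT T by exact: measurable_affR.
rewrite -(ge0_integral_pushforward mT leb measurableT mf)//.
by apply: eq_measure_integral => A mA _; rewrite /= /pushforward lebesgue_affine.
Qed.

Lemma fubini_sets d1 d2 (T1 : measurableType d1) (T2 : measurableType d2)
    (m1 : {sigma_finite_measure set T1 -> \bar R})
    (m2 : {sigma_finite_measure set T2 -> \bar R}) (S : set (T1 * T2)) :
  measurable S ->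
  (\int[m1]_x m2 [set y | S (x, y)] = \int[m2]_y m1 [set x | S (x, y)])%E.
Proof.
move=> mS; have := indic_fubini_tonelli m1 m2 mS.
rewrite indic_fubini_tonelli_FE// indic_fubini_tonelli_GE//.
rewrite (_ : m2 \o xsection S = fun x => m2 [set y | S (x, y)]); last first.
  by apply/funext => x /=; congr (m2 _); apply/seteqP; split => y /=; rewrite /xsection/= inE.
rewrite (_ : m1 \o ysection S = fun y => m1 [set x | S (x, y)])//.
by apply/funext => x /=; congr (m1 _); apply/seteqP; split => y /=; rewrite /ysection/= inE.
Qed.

Lemma measurable_setP d1 d2 (T1 : measurableType d1) (T2 : measurableType d2)
    (f : T1 -> T2) (A : set T2) :
  measurable_fun setT f -> measurable A -> measurable [set x | A (f x)].
Proof. by move=> mf mA; rewrite -[X in measurable X]setTI; exact: mf. Qed.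

Lemma measurable_section m (A : set (borel_rV R m.+1)) : measurable A ->
  measurable_fun setT (fun x : R => vol [set y | A (consrV (x, y))]).
Proof.
move=> mA.
have := measurable_fun_xsection (@volm R m) (measurable_preim_consrV mA).
rewrite [X in measurable_fun _ X](_ : _ = (fun x : R => vol [set y | A (consrV (x, y))]))//.
by apply/funext => x /=; congr (vol _); apply/seteqP; split => y /=; rewrite /xsection/= inE.
Qed.

Lemma measurable_rVsec m (A : set (borel_rV R m.+1)) (x : R) : measurable A ->
  measurable ([set y | A (consrV (x, y))] : set (borel_rV R m)).
Proof.
move=> mA; apply: (@measurable_setP _ _ (borel_rV R m) (borel_rV R m.+1) (fun y => consrV (x, y)) A) => //.
by apply: (measurableT_comp (@measurable_consrV R m)); exact: pair1_measurable.
Qed.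

Lemma measurable_scale_add n (l : R) (v : 'rV[R]_n) :
  measurable_fun setT ((fun x => l *: x + v) : borel_rV R n -> borel_rV R n).
Proof.
apply: measurable_fun_rV => i.
rewrite [X in measurable_fun _ X](_ : _ =
    (fun x : borel_rV R n => l * (x : 'rV[R]_n) 0 i + v 0 i)); last first.
  by apply/funext => x; rewrite !mxE.
by apply: measurable_funD => //; apply: measurable_funM => //; exact: measurable_coord.
Qed.

Lemma scale_consrVD m (l x : R) (y : 'rV[R]_m) (v : 'rV[R]_m.+1) :
  l *: consrV (x, y) + v = consrV (l * x + v 0 0, l *: y + (unconsrV v).2).
Proof.
apply/rowP => i; rewrite mxE [X in X + _]mxE.
have [j ->|->] := unliftP ord0 i; last by rewrite !consrV0.
by rewrite !consrVS/= mxE [in RHS]mxE [X in _ = _ + X]mxE.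
Qed.

Lemma vol_affine n (l : R) (v : 'rV[R]_n) (A : set (borel_rV R n)) :
  0 < l -> measurable A ->
  vol [set x | A (l *: x + v)] = ((l ^- n)%:E * vol A)%E.
Proof.
move=> l0; elim: n v A => [|n IH] v A mA.
  rewrite expr0 invr1 mul1e; congr (vol _); apply/seteqP.
  by split => x /=; rewrite (thinmx0 (_ + _)) (thinmx0 x).
rewrite !vol_consrV.
pose v' := (unconsrV v).2.
transitivity (\int[leb]_x ((l ^- n)%:E * vol [set y | A (consrV ((l * x + v 0 0)%R, y))]))%E.
  apply: eq_integral => x _.
  rewrite -(IH v' [set y | A (consrV (l * x + v 0 0, y))]); last exact: measurable_rVsec.
  by congr (vol _); apply/seteqP; split => y /=; rewrite scale_consrVD.
rewrite ge0_integralZl//=; first last.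
- by rewrite lee_fin invr_ge0 exprn_ge0// ltW.
- by move=> *; exact: vol_ge0.
- by apply: (measurableT_comp (measurable_section mA)); exact: measurable_affR.
rewrite (@ge0_integral_affine l (v 0 0) (fun x => vol [set y | A (consrV (x, y))]))//.
- by rewrite muleA -EFinM exprS invfM mulrC.
- exact: measurable_section.
- by move=> x; exact: vol_ge0.
Qed.

Lemma ge0_integral_affine_rV n (l : R) (v : 'rV[R]_n) (f : 'rV[R]_n -> \bar R) : 0 < l ->
  measurable_fun setT (f : borel_rV R n -> _) -> (forall x, (0 <= f x)%E) ->
  (\int[@volm R n]_x f (l *: x + v)%R = (l ^- n)%:E * \int[@volm R n]_x f x)%E.
Proof.
move=> l0 mf f0.
have l0' : 0 <= l ^- n by rewrite invr_ge0 exprn_ge0// ltW.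
transitivity (\int[mscale (NngNum l0') (@volm R n)]_x f x)%E; last first.
  by rewrite ge0_integral_mscale.
have mT := @measurable_scale_add n l v.
rewrite -(ge0_integral_pushforward mT (@volm R n) measurableT mf)//.
by apply: eq_measure_integral => A mA _; rewrite /= /pushforward [LHS]vol_affine.
Qed.

Lemma measurable_dotp d (T : measurableType d) n (f g : T -> 'rV[R]_n) :
  (forall i, measurable_fun setT (fun x => f x 0 i)) ->
  (forall i, measurable_fun setT (fun x => g x 0 i)) ->
  measurable_fun setT (fun x => dotp (f x) (g x)).
Proof.
move=> mf mg; apply: measurable_sum => i; exact: measurable_funM.
Qed.

(** Comparison with boxes gives bounded sets a finite volume and balls a
    positive one. *)
Lemma vol_box n (a : R) : 0 <= a ->
  vol [set x : 'rV[R]_n | forall i, `|x 0 i| <= a] = ((2 * a) ^+ n)%:E.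
Proof.
move=> a0; elim: n => [|n IH].
  rewrite expr0 /= indicE mem_set//=; by case.
rewrite vol_consrV.
rewrite (_ : (fun x => _) = (fun x => ((2 * a) ^+ n)%:E * (\1_`[-a, a] x)%:E)%E); last first.
  apply/funext => x; rewrite indicE.
  have [xa|xa] := boolP (x \in `[-a, a]%classic).
    rewrite mule1 -IH; congr (vol _); apply/seteqP; split => y /=.
      by move=> h i; have := h (lift ord0 i); rewrite consrVS.
    move=> h i; have [j ->|->] := unliftP ord0 i; rewrite ?consrVS ?consrV0//=.
    by move: xa; rewrite inE/= in_itv/= ler_norml.
  rewrite mule0 -(vol_set0 n); congr (vol _); apply/seteqP; split => y //=.
  move=> /(_ 0); rewrite consrV0/= => xa'; move: xa.
  by rewrite notin_setE/= in_itv/= -ler_norml xa'.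
rewrite ge0_integralZl//=; first last.
- by rewrite lee_fin exprn_ge0// mulr_ge0.
- exact/measurable_EFinP/measurable_indic.
rewrite integral_indic//= setIT [X in (_ * X)%E]lebesgue_measure_itv/= lte_fin.
have [lt|ge] := ltP (-a) a; first by rewrite -EFinD -EFinM exprSr; congr EFin; ring.
have -> : a = 0 by apply/eqP; rewrite eq_le a0 andbT; lra.
by rewrite mule0 mulr0 exprS mul0r.
Qed.

End AffineInvariance.

(** * Euclidean balls and orthogonal invariance *)

Section EuclideanBalls.
Context {R : realType}.
Local Notation leb := (@lebesgue_measure R).

Lemma dotpC n (u v : 'rV[R]_n) : dotp u v = dotp v u.
Proof. by apply: eq_bigr => i _; rewrite mulrC. Qed.

Lemma dotpDl n (u v w : 'rV[R]_n) : dotp (u + v) w = dotp u w + dotp v w.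
Proof. by rewrite -big_split/=; apply: eq_bigr => i _; rewrite mxE mulrDl. Qed.

Lemma dotpDr n (u v w : 'rV[R]_n) : dotp w (u + v) = dotp w u + dotp w v.
Proof. by rewrite dotpC dotpDl !(dotpC w). Qed.

Lemma dotpZl n a (u v : 'rV[R]_n) : dotp (a *: u) v = a * dotp u v.
Proof. by rewrite mulr_sumr; apply: eq_bigr => i _; rewrite mxE mulrA. Qed.

Lemma dotpZr n a (u v : 'rV[R]_n) : dotp u (a *: v) = a * dotp u v.
Proof. by rewrite dotpC dotpZl dotpC. Qed.

Lemma dotpNl n (u v : 'rV[R]_n) : dotp (- u) v = - dotp u v.
Proof. by rewrite -scaleN1r dotpZl mulN1r. Qed.

Lemma dotpNr n (u v : 'rV[R]_n) : dotp u (- v) = - dotp u v.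
Proof. by rewrite dotpC dotpNl dotpC. Qed.

Lemma dotpBl n (u v w : 'rV[R]_n) : dotp (u - v) w = dotp u w - dotp v w.
Proof. by rewrite dotpDl dotpNl. Qed.

Lemma dotpBr n (u v w : 'rV[R]_n) : dotp w (u - v) = dotp w u - dotp w v.
Proof. by rewrite dotpDr dotpNr. Qed.

Lemma dotp0l n (u : 'rV[R]_n) : dotp 0 u = 0.
Proof. by rewrite -(scale0r u) dotpZl mul0r. Qed.

Lemma dotp0r n (u : 'rV[R]_n) : dotp u 0 = 0.
Proof. by rewrite dotpC dotp0l. Qed.

Lemma dotp_ge0 n (u : 'rV[R]_n) : 0 <= dotp u u.
Proof. by apply: sumr_ge0 => i _; rewrite -expr2 sqr_ge0. Qed.

Lemma dotp_eq0 n (u : 'rV[R]_n) : (dotp u u == 0) = (u == 0).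
Proof.
apply/eqP/eqP => [/eqP|->]; last by rewrite dotp0l.
rewrite psumr_eq0; last by move=> i _; rewrite -expr2 sqr_ge0.
move=> /allP h; apply/rowP => i; rewrite mxE.
by have := h i (mem_index_enum _); rewrite -expr2 sqrf_eq0 => /eqP.
Qed.

Lemma dotp_gt0 n (u : 'rV[R]_n) : (0 < dotp u u) = (u != 0).
Proof. by rewrite lt_def dotp_eq0 dotp_ge0 andbT. Qed.

Lemma dotp_mulmx n (u v : 'rV[R]_n) : dotp u v = (u *m v^T) 0 0.
Proof. by rewrite mxE; apply: eq_bigr => i _; rewrite mxE. Qed.

Lemma dotp_consrV m (x : R) (y : 'rV[R]_m) :
  dotp (consrV (x, y)) (consrV (x, y)) = x ^+ 2 + dotp y y.
Proof.
rewrite {1}/dotp big_ord_recl consrV0 expr2; congr (_ + _).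
by apply: eq_bigr => i _; rewrite consrVS.
Qed.

Lemma unit_ballP n (x : 'rV[R]_n) : unit_ball R n x <-> dotp x x <= 1.
Proof. by rewrite /unit_ball/= /enorm -[X in _ <= X]sqrtr1 ler_sqrt. Qed.

Lemma coord_le_dotp n (x : 'rV[R]_n) i : (x 0 i) ^+ 2 <= dotp x x.
Proof.
rewrite /dotp (bigD1 i)//= expr2 lerDl; apply: sumr_ge0 => j _.
by rewrite -expr2 sqr_ge0.
Qed.

Lemma measurable_dotp_self n :
  measurable_fun setT (fun x : borel_rV R n => dotp (x : 'rV[R]_n) x).
Proof. by apply: measurable_dotp => i; exact: measurable_coord. Qed.

(** Indexed by the squared radius, so that the sections of a ball are again
    balls, possibly with a negative index, in which case they are empty. *)
Definition sqball n (r : R) : set 'rV[R]_n := [set x | dotp x x <= r].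

Lemma measurable_sqball n (r : R) :
  measurable (@sqball n r : set (borel_rV R n)).
Proof. by apply: measurable_set_le => //; exact: measurable_dotp_self. Qed.

Lemma unit_ballE n : unit_ball R n = sqball 1.
Proof. by apply/seteqP; split => x /unit_ballP. Qed.

Lemma measurable_unit_ball n : measurable (unit_ball R n : set (borel_rV R n)).
Proof. by rewrite unit_ballE; exact: measurable_sqball. Qed.

Lemma le_vol n (A B : set 'rV[R]_n) :
  measurable (A : set (borel_rV R n)) -> measurable (B : set (borel_rV R n)) ->
  A `<=` B -> (vol A <= vol B)%E.
Proof. by move=> mA mB AB; apply: (@le_measure _ _ _ (@volm R n)) => //; rewrite inE. Qed.

Lemma measurable_box n (a : R) :
  measurable ([set x : 'rV[R]_n | forall i, `|x 0 i| <= a] : set (borel_rV R n)).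
Proof.
rewrite (_ : [set x | _] = \bigcap_(i in [set` [set: 'I_n]%SET])
    [set x : 'rV[R]_n | `|x 0 i| <= a]).
  apply: fin_bigcap_measurable => // i _; apply: measurable_set_le => //.
  by apply: measurableT_comp => //; exact: measurable_coord.
apply/seteqP; split => x /=; first by move=> h i _; exact: h.
by move=> h i; apply: h; rewrite /= inE.
Qed.

Lemma vol_bounded_lty n (A : set 'rV[R]_n) (r : R) :
  measurable (A : set (borel_rV R n)) -> 0 <= r ->
  A `<=` [set x : 'rV[R]_n | forall i, `|x 0 i| <= r] -> (vol A < +oo)%E.
Proof.
move=> mA r0 Ar; apply: le_lt_trans (le_vol mA _ Ar) _; first exact: measurable_box.
by rewrite vol_box// ltry.
Qed.

Lemma vol_sqball_lty n (r : R) : (vol (@sqball n r) < +oo)%E.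
Proof.
apply: (@vol_bounded_lty _ _ (1 + `|r|)); first exact: measurable_sqball.
  by rewrite addr_ge0.
move=> x /= xr i; have h := le_trans (coord_le_dotp x i) xr.
have h2 : `|x 0 i| ^+ 2 <= (1 + `|r|) ^+ 2.
  rewrite real_normK ?num_real//; apply: (le_trans h); apply: (le_trans (ler_norm r)).
  by have := normr_ge0 r; set s := `|r|; nra.
by rewrite ler_sqr in h2; rewrite ?nnegrE ?addr_ge0.
Qed.

Definition kappa n : R := fine (vol (unit_ball R n)).

Lemma kappaE n : vol (unit_ball R n) = (kappa n)%:E.
Proof.
rewrite /kappa fineK// ge0_fin_numE ?vol_ge0// unit_ballE; exact: vol_sqball_lty.
Qed.

Lemma kappa_gt0 n : 0 < kappa n.
Proof.
rewrite -lte_fin -kappaE.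
apply: (@lt_le_trans _ _ (vol [set x : 'rV[R]_n | forall i, `|x 0 i| <= n.+1%:R^-1])).
  by rewrite vol_box ?invr_ge0// lte_fin exprn_gt0// mulr_gt0 ?invr_gt0.
apply: le_vol; [exact: measurable_box|exact: measurable_unit_ball|].
move=> x /= h; apply/unit_ballP.
apply: (@le_trans _ _ (\sum_(i < n) n.+1%:R^-1)).
  apply: ler_sum => i _; rewrite -expr2 -real_normK ?num_real//.
  apply: (@le_trans _ _ (n.+1%:R^-1 ^+ 2)).
    by rewrite ler_sqr ?nnegrE ?invr_ge0.
  rewrite expr2 ler_piMl ?invr_ge0// invf_le1 ?ltr0n//.
  by rewrite ler1n.
rewrite sumr_const card_ord -[_ *+ n]mulr_natl ler_pdivrMr ?ltr0n// mul1r ler_nat//.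
Qed.

Lemma vol_sqball n (r : R) : 0 < r ->
  vol (@sqball n (r ^+ 2)) = (r ^+ n * kappa n)%:E.
Proof.
move=> r0; rewrite EFinM -kappaE.
rewrite -[in RHS](invrK (r ^+ n)) -[in RHS]exprVn.
rewrite -(@vol_affine R n r^-1 0) ?invr_gt0//; last exact: measurable_unit_ball.
congr (vol _); rewrite unit_ballE; apply/seteqP; split => x /=;
by rewrite /sqball/= addr0 dotpZl dotpZr mulrA -invfM ler_pdivrMl ?mulr_gt0// mulr1 expr2.
Qed.

Lemma vol_translate n (v : 'rV[R]_n) (A : set (borel_rV R n)) : measurable A ->
  vol [set x | A (x + v)] = vol A.
Proof.
move=> mA; rewrite -[RHS]mul1e -[X in (X%:E * _)%E](invr1 R) -(expr1n R n).
by rewrite -(vol_affine v)//; congr (vol _); apply/seteqP; split => x /=; rewrite scale1r.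
Qed.

Section AdditiveBijection.
Context (n : nat) (g h : 'rV[R]_n -> 'rV[R]_n).
Hypothesis mg : measurable_fun setT (g : borel_rV R n -> borel_rV R n).
Hypothesis gD : forall x y, g (x + y) = g x + g y.
Hypothesis hK : cancel h g.

Let measurable_g2 (A : set (borel_rV R n)) (e : R) : measurable A ->
  measurable [set p : borel_rV R n * borel_rV R n | A (g p.1 + e *: (p.2 : 'rV[R]_n))].
Proof.
move=> mA.
apply: (@measurable_setP _ _ (borel_rV R n * borel_rV R n)%type (borel_rV R n)
  (fun p => g p.1 + e *: (p.2 : 'rV[R]_n)) A) => //.
apply: measurable_fun_rV => i.
rewrite [X in measurable_fun _ X](_ : _ =
  ((fun x : borel_rV R n => (g x) 0 i) \o fst) \+
  (fun p : borel_rV R n * borel_rV R n =>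
    e * ((fun x : borel_rV R n => (x : 'rV[R]_n) 0 i) \o snd) p)); last first.
  by apply/funext => x; rewrite !mxE.
apply: measurable_funD.
  apply: measurableT_comp; last exact: measurable_fst.
  exact: (measurableT_comp (measurable_coord i) mg).
apply: measurable_funM => //; apply: measurableT_comp; first exact: measurable_coord.
exact: measurable_snd.
Qed.

Let measurable_g (A : set (borel_rV R n)) : measurable A ->
  measurable ([set x | A (g x)] : set (borel_rV R n)).
Proof. by move=> mA; exact: (measurable_setP mg). Qed.

(** Translation invariance alone, through Fubini, forces the volume to be
    invariant under every additive Borel bijection that preserves one set of
    positive finite volume: iterate the integral of [1_A (g x) 1_B (g x + y)] in
    both orders. *)
Lemma vol_prod_additive (A B : set (borel_rV R n)) : measurable A -> measurable B ->
  (vol [set x | A (g x)] * vol B = vol [set x | B (g x)] * vol [set y | A (- y)%R])%E.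
Proof.
move=> mA mB.
pose S1 : set (borel_rV R n * borel_rV R n) :=
  [set p | A (g p.1)] `&` [set p | B (g p.1 + 1 *: (p.2 : 'rV[R]_n))].
pose S2 : set (borel_rV R n * borel_rV R n) :=
  [set p | B (g p.1)] `&` [set p | A (g p.1 + (-1) *: (p.2 : 'rV[R]_n))].
have mSg (C : set (borel_rV R n)) : measurable C ->
    measurable [set p : borel_rV R n * borel_rV R n | C (g p.1)].
  move=> mC; apply: (@measurable_setP _ _ (borel_rV R n * borel_rV R n)%type (borel_rV R n)
    fst [set x | C (g x)]).
    exact: measurable_fst.
  exact: measurable_g.
have mS1 : measurable S1 by apply: measurableI; [exact: mSg|exact: measurable_g2].
have mS2 : measurable S2 by apply: measurableI; [exact: mSg|exact: measurable_g2].
have sect (C D : set 'rV[R]_n) x : vol [set y | C (g x) /\ D y] = (vol D * (\1_[set x | C (g x)] x)%:E)%E.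
  rewrite indicE; have [Cx|nCx] := pselect (C (g x)).
    rewrite mem_set//= mule1; congr (vol _); apply/seteqP; split => y //=; by case.
  rewrite memNset//= mule0 -(vol_set0 n); congr (vol _).
  by apply/seteqP; split => y //= [].
have intg (C D : set (borel_rV R n)) : measurable C -> measurable D ->
  (\int[@volm R n]_x (vol D * (\1_[set x | C (g x)] x)%:E) = vol D * vol [set x | C (g x)])%E.
  move=> mC mD; rewrite ge0_integralZl//=; first last.
  - exact: vol_ge0.
  - by apply/measurable_EFinP; apply: measurable_indic; exact: measurable_g.
  by rewrite integral_indic ?setIT//; exact: measurable_g.
have -> : (vol [set x | A (g x)] * vol B = \int[@volm R n]_x (@volm R n) [set y | S1 (x, y)])%E.
  rewrite muleC -intg//; apply: eq_integral => x _; rewrite -sect.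
  transitivity (vol [set y | A (g x) /\ B (y + g x)]); last first.
    by congr (vol _); apply/seteqP; split => y; rewrite /S1/= scale1r addrC.
  rewrite -(@vol_translate n (g x) [set y | A (g x) /\ B y])//.
  have [Ax|nAx] := pselect (A (g x)).
    by rewrite [X in measurable X](_ : _ = B)//; apply/seteqP; split => y //=; case.
  by rewrite [X in measurable X](_ : _ = set0)//; apply/seteqP; split => y //= [].
rewrite fubini_sets//.
have -> : (vol [set x | B (g x)] * vol [set y | A (- y)%R] =
    \int[@volm R n]_x (@volm R n) [set y | S2 (x, y)])%E.
  have mN : measurable ([set y | A (- y)] : set (borel_rV R n)).
    apply: (@measurable_setP _ _ (borel_rV R n) (borel_rV R n) (fun y => - y) A) => //.
    have := @measurable_scale_add R n (-1) 0.
    by under eq_fun do rewrite addr0 scaleN1r.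
  rewrite muleC -intg//; apply: eq_integral => x _; rewrite -sect.
  transitivity (vol [set y | B (g x) /\ A (- (y - g x))]); last first.
    by congr (vol _); apply/seteqP; split => y; rewrite /S2/= scaleN1r opprB.
  rewrite -(@vol_translate n (- g x) [set y | B (g x) /\ A (- y)])//.
  have [Ax|nAx] := pselect (B (g x)).
    by rewrite [X in measurable X](_ : _ = [set y | A (- y)])//; apply/seteqP; split => y //=; case.
  by rewrite [X in measurable X](_ : _ = set0)//; apply/seteqP; split => y //= [].
rewrite [RHS]fubini_sets//.
apply: eq_integral => y _.
rewrite -[LHS](@vol_translate n (- h y)); last first.
  exact: (@measurable_setP _ _ (borel_rV R n) (borel_rV R n * borel_rV R n)%type
    (fun x => (x, y)) S1).
congr (vol _); apply/seteqP.
have E x : g (x - h y) = g x - y.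
  have := gD (x - h y) (h y); rewrite subrK hK => ->; by rewrite addrK.
by split => x; rewrite /S1 /S2/= E scale1r scaleN1r subrK => -[].
Qed.

End AdditiveBijection.

(** The case where the additive bijection is the identity. *)
Lemma vol_opp n (A : set (borel_rV R n)) : measurable A -> vol [set x | A (- x)] = vol A.
Proof.
move=> mA.
have := @vol_prod_additive n id id (@measurable_id _ _ _) (fun _ _ => erefl)
  (fun _ => erefl) A (unit_ball R n) mA (@measurable_unit_ball n).
rewrite /= kappaE muleC => /(congr1 (fun z => ((kappa n)^-1%:E * z)%E)).
by rewrite !muleA -!EFinM mulVf ?gt_eqF ?kappa_gt0// !mul1e.
Qed.

Lemma measurable_mulmx m n (O : 'M[R]_(m, n)) :
  measurable_fun setT ((fun x : 'rV[R]_m => x *m O) : borel_rV R m -> borel_rV R n).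
Proof.
apply: measurable_fun_rV => i.
rewrite [X in measurable_fun _ X](_ : _ =
    (fun x : borel_rV R m => \sum_j (x : 'rV[R]_m) 0 j * O j i)).
  apply: measurable_sum => j; apply: measurable_funM => //; exact: measurable_coord.
by apply/funext => x; rewrite mxE.
Qed.

Lemma dotp_orthogonal n (O : 'M[R]_n) (u v : 'rV[R]_n) : O *m O^T = 1%:M ->
  dotp (u *m O) (v *m O) = dotp u v.
Proof. by move=> OO; rewrite !dotp_mulmx trmx_mul mulmxA -(mulmxA u) OO mulmx1. Qed.

(** The unit ball is the preserved set; it fixes the constant to 1. *)
Lemma vol_orthogonal n (O : 'M[R]_n) (A : set (borel_rV R n)) :
  O *m O^T = 1%:M -> measurable A -> vol [set x | A (x *m O)] = vol A.
Proof.
move=> OO mA.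
have OK : cancel (fun x : 'rV[R]_n => x *m O^T) (fun x : 'rV[R]_n => x *m O).
  by move=> x; rewrite -mulmxA (mulmx1C OO) mulmx1.
have := @vol_prod_additive n (fun x : 'rV[R]_n => x *m O) (fun x => x *m O^T)
  (measurable_mulmx O) (fun x y => mulmxDl x y O) OK A (unit_ball R n) mA
  (@measurable_unit_ball n).
rewrite (vol_opp mA).
rewrite (_ : [set x | unit_ball R n (x *m O)] = unit_ball R n); last first.
  by apply/seteqP; split => x /unit_ballP h; apply/unit_ballP; move: h;
    rewrite dotp_orthogonal.
rewrite /= kappaE muleC => /(congr1 (fun z => ((kappa n)^-1%:E * z)%E)).
by rewrite !muleA -!EFinM mulVf ?gt_eqF ?kappa_gt0// !mul1e.
Qed.

End EuclideanBalls.

(** * Volumes of balls *)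

Section BallVolumes.
Context {R : realType}.
Local Notation leb := (@lebesgue_measure R).

Lemma integral_exprn (d : nat) (a b : R) : a <= b ->
  (\int[leb]_(x in `[a, b]) (x ^+ d)%:E = ((b ^+ d.+1 - a ^+ d.+1) / d.+1%:R)%:E)%E.
Proof.
rewrite le_eqVlt => /predU1P[<-|ab].
  by rewrite set_itv1 integral_set1 subrr mul0r.
have dF (x : R) : is_derive x 1 (fun x => x ^+ d.+1 / d.+1%:R) (x ^+ d).
  rewrite (_ : (fun x => _) = d.+1%:R^-1 \*: ((id : R -> R) ^+ d.+1)); last first.
    by apply/funext => y /=; rewrite exprfctE mulrC.
  apply: is_derive_eq.
  by rewrite /GRing.scale/= mulr1 mulrA mulVf ?pnatr_eq0// mul1r.
rewrite (@continuous_FTC2 _ (fun x => x ^+ d) (fun x => x ^+ d.+1 / d.+1%:R))//.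
- by rewrite -EFinB mulrBl.
- by apply: continuous_subspaceT => x; exact: exprn_continuous.
- have cF : continuous (fun x : R => x ^+ d.+1 / d.+1%:R).
    by move=> x; apply: differentiable_continuous; apply/derivable1_diffP; exact: (@ex_derive _ _ _ _ _ _ _ (dF x)).
  split.
  + by move=> x _; exact: (@ex_derive _ _ _ _ _ _ _ (dF x)).
  + exact/cvg_at_right_filter/cF.
  + exact/cvg_at_left_filter/cF.
- by move=> x _; rewrite derive1E; exact: derive_val.
Qed.

Lemma integral_sqrtX (d : nat) :
  (\int[leb]_(x in `[0%R, 1%R]) (Num.sqrt x ^+ d)%:E = (2 / d.+2%:R)%:E)%E.
Proof.
pose F (x : R) := 2 / d.+2%:R * Num.sqrt x ^+ d.+2.
have dF (x : R) : 0 < x -> is_derive x 1 F (Num.sqrt x ^+ d).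
  move=> x0; have dsq := is_derive1_sqrt x0.
  rewrite (_ : F = (2 / d.+2%:R) \*: ((Num.sqrt : R -> R) ^+ d.+2)); last first.
    by apply/funext => y /=; rewrite exprfctE.
  apply: is_derive_eq.
  have s0 : Num.sqrt x != 0 by rewrite gt_eqF// sqrtr_gt0.
  have : d.+2%:R != 0 :> R by rewrite pnatr_eq0.
  rewrite /GRing.scale/= exprS; move: (d.+2%:R : R) (Num.sqrt x) s0 => k s s0 k0.
  by field; rewrite s0.
have cF : continuous F.
  move=> x; apply: cvgM; first exact: cvg_cst.
  apply: (@continuous_comp _ _ _ Num.sqrt (fun y => y ^+ d.+2)).
    exact: sqrt_continuous.
  exact: exprn_continuous.
rewrite (@continuous_FTC2 _ (fun x => Num.sqrt x ^+ d) F)//.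
- by rewrite -EFinB /F sqrtr1 sqrtr0 expr1n expr0n/= mulr1 mulr0 subr0.
- apply: continuous_subspaceT => x.
  apply: (@continuous_comp _ _ _ Num.sqrt (fun y => y ^+ d)).
    exact: sqrt_continuous.
  exact: exprn_continuous.
- split.
  + move=> x; rewrite in_itv/= => /andP[x0 _].
    by exact: (@ex_derive _ _ _ _ _ _ _ (dF x x0)).
  + exact/cvg_at_right_filter/cF.
  + exact/cvg_at_left_filter/cF.
- move=> x; rewrite in_itv/= => /andP[x0 _].
  by rewrite derive1E; have := dF _ x0 => ?; exact: derive_val.
Qed.

Lemma measurable_sqrt : measurable_fun setT (Num.sqrt : R -> R).
Proof. by apply: continuous_measurable_fun; exact: sqrt_continuous. Qed.

Lemma vol_sqball_sqrt n (u : R) : 0 <= u ->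
  vol (@sqball R n u) = (Num.sqrt u ^+ n * kappa n)%:E.
Proof.
rewrite le_eqVlt => /predU1P[<-|u0]; last first.
  by rewrite -vol_sqball ?sqrtr_gt0// sqr_sqrtr// ltW.
have sq0 : @sqball R n 0 = [set x : 'rV[R]_n | forall i, `|x 0 i| <= 0].
  apply/seteqP; split => x; rewrite /sqball/= => h.
    by move: h; rewrite le_eqVlt ltNge dotp_ge0 orbF dotp_eq0 => /eqP-> i; rewrite mxE normr0.
  have -> : x = 0 by apply/rowP => i; apply/eqP; rewrite mxE -normr_le0.
  by rewrite dotp0l.
rewrite sq0 vol_box// mulr0 sqrtr0; case: n sq0 => [_|n _].
  rewrite !expr0 mul1r -kappaE unit_ballE.
  by rewrite /= indicE mem_set// /sqball/= /dotp big_ord0.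
by rewrite !exprS !mul0r.
Qed.

Lemma sqball_lt0 n (u : R) : u < 0 -> @sqball R n u = set0.
Proof.
move=> u0; apply/seteqP; split => // x /= h.
by have := lt_le_trans u0 (dotp_ge0 x); rewrite ltNge h.
Qed.

Lemma measurable_fst_rV n : measurable_fun setT (fun p : measurableTypeR R * borel_rV R n => p.1 : R).
Proof. exact: measurable_fst. Qed.

Lemma measurable_dotp_snd n :
  measurable_fun setT (fun p : measurableTypeR R * borel_rV R n => dotp (p.2 : 'rV[R]_n) p.2).
Proof.
exact: (measurableT_comp (@measurable_dotp_self R n) measurable_snd).
Qed.

(** Layer-cake: for 0 <= x <= 1 the level set {dotp y y <= x} is a ball of
    radius sqrt x. *)
Lemma integral_tent d :
  (\int[@volm R d]_y (Num.max 0 (1 - dotp y y))%:E = (2 / d.+2%:R * kappa d)%:E)%E.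
Proof.
pose S : set (measurableTypeR R * borel_rV R d) :=
  [set p | dotp (p.2 : 'rV[R]_d) p.2 <= p.1] `&` [set p | p.1 <= 1].
have mS : measurable S.
  apply: measurableI; apply: measurable_set_le => //.
  exact: measurable_dotp_snd.
transitivity (\int[@volm R d]_y leb [set x | S (x, y)])%E.
  apply: eq_integral => y _.
  rewrite (_ : [set x | _] = `[dotp y y, 1]%classic); last first.
    by apply/seteqP; split => x /=; rewrite in_itv/=; [case=> -> ->|case/andP].
  rewrite [RHS]lebesgue_measure_itv/= lte_fin.
  case: ltP => y1; first by rewrite -EFinD max_r// subr_ge0 ltW.
  by rewrite max_l// subr_le0.
rewrite -fubini_sets//.
transitivity (\int[leb]_(x in `[0%R, 1%R]) ((kappa d)%:E * (Num.sqrt x ^+ d)%:E))%E; last first.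
  rewrite ge0_integralZl//=; last 2 first.
  - apply/measurable_EFinP; apply: measurable_funX; apply: measurable_funTS.
    exact: measurable_sqrt.
  - by rewrite lee_fin ltW// kappa_gt0.
  by rewrite integral_sqrtX -EFinM mulrC.
rewrite [RHS]integral_mkcond; apply: eq_integral => x _.
rewrite /patch; case: ifPn => [|].
  rewrite inE/= in_itv/= => /andP[x0 x1].
  rewrite -EFinM mulrC -vol_sqball_sqrt//; congr (vol _).
  by apply/seteqP; split => y //= [].
rewrite notin_setE/= in_itv/= => xN.
transitivity (vol (set0 : set 'rV[R]_d)); last exact: vol_set0.
congr (vol _); apply/seteqP; split => y //= [/= h1 h2].
by apply: xN; rewrite h2 (le_trans (dotp_ge0 y)).
Qed.

Lemma measurable_fun_sec d1 d2 (T1 : measurableType d1) (T2 : measurableType d2)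
    (m2 : {sigma_finite_measure set T2 -> \bar R}) (S : set (T1 * T2)) :
  measurable S -> measurable_fun setT (fun x => m2 [set y | S (x, y)]).
Proof.
move=> mS; have := measurable_fun_xsection m2 mS.
rewrite [X in measurable_fun _ X](_ : _ = (fun x => m2 [set y | S (x, y)]))//.
by apply/funext => x /=; congr (m2 _); apply/seteqP; split => y /=; rewrite /xsection/= inE.
Qed.

(** Since (1 - x^2)^(1/2) >= (1 - |x|)^(1/2), the ball contains the set
    |x| <= 1 - |y|^2, whose volume is twice that of the tent function. *)
Lemma kappaS_ge d : 4 / d.+2%:R * kappa d <= kappa (R:=R) d.+1.
Proof.
pose S : set (measurableTypeR R * borel_rV R d) :=
  [set p | `|p.1| <= 1 - dotp (p.2 : 'rV[R]_d) p.2].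
have mS : measurable S.
  apply: measurable_set_le => //.
    by apply: measurableT_comp => //; exact: measurable_fst_rV.
  apply: measurable_funB => //; exact: measurable_dotp_snd.
rewrite -lee_fin -kappaE vol_consrV.
apply: (@le_trans _ _ (\int[leb]_x (@volm R d) [set y | S (x, y)])%E); last first.
  apply: ge0_le_integral => //.
  - exact: (measurable_fun_sec (@volm R d) mS).
  - exact: (measurable_section (@measurable_unit_ball R d.+1)).
  move=> x _; apply: le_vol.
  - apply: (@measurable_setP _ _ (borel_rV R d) (measurableTypeR R * borel_rV R d)%type
      (fun y => (x, y)) S) => //.
    exact: (@pair1_measurable _ _ (measurableTypeR R) (borel_rV R d) x).
  - exact: (measurable_rVsec x (@measurable_unit_ball R d.+1)).
  move=> y; rewrite /S/= => xy; apply/unit_ballP; rewrite dotp_consrV.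
  have := normr_ge0 x; have := dotp_ge0 y; rewrite -(real_normK (num_real x)).
  by move: (`|x|) (dotp y y) xy => a b ? ? ?; nra.
rewrite fubini_sets//.
rewrite (_ : (fun y : borel_rV R d => _) =
    (fun y => 2%:E * (Num.max 0 (1 - dotp (y : 'rV[R]_d) y))%:E)%E); last first.
  apply/funext => y.
  rewrite (_ : [set x | _] = `[- (1 - dotp (y : 'rV[R]_d) y), (1 - dotp (y : 'rV[R]_d) y)]%classic); last first.
    by apply/seteqP; split => x; rewrite /S/= in_itv/= ler_norml.
  rewrite [LHS]lebesgue_measure_itv/= lte_fin -EFinM.
  case: ltP => y1.
    by rewrite -EFinD max_r; [congr EFin; ring|lra].
  by rewrite max_l ?mulr0//; lra.
rewrite ge0_integralZl//=; last 2 first.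
- apply/measurable_EFinP; apply: measurable_maxr => //.
  by apply: measurable_funB => //; exact: measurable_dotp_self.
- by move=> y _; rewrite lee_fin le_max lexx.
by rewrite integral_tent -EFinM lee_fin mulrA; apply: ler_wpM2r; [exact/ltW/kappa_gt0|rewrite mulrA -natrM].
Qed.

(** Chernoff bound: the indicator of {dotp x x <= u} is at most
    exp (u - dotp x x), whose integral is a product of Gaussian integrals. *)
Lemma vol_sqball_le_gauss n (u : R) :
  (vol (@sqball R n u) <= (expR u * Num.sqrt pi ^+ n)%:E)%E.
Proof.
elim: n u => [|n IH] u.
  rewrite expr0 mulr1 /=; rewrite indicE lee_fin.
  have [u0|u0] := ltP u 0; first by rewrite sqball_lt0// in_set0 expR_ge0.
  rewrite mem_set/=; last by rewrite /sqball/= /dotp big_ord0.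
  by rewrite (le_trans _ (expR_ge1Dx u))//; lra.
rewrite vol_consrV.
apply: (@le_trans _ _ (\int[leb]_x ((expR u * Num.sqrt pi ^+ n)%:E * (gauss_fun x)%:E))%E).
  apply: ge0_le_integral => //.
  - by move=> x _; exact: vol_ge0.
  - exact: (measurable_section (@measurable_sqball R n.+1 u)).
  - apply/measurable_EFinP; apply: measurable_funM => //; exact: measurable_gauss_fun.
  move=> x _; rewrite -EFinM mulrAC -expRD.
  rewrite (_ : [set y | _] = sqball (u - x ^+ 2)) ?IH//.
  by apply/seteqP; split => y; rewrite /sqball/= dotp_consrV => h; lra.
rewrite ge0_integralZl//=; last 2 first.
- by apply/measurable_EFinP; exact: measurable_gauss_fun.
- by move=> x _; rewrite lee_fin gauss_fun_ge0.
by rewrite integralT_gauss -EFinM -mulrA -exprSr.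
Qed.

End BallVolumes.

(** * The second moment bound on a convex base *)

Section BoundedIntegrals.
Context {R : realType} {d : measure_display} {T : measurableType d}.
Context (mu : {measure set T -> \bar R}) (Z : set T).
Hypothesis mZ : measurable Z.
Hypothesis Zfin : (mu Z < +oo)%E.

(** Every integrand on a bounded base is of this kind; the class is closed
    under the operations used and makes the real-valued integral linear. *)
Definition tame (f : T -> R) :=
  measurable_fun setT f /\ exists M, forall x, Z x -> `|f x| <= M.

Lemma tame_integrable f : tame f -> mu.-integrable Z (EFin \o f).
Proof.
move=> [mf [M fM]]; apply: measurable_bounded_integrable => //.
  exact: measurable_funTS.
exists M; split; first exact: num_real.
by move=> x Mx y Zy; rewrite /= (le_trans (fM y Zy))// ltW.
Qed.

Lemma tame_cst c : tame (fun=> c).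
Proof. by split; [exact: measurable_cst|exists `|c|]. Qed.

Lemma tameD f g : tame f -> tame g -> tame (fun x => f x + g x).
Proof.
move=> [mf [M fM]] [mg [N gN]]; split; first exact: measurable_funD.
by exists (M + N) => x Zx; rewrite (le_trans (ler_normD _ _))// lerD ?fM ?gN.
Qed.

Lemma tameM f g : tame f -> tame g -> tame (fun x => f x * g x).
Proof.
move=> [mf [M fM]] [mg [N gN]]; split; first exact: measurable_funM.
by exists (M * N) => x Zx; rewrite normrM ler_pM ?fM ?gN.
Qed.

Lemma tame_norm f : tame f -> tame (fun x => `|f x|).
Proof.
move=> [mf [M fM]]; split; first exact: measurableT_comp.
by exists M => x Zx; rewrite normr_id fM.
Qed.

Lemma tame_sum (I : Type) (s : seq I) (f : I -> T -> R) :
  (forall i, tame (f i)) -> tame (fun x => \sum_(i <- s) f i x).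
Proof.
move=> tf; elim: s => [|i s IH].
  by under eq_fun do rewrite big_nil; exact: tame_cst.
by under eq_fun do rewrite big_cons; exact: tameD.
Qed.

Lemma tame_intD f g : tame f -> tame g ->
  \int[mu]_(x in Z) (f x + g x) = \int[mu]_(x in Z) f x + \int[mu]_(x in Z) g x.
Proof. by move=> tf tg; rewrite RintegralD//; exact: tame_integrable. Qed.

Lemma tame_intZ c f : tame f ->
  \int[mu]_(x in Z) (c * f x) = c * \int[mu]_(x in Z) f x.
Proof. by move=> tf; rewrite RintegralZl//; exact: tame_integrable. Qed.

Lemma tame_int_sum (I : Type) (s : seq I) (f : I -> T -> R) :
  (forall i, tame (f i)) ->
  \int[mu]_(x in Z) (\sum_(i <- s) f i x) = \sum_(i <- s) \int[mu]_(x in Z) f i x.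
Proof.
move=> tf; elim: s => [|i s IH].
  under eq_Rintegral do rewrite big_nil.
  by rewrite Rintegral_cst// mul0r big_nil.
under eq_Rintegral do rewrite big_cons.
by rewrite big_cons tame_intD ?IH//; exact: tame_sum.
Qed.

Lemma tame_int_le f g : tame f -> tame g -> (forall x, Z x -> f x <= g x) ->
  \int[mu]_(x in Z) f x <= \int[mu]_(x in Z) g x.
Proof. by move=> tf tg fg; apply: le_Rintegral => //; exact: tame_integrable. Qed.

Lemma tame_intE f : tame f ->
  (\int[mu]_(x in Z) f x)%:E = (\int[mu]_(x in Z) (f x)%:E)%E.
Proof. by move=> tf; rewrite fineK//; apply: integrable_fin_num => //; exact: tame_integrable. Qed.

End BoundedIntegrals.

(** In this section Z is the convex base of a cone, truncated to be bounded,
    and g = b^2 |y|^2 - e measures how far the facet is from the sphere over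
    the point y.  The level e is arbitrary: it depends on the distance of the
    facet from the origin, which an approximating polytope may choose freely.
    What cannot be chosen away is the curvature b^2 of g. *)
Section QuadraticOnConvexCell.
Context {R : realType} {d : nat}.
Local Notation mu := (@volm R d).
Context (Z : set 'rV[R]_d) (M : R).
Hypothesis mZ : measurable (Z : set (borel_rV R d)).
Hypothesis ZM : forall x, Z x -> dotp x x <= M.
Context (b e lam : R).
Hypothesis lam01 : 0 < lam < 1.
Hypothesis Zconv : forall x y, Z x -> Z y -> Z (lam *: x + (1 - lam) *: y).

Let g (x : 'rV[R]_d) : R := b ^+ 2 * dotp x x - e.
Let I (f : borel_rV R d -> R) : R := \int[mu]_(x in Z) f x.
Let v := fine (vol Z).
Let J := I (fun x => `|g x|).
Let A0 := I (fun x => dotp (x : 'rV[R]_d) x).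
Let B : 'rV[R]_d := \row_i I (fun x => (x : 'rV[R]_d) 0 i).
Local Notation tame := (@tame R _ (borel_rV R d) Z).

Let Zfin : (mu Z < +oo)%E.
Proof.
apply: (le_lt_trans _ (@vol_sqball_lty R d M)).
by apply: le_vol => //; exact: measurable_sqball.
Qed.

Let tame_coord i : tame (fun x => (x : 'rV[R]_d) 0 i).
Proof.
split; first exact: measurable_coord.
exists (1 + `|M|) => x Zx; rewrite -ler_sqr ?nnegrE ?addr_ge0//.
rewrite real_normK ?num_real//; apply: (le_trans (coord_le_dotp x i)).
apply: (le_trans (ZM Zx)); apply: (le_trans (ler_norm M)).
by have := normr_ge0 M; set s := `|M|; nra.
Qed.

Let tame_dotp (c : 'rV[R]_d) : tame (fun x => dotp (x : 'rV[R]_d) c).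
Proof. by apply: tame_sum => i; apply: tameM => //; exact: tame_cst. Qed.

Let tame_sq : tame (fun x => dotp (x : 'rV[R]_d) x).
Proof. by apply: tame_sum => i; apply: tameM. Qed.

Let tame_g : tame g.
Proof.
apply: tameD; last exact: tame_cst.
by apply: tameM => //; exact: tame_cst.
Qed.

Let int_cst (c : R) : I (fun=> c) = c * v.
Proof. by rewrite /I Rintegral_cst. Qed.

Let int_dotp (c : 'rV[R]_d) : I (fun x => dotp (x : 'rV[R]_d) c) = dotp B c.
Proof.
rewrite /I /dotp tame_int_sum//; last first.
  by move=> i; apply: tameM => //; exact: tame_cst.
apply: eq_bigr => i _; rewrite mxE mulrC -tame_intZ//.
by apply: eq_Rintegral => x _; rewrite mulrC.
Qed.

Let dotp_sub (x c : 'rV[R]_d) :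
  dotp (x - c) (x - c) = dotp x x + ((-2) * dotp x c + dotp c c).
Proof. by rewrite dotpBl !dotpBr (dotpC c x); ring. Qed.

Let int_dist (c : 'rV[R]_d) :
  I (fun x => dotp ((x : 'rV[R]_d) - c) (x - c)) = A0 + ((-2) * dotp B c + dotp c c * v).
Proof.
rewrite /I; under eq_Rintegral do rewrite dotp_sub.
have t1 : tame (fun x => (-2) * dotp (x : 'rV[R]_d) c).
  by apply: tameM => //; exact: tame_cst.
have t2 : tame (fun=> dotp c c) by exact: tame_cst.
rewrite tame_intD//; last exact: tameD.
rewrite tame_intD// tame_intZ//.
by congr (_ + (_ * _ + _)); [exact: int_dotp|exact: int_cst].
Qed.

(** The contraction of ratio lam towards eta maps the cell into itself, so that
    averaging |g| over the image costs at most the Jacobian lam^-d. *)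
Let int_contract (eta : 'rV[R]_d) : Z eta ->
  I (fun x => `|g (lam *: (x : 'rV[R]_d) + (1 - lam) *: eta)|) <= lam ^- d * J.
Proof.
move=> Zeta; have /andP[l0 l1] := lam01.
have mgn : measurable_fun setT (fun x : borel_rV R d => `|g x|).
  by case: (tame_norm tame_g).
pose h (y : 'rV[R]_d) : \bar R := (`|g y| * \1_Z y)%:E.
have mh : measurable_fun setT (h : borel_rV R d -> \bar R).
  apply/measurable_EFinP; apply: measurable_funM => //.
have h0 y : (0 <= h y)%E by rewrite lee_fin mulr_ge0.
have hE : (\int[mu]_x h x = \int[mu]_(x in Z) (`|g x|)%:E)%E.
  rewrite [RHS]integral_mkcond; apply: eq_integral => x _.
  rewrite /patch /h indicE; case: ifPn => xZ; first by rewrite mulr1.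
  by rewrite mulr0.
have := ge0_integral_affine_rV ((1 - lam) *: eta) l0 mh h0.
have tz : tame (fun x => `|g (lam *: (x : 'rV[R]_d) + (1 - lam) *: eta)|).
  split.
    exact: (measurableT_comp mgn (measurable_scale_add lam _)).
  have [_ [N gN]] := tame_norm tame_g.
  by exists N => x Zx; apply: gN; exact: Zconv.
rewrite -lee_fin EFinM [(I _)%:E](tame_intE _ _ tz)// [J%:E](tame_intE _ _ (tame_norm tame_g))//.
rewrite -hE => <-.
rewrite integral_mkcond; apply: ge0_le_integral => //=.
- by move=> x _; rewrite /patch; case: ifPn => // _; rewrite lee_fin.
- apply/(measurable_restrictT _ _).1 => //.
  by apply/measurable_EFinP; apply: measurable_funTS; case: tz.
- exact: (measurableT_comp mh (measurable_scale_add lam _)).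
move=> x _; rewrite /patch; case: ifPn => // xZ.
rewrite /h indicE mem_set ?mulr1//; apply: Zconv => //; exact: set_mem.
Qed.

(** Strong convexity of the quadratic g along segments. *)
Let g_comb (x y : 'rV[R]_d) :
  g (lam *: x + (1 - lam) *: y) =
  lam * g x + (1 - lam) * g y - lam * (1 - lam) * b ^+ 2 * dotp (x - y) (x - y).
Proof.
rewrite /g dotp_sub !(dotpDl, dotpDr, dotpZl, dotpZr) (dotpC y x); ring.
Qed.

(** For x and y in Z, the strong convexity of g bounds
    lam (1 - lam) b^2 |x - y|^2 by |g| at x, at y and at the contracted point.
    Integrating over x and then y turns the left side into the second moment
    of Z about its centroid, and the right side into a multiple of the integral
    of |g|. *)
Let spread_le : lam * (1 - lam) * b ^+ 2 * (2 * (v * A0 - dotp B B)) <=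
  (1 + lam ^- d) * J * v.
Proof.
have /andP[l0 l1] := lam01.
have step eta : Z eta ->
    lam * (1 - lam) * b ^+ 2 * (A0 + ((-2) * dotp eta B + dotp eta eta * v)) <=
    (lam + lam ^- d) * J + (1 - lam) * v * `|g eta|.
  move=> Zeta; rewrite (dotpC eta B) -int_dist.
  have td : tame (fun x => dotp ((x : 'rV[R]_d) - eta) (x - eta)).
    rewrite [X in tame X](_ : _ = (fun x => dotp (x : 'rV[R]_d) x + ((-2) * dotp (x : 'rV[R]_d) eta + dotp eta eta))).
      apply: tameD => //; apply: tameD; last exact: tame_cst.
      by apply: tameM => //; exact: tame_cst.
    by apply/funext => x; rewrite dotp_sub.
  have tz : tame (fun x => `|g (lam *: (x : 'rV[R]_d) + (1 - lam) *: eta)|).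
    have [mgn [N gN]] := tame_norm tame_g.
    split; first exact: (measurableT_comp mgn (measurable_scale_add lam _)).
    by exists N => x Zx; apply: gN; exact: Zconv.
  have tg : tame (fun x => lam * `|g x|).
    by apply: tameM; [exact: tame_cst|exact: tame_norm].
  have tc : tame (fun=> (1 - lam) * `|g eta|) by exact: tame_cst.
  rewrite -[X in X <= _](tame_intZ mZ Zfin _ td).
  apply: (@le_trans _ _ (I (fun x => lam * `|g x| + ((1 - lam) * `|g eta| +
     `|g (lam *: (x : 'rV[R]_d) + (1 - lam) *: eta)|)))).
    apply: tame_int_le => //.
    - by apply: tameM => //; exact: tame_cst.
    - by apply: tameD => //; exact: tameD.
    move=> x Zx; have := g_comb x eta.
    have h1 := ler_norm (g x); have h2 := ler_norm (g eta).
    have h3 := ler_norm (- g (lam *: x + (1 - lam) *: eta)); rewrite normrN in h3.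
    have h4 : lam * g x <= lam * `|g x| by rewrite ler_wpM2l// ltW.
    have h5 : (1 - lam) * g eta <= (1 - lam) * `|g eta| by rewrite ler_wpM2l// subr_ge0 ltW.
    by move: h3 h4 h5; move: (g (_ + _)) => gz; lra.
  rewrite /I tame_intD//; last exact: tameD.
  rewrite tame_intD// tame_intZ//; last exact: tame_norm.
  have := int_contract Zeta; rewrite -/J -/(I _) -/(I _) -/(I _) int_cst => h.
  rewrite [X in _ <= X](_ : _ = lam * J + ((1 - lam) * `|g eta| * v + lam ^- d * J)).
    by rewrite lerD2l lerD2l.
  by move: (lam ^- d) => ld; ring.
have tL : tame (fun eta => lam * (1 - lam) * b ^+ 2 *
    (A0 + ((-2) * dotp (eta : 'rV[R]_d) B + dotp (eta : 'rV[R]_d) eta * v))).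
  apply: tameM; first exact: tame_cst.
  apply: tameD; first exact: tame_cst.
  by apply: tameD; apply: tameM => //; exact: tame_cst.
have tR1 : tame (fun eta => (1 - lam) * v * `|g eta|).
  by apply: tameM; [exact: tame_cst|exact: tame_norm].
have tR : tame (fun eta => (lam + lam ^- d) * J + (1 - lam) * v * `|g eta|).
  by apply: tameD => //; exact: tame_cst.
have := tame_int_le mZ Zfin tL tR step.
have tD : tame (fun eta => (-2) * dotp (eta : 'rV[R]_d) B).
  by apply: tameM => //; exact: tame_cst.
have tE : tame (fun eta => dotp (eta : 'rV[R]_d) eta * v).
  by apply: tameM => //; exact: tame_cst.
rewrite tame_intZ//; last by apply: tameD; [exact: tame_cst|exact: tameD].
rewrite tame_intD//; [|exact: tame_cst|exact: tameD].
rewrite tame_intD//; rewrite tame_intZ//.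
rewrite tame_intD//; last exact: tame_cst.
have E1 := int_dotp B.
have E2 : I (fun eta => dotp (eta : 'rV[R]_d) eta * v) = v * A0.
  rewrite /I -[RHS]tame_intZ//.
  by apply: eq_Rintegral => x _; rewrite mulrC.
have E3 := int_cst A0.
have E4 := int_cst ((lam + lam ^- d) * J).
have E5 : I (fun eta => (1 - lam) * v * `|g eta|) = (1 - lam) * v * J.
  by rewrite [LHS]tame_intZ//; exact: tame_norm.
move: E1 E2 E3 E4 E5; rewrite /I => -> -> -> -> ->.
move: (lam ^- d) (b ^+ 2) (dotp B B) => ld bb BB.
by move=> h; apply: le_trans (le_trans _ h) _; rewrite le_eqVlt; apply/orP; left;
  apply/eqP; ring.
Qed.

(** Bathtub principle: among sets of given volume, a ball about c has the
    smallest second moment about c.  In this penalized form the bound is linear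
    in the volume, so that one radius r can serve all cells at once. *)
Let bathtub (c : 'rV[R]_d) (r : R) : 0 < r ->
  r ^+ 2 * v - r ^+ d.+2 * (2 / d.+2%:R * kappa d) <=
  A0 + ((-2) * dotp B c + dotp c c * v).
Proof.
move=> r0; rewrite -int_dist.
have td : tame (fun x => dotp ((x : 'rV[R]_d) - c) (x - c)).
  rewrite [X in tame X](_ : _ = (fun x => dotp (x : 'rV[R]_d) x + ((-2) * dotp (x : 'rV[R]_d) c + dotp c c))).
    apply: tameD => //; apply: tameD; last exact: tame_cst.
    by apply: tameM => //; exact: tame_cst.
  by apply/funext => x; rewrite dotp_sub.
pose f (x : borel_rV R d) : R := r ^+ 2 + (-1) * dotp ((x : 'rV[R]_d) - c) (x - c).
have tf : tame f.
  by apply: tameD; [|apply: tameM => //]; exact: tame_cst.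
suff : I f <= r ^+ d.+2 * (2 / d.+2%:R * kappa d).
  have -> : I f = r ^+ 2 * v + (-1) * I (fun x => dotp ((x : 'rV[R]_d) - c) (x - c)).
    rewrite /I /f tame_intD//; [|exact: tame_cst|by apply: tameM => //; exact: tame_cst].
    by rewrite (tame_intZ mZ Zfin (-1) td); congr (_ + _); exact: int_cst.
  by rewrite mulN1r lerBlDr lerBlDr addrC.
pose h (y : 'rV[R]_d) : \bar R := ((r ^+ 2)%:E * (Num.max 0 (1 - dotp y y))%:E)%E.
have mt : measurable_fun setT (fun y : borel_rV R d => (Num.max 0 (1 - dotp (y : 'rV[R]_d) y))%:E).
  apply/measurable_EFinP; apply: measurable_maxr => //.
  by apply: measurable_funB => //; exact: measurable_dotp_self.
have t0 (y : 'rV[R]_d) : (0 <= (Num.max 0 (1 - dotp y y))%:E)%E.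
  by rewrite lee_fin le_max lexx.
have r20 : (0 <= (r ^+ 2)%:E)%E by rewrite lee_fin exprn_ge0// ltW.
have mh : measurable_fun setT (h : borel_rV R d -> \bar R).
  by apply: emeasurable_funM => //.
have h0 y : (0 <= h y)%E by rewrite mule_ge0.
have ri0 : 0 < r^-1 by rewrite invr_gt0.
have := ge0_integral_affine_rV (- (r^-1 *: c)) ri0 mh h0.
have -> : (\int[mu]_x h x = (r ^+ 2 * (2 / d.+2%:R * kappa d))%:E)%E.
  by rewrite /h ge0_integralZl//= integral_tent -EFinM.
rewrite exprVn invrK -EFinM.
rewrite (_ : r ^+ d * (r ^+ 2 * _) = r ^+ d.+2 * (2 / d.+2%:R * kappa d)); last first.
  by rewrite mulrA -exprD addn2.
rewrite -lee_fin => <-.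
rewrite [(I f)%:E]tame_intE// integral_mkcond.
have -> : (\int[mu]_x h (r^-1 *: x - r^-1 *: c)%R)%E = (\int[mu]_x (Num.max 0 (f x))%:E)%E.
  apply: eq_integral => x _; rewrite /h -EFinM /f; congr EFin.
  rewrite -scalerBr dotpZl dotpZr maxr_pMr ?exprn_ge0 ?(ltW r0)// mulr0.
  by congr Num.max; field; rewrite gt_eqF.
apply: (@le_trans _ _ (\int[mu]_x (((fun x => (Num.max 0 (f x))%:E) \_ Z) x)%E)%E).
  rewrite -!integral_mkcond; apply: le_integral => //.
  - exact: tame_integrable.
  - apply: tame_integrable => //; case: tf => mf [N fN]; split.
      exact: measurable_maxr.
    by exists N => x Zx; rewrite (le_trans _ (fN x Zx))// /Num.max; case: ifPn => // _; rewrite normr0.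
  - by move=> x _; rewrite lee_fin le_max lexx orbT.
rewrite -integral_mkcond; apply: ge0_subset_integral => //.
- by apply/measurable_EFinP; apply: measurable_maxr => //; case: tf.
- by move=> x _; rewrite lee_fin le_max lexx.
Qed.

Let J_ge0 : 0 <= J.
Proof. by apply: Rintegral_ge0. Qed.

Let v_ge0 : 0 <= v.
Proof. by rewrite fine_ge0// vol_ge0. Qed.

(** The spread bound of a convex set combined with the bathtub principle about
    its centroid. *)
Lemma quadratic_cell_bound (r : R) : 0 < r ->
  2 * lam * (1 - lam) * b ^+ 2 *
    (r ^+ 2 * v - r ^+ d.+2 * (2 / d.+2%:R * kappa d)) <= (1 + lam ^- d) * J.
Proof.
move=> r0; have /andP[l0 l1] := lam01.
have ld0 : 0 <= lam ^- d by rewrite invr_ge0 exprn_ge0// ltW.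
have c0 : 0 <= lam * (1 - lam) * b ^+ 2.
  by rewrite mulr_ge0 ?sqr_ge0// mulr_ge0 ?subr_ge0// ltW.
have [v0|v0] := eqVneq v 0.
  apply: (@le_trans _ _ 0); last by rewrite mulr_ge0// addr_ge0.
  have T0 : 0 <= r ^+ d.+2 * (2 / d.+2%:R * kappa d).
    rewrite mulr_ge0 ?exprn_ge0 ?(ltW r0)// mulr_ge0 ?divr_ge0//; exact/ltW/kappa_gt0.
  rewrite v0 mulr0 sub0r mulrN oppr_le0 mulr_ge0//.
  by rewrite -!mulrA mulr_ge0// mulrA.
have vpos : 0 < v by rewrite lt_def v0 v_ge0.
(* v^-1 *: B is the centroid of Z *)
have := bathtub (v^-1 *: B) r0.
rewrite dotpZr dotpZl dotpZr.
set Phi := r ^+ 2 * v - _ => h.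
have h2 : Phi * v <= v * A0 - dotp B B.
  rewrite -(ler_pM2r vpos) in h; apply: (le_trans h).
  by rewrite le_eqVlt; apply/orP; left; apply/eqP; field.
have h3 := ler_wpM2l c0 h2.
rewrite -(ler_pM2r vpos); apply: (le_trans _ spread_le).
rewrite [X in _ <= X]mulrCA.
rewrite (_ : _ * v = 2 * (lam * (1 - lam) * b ^+ 2 * (Phi * v))); last by ring.
by rewrite ler_pM2l.
Qed.

End QuadraticOnConvexCell.

(** * Volumes in a cone over a flat base *)

Section ConeCoordinates.
Context {R : realType} (d : nat).
Local Notation leb := (@lebesgue_measure R).
Local Notation mu := (@volm R d).

(** Coordinates (h, y) -> (h, h y) adapted to a cone; the Jacobian is h^d. *)
Lemma vol_cone_coordinates (A : set (borel_rV R d.+1))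
    (S : set (measurableTypeR R * borel_rV R d)) :
  measurable A -> measurable S ->
  (forall h y, A (consrV (h, y)) -> 0 < h) ->
  (forall h y, S (h, y) -> 0 < h) ->
  (forall h y, 0 < h -> A (consrV (h, h *: y)) <-> S (h, y)) ->
  vol A = (\int[mu]_y \int[leb]_h ((h ^+ d)%R * \1_S (h, y))%:E)%E.
Proof.
move=> mA mS A0 S0 AS.
have mS' h : measurable ([set y | S (h, y)] : set (borel_rV R d)).
  apply: (@measurable_setP _ _ (borel_rV R d) (measurableTypeR R * borel_rV R d)%type
    (fun y => (h, y)) S) => //.
  exact: (@pair1_measurable _ _ (measurableTypeR R) (borel_rV R d) h).
rewrite -(@fubini_tonelli _ _ (measurableTypeR R) (borel_rV R d) R leb mu
  (fun p => ((p.1 ^+ d)%R * \1_S p)%:E)); first last.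
- move=> [h y]; rewrite lee_fin indicE; case: (boolP (_ \in S)) => hS; last by rewrite mulr0.
  by rewrite mulr1 exprn_ge0// ltW//; apply: (S0 h y); exact: set_mem.
- apply/measurable_EFinP; apply: measurable_funM; last exact: measurable_indic.
  apply: measurable_funX; exact: measurable_fst.
rewrite vol_consrV; apply: eq_integral => h _.
have [h0|h0] := ltP 0 h; last first.
  rewrite (_ : [set y | _] = set0); last first.
    by apply/seteqP; split => y //= /A0; rewrite ltNge h0.
  rewrite vol_set0; apply/esym; apply: integral0_eq => y _ /=.
  by rewrite indicE memNset ?mulr0// => /S0; rewrite ltNge h0.
transitivity ((h ^+ d)%:E * vol [set y | S (h, y)])%E; last first.
  transitivity (\int[mu]_y ((h ^+ d)%:E * (\1_[set y | S (h, y)] y)%:E))%E.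
    rewrite ge0_integralZl//=; last 2 first.
    - by apply/measurable_EFinP; apply: measurable_indic.
    - by rewrite lee_fin exprn_ge0// ltW.
    by rewrite integral_indic ?setIT.
  by apply: eq_integral => y _; rewrite -EFinM !indicE; congr ((_ * (_ : bool)%:R)%:E);
    apply/idP/idP; rewrite !inE.
rewrite (_ : [set y | S (h, y)] =
    [set y | [set y | A (consrV (h, y))] (h *: y + 0)]); last first.
  by apply/seteqP; split => y /=; rewrite addr0 => /AS; apply.
rewrite vol_affine//; last exact: measurable_rVsec.
by rewrite muleA -EFinM mulfV ?mul1e// expf_neq0// gt_eqF.
Qed.

Lemma integral_exprn_oc (a b : R) : 0 <= a -> a <= b ->
  (\int[leb]_h (h ^+ d * \1_(`]a, b]%classic) h)%:E =
   ((b ^+ d.+1 - a ^+ d.+1) / d.+1%:R)%:E)%E.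
Proof.
move=> a0 ab.
have -> : (\int[leb]_h (h ^+ d * \1_(`]a, b]%classic) h)%:E =
    \int[leb]_(h in `]a, b]) (h ^+ d)%:E)%E.
  rewrite [RHS]integral_mkcond; apply: eq_integral => h _.
  by rewrite /patch indicE; case: ifPn; rewrite ?mulr1 ?mulr0.
rewrite integral_itv_obnd_cbnd; last first.
  by apply/measurable_EFinP; apply: measurable_funX.
exact: integral_exprn.
Qed.

Lemma consrV_scale (h : R) (y : 'rV[R]_d) : consrV (h, h *: y) = h *: consrV (1, y).
Proof.
have := scale_consrVD h 1 y 0; rewrite addr0 mulr1 mxE addr0 => ->.
by congr (consrV (_, _)); rewrite -[LHS]addr0; congr (_ + _); apply/rowP => j; rewrite !mxE.
Qed.

Context (K : set 'rV[R]_d.+1) (b : R).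
Hypothesis mK : measurable (K : set (borel_rV R d.+1)).
Hypothesis K0 : forall x, K x -> 0 < x 0 0.
Hypothesis KZ : forall (h : R) x, 0 < h -> K x -> K (h *: x).
Hypothesis KD : forall x y, K x -> K y -> K (x + y).
Hypothesis b0 : 0 < b.

Definition cone_base : set 'rV[R]_d := [set y | K (consrV (1, y))].
Local Notation Y := cone_base.

Lemma cone_baseP h y : 0 < h -> K (consrV (h, h *: y)) <-> Y y.
Proof.
move=> h0; rewrite consrV_scale; split => [|yY]; last exact: KZ.
move=> /(KZ (h := h^-1)); rewrite invr_gt0 => /(_ h0).
by rewrite scalerA mulVf ?scale1r// gt_eqF.
Qed.

Lemma measurable_cone_base : measurable (Y : set (borel_rV R d)).
Proof. exact: measurable_rVsec. Qed.

Lemma cone_base_conv lam x y : 0 < lam < 1 -> Y x -> Y y ->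
  Y (lam *: x + (1 - lam) *: y).
Proof.
move=> /andP[l0 l1] Yx Yy; rewrite /cone_base/=.
have -> : consrV (1, lam *: x + (1 - lam) *: y) =
    lam *: consrV (1, x) + (1 - lam) *: consrV (1, y).
  rewrite -(consrV_scale (1 - lam) y) scale_consrVD consrV0 consrVK/= mulr1.
  by rewrite [in RHS](addrC lam (1 - lam)) subrK.
by apply: KD; apply: KZ => //; rewrite subr_gt0.
Qed.

Let measurable_x00 : measurable_fun setT (fun x : borel_rV R d.+1 => (x : 'rV[R]_d.+1) 0 0).
Proof. exact: measurable_coord. Qed.

Let measurable_bY : measurable [set p : measurableTypeR R * borel_rV R d | Y p.2].
Proof.
apply: (@measurable_setP _ _ (measurableTypeR R * borel_rV R d)%type (borel_rV R d) snd Y).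
  exact: measurable_snd.
exact: measurable_cone_base.
Qed.

Definition cone_cap : set 'rV[R]_d.+1 := K `&` [set x : 'rV[R]_d.+1 | x 0 0 <= b].

Lemma measurable_cone_cap : measurable (cone_cap : set (borel_rV R d.+1)).
Proof. by apply: measurableI => //; apply: measurable_set_le. Qed.

Lemma vol_cone_cap : vol cone_cap = ((b ^+ d.+1 / d.+1%:R)%:E * vol Y)%E.
Proof.
pose S : set (measurableTypeR R * borel_rV R d) :=
  [set p | Y p.2] `&` ([set p | 0 < p.1] `&` [set p | p.1 <= b]).
have mS : measurable S.
  apply: measurableI => //; apply: measurableI.
    by apply: measurable_set_lt => //; exact: measurable_fst_rV.
  by apply: measurable_set_le => //; exact: measurable_fst_rV.
rewrite (vol_cone_coordinates measurable_cone_cap mS).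
- transitivity (\int[mu]_y ((b ^+ d.+1 / d.+1%:R)%:E * (\1_Y y)%:E))%E; last first.
    rewrite ge0_integralZl//=; last 2 first.
    - apply/measurable_EFinP; apply: measurable_indic; exact: measurable_cone_base.
    - by rewrite lee_fin divr_ge0// exprn_ge0// ltW.
    by rewrite integral_indic ?setIT//; exact: measurable_cone_base.
  apply: eq_integral => y _.
  have [Yy|Yy] := pselect (Y y).
    rewrite indicE mem_set// mule1.
    have := integral_exprn_oc (lexx 0) (ltW b0); rewrite expr0n subr0 => <-.
    apply: eq_integral => h _; rewrite !indicE; congr ((_ * (_ : bool)%:R)%:E).
    apply/idP/idP; rewrite !inE /S/= in_itv/=; first by case=> _ [-> ->].
    by move=> /andP[].
  rewrite indicE memNset// mule0; apply: integral0_eq => h _.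
  by rewrite indicE memNset ?mulr0//; case.
- by move=> h y [/K0]; rewrite consrV0.
- by move=> h y [_ []].
move=> h y h0; rewrite /cone_cap/S/= consrV0; have := cone_baseP y h0.
by move=> E; split=> [[/E]|[/E ? []]].
Qed.

Definition cone_diff : set 'rV[R]_d.+1 :=
  K `&` [set x : 'rV[R]_d.+1 | (x 0 0 <= b) != (dotp x x <= 1)].

Lemma measurable_cone_diff : measurable (cone_diff : set (borel_rV R d.+1)).
Proof.
apply: measurableI => //.
have m1 : measurable ([set x | x 0 0 <= b] : set (borel_rV R d.+1)).
  exact: measurable_set_le.
have m2 := @measurable_sqball R d.+1 1.
rewrite (_ : [set x | _] = [set x : 'rV[R]_d.+1 | x 0 0 <= b] `+` @sqball R d.+1 1).
  by apply: measurableU; exact: measurableD.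
apply/seteqP; split => x; rewrite /sqball/= /setY/=.
  by case: (_ <= b); case: (_ <= 1) => //= _; [left|right].
by case=> -[]; case: (_ <= b); case: (_ <= 1).
Qed.

(** The ray over y meets the unit sphere at height (base_gauge y)^-1. *)
Definition base_gauge (y : 'rV[R]_d) : R := Num.sqrt (1 + dotp y y).

Lemma base_gauge_gt0 y : 0 < base_gauge y.
Proof. by rewrite sqrtr_gt0 ltr_wpDr// dotp_ge0. Qed.

Lemma measurable_base_gauge : measurable_fun setT (base_gauge : borel_rV R d -> R).
Proof.
apply: (measurableT_comp measurable_sqrt); apply: measurable_funD => //.
exact: measurable_dotp_self.
Qed.

Lemma vol_cone_diff : vol cone_diff =
  (\int[mu]_(y in Y) (`|b ^+ d.+1 - base_gauge y ^- d.+1| / d.+1%:R)%:E)%E.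
Proof.
pose S : set (measurableTypeR R * borel_rV R d) :=
  [set p | Y p.2] `&` ([set p | 0 < p.1] `&`
    ([set p | p.1 <= b] `+` [set p | p.1 * base_gauge p.2 <= 1])).
have mS : measurable S.
  apply: measurableI => //; apply: measurableI.
    by apply: measurable_set_lt => //; exact: measurable_fst_rV.
  have m1 : measurable [set p : measurableTypeR R * borel_rV R d | p.1 <= b].
    by apply: measurable_set_le => //; exact: measurable_fst_rV.
  have m2 : measurable [set p : measurableTypeR R * borel_rV R d |
      p.1 * base_gauge p.2 <= 1].
    apply: measurable_set_le => //; apply: measurable_funM; first exact: measurable_fst_rV.
    exact: (measurableT_comp measurable_base_gauge measurable_snd).
  by apply: measurableU; exact: measurableD.
rewrite (vol_cone_coordinates measurable_cone_diff mS).
- rewrite [RHS]integral_mkcond; apply: eq_integral => y _.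
  rewrite /patch; case: ifPn => [/set_mem Yy|yN]; last first.
    apply: integral0_eq => h _; rewrite indicE memNset ?mulr0//.
    by case=> /= /mem_set h1; rewrite h1 in yN.
  pose r := (base_gauge y)^-1.
  have r0 : 0 < r by rewrite invr_gt0 base_gauge_gt0.
  have -> : `|b ^+ d.+1 - base_gauge y ^- d.+1| =
      Num.max b r ^+ d.+1 - Num.min b r ^+ d.+1.
    rewrite -exprVn -/r; have [br|rb] := leP b r.
      by rewrite distrC ger0_norm// subr_ge0 lerXn2r ?nnegrE// ltW.
    by rewrite ger0_norm// subr_ge0 lerXn2r ?nnegrE// ltW.
  rewrite -integral_exprn_oc; last 2 first.
  - by rewrite le_min !ltW.
  - by rewrite le_max !ge_min lexx.
  apply: eq_integral => h _; rewrite !indicE; congr ((_ * (_ : bool)%:R)%:E).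
  have hr : (h * base_gauge y <= 1) = (h <= r).
    by rewrite -[in RHS](mul1r r) ler_pdivlMr// base_gauge_gt0.
  apply/idP/idP; rewrite !inE /S/= in_itv/= hr gt_min le_max.
    by case=> _ [_] [[h1 /negP]|[h1 /negP]]; rewrite -ltNge h1 => ->; rewrite ?orbT.
  move=> /andP[h1 h2]; split => //; split.
    by case/orP: h1; exact: lt_trans.
  move: h1 h2; have [h1|h1] := leP h b; have [h2|h2] := leP h r => //= _ _.
  - by left; split => //; apply/negP; rewrite -ltNge.
  - by right; split => //; apply/negP; rewrite -ltNge.
- by move=> h y [/K0]; rewrite consrV0.
- by move=> h y [_ []].
move=> h y h0; rewrite /cone_diff/S/= consrV0; have E := cone_baseP y h0.
have -> : (dotp (consrV (h, h *: y)) (consrV (h, h *: y)) <= 1) = (h * base_gauge y <= 1).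
  rewrite dotp_consrV dotpZl dotpZr.
  have hg : 0 <= h * base_gauge y by rewrite mulr_ge0 ?ltW// base_gauge_gt0.
  rewrite -[RHS](@ler_sqr _ (h * base_gauge y) 1) ?nnegrE// expr1n exprMn sqr_sqrtr.
    by rewrite mulrDr mulr1 expr2 mulrA.
  by rewrite addr_ge0// dotp_ge0.
split=> [[/E Yy]|[/E Ky [_]]].
  move=> hb; split => //; split => //; move: hb.
  by case: (_ <= b); case: (_ <= 1) => //= _; [left|right].
by case=> -[]; case: (_ <= b); case: (_ <= 1).
Qed.

End ConeCoordinates.

(** * The symmetric difference inside one cone *)

Section ConeCell.
Context {R : realType}.
Local Notation leb := (@lebesgue_measure R).

(** Bernoulli's inequality for the real exponent n / 2, applied to a^2. *)
Lemma exprn_ge_quadratic (n : nat) (a : R) : (2 <= n)%N -> 0 <= a ->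
  1 + n%:R / 2 * (a ^+ 2 - 1) <= a ^+ n.
Proof.
move=> n2 a0.
have step m : 1 + m%:R / 2 * (a ^+ 2 - 1) <= a ^+ m ->
    1 + m.+2%:R / 2 * (a ^+ 2 - 1) <= a ^+ m.+2.
  move=> h; have a2 : 0 <= a ^+ 2 by rewrite sqr_ge0.
  have := ler_wpM2l a2 h; rewrite -exprD add2n => h2; apply: (le_trans _ h2).
  rewrite -subr_ge0 -!natr1.
  rewrite (_ : _ - _ = m%:R / 2 * (a ^+ 2 - 1) ^+ 2); last by field.
  by rewrite mulr_ge0 ?sqr_ge0// divr_ge0.
have : 1 + n%:R / 2 * (a ^+ 2 - 1) <= a ^+ n /\
       1 + n.+1%:R / 2 * (a ^+ 2 - 1) <= a ^+ n.+1.
  elim: n n2 => // -[//|[|n]] IH _.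
    split; first by rewrite expr2; lra.
    rewrite exprS; have := mulr_ge0 (sqr_ge0 (a - 1)) (addr_ge0 a0 (ltW (ltr0n R 1))).
    nra.
  by have [h1 h2] := IH isT; split => //; apply: step; case: n {IH h2} h1.
by case.
Qed.

(** On a ray of the cone let a be the height of the facet divided by that of
    the sphere, so that the part of the ray between them has relative volume
    |1 - a^-n|.  This is compared with the quadratic |a^2 - 1|: as it stands for
    a <= 1, and cut off at the level s for a > 1, where the n * s in the
    coefficient is the price of the boundedness of 1 - a^-n. *)
Lemma deficit_ge_inside (n : nat) (a s : R) : (2 <= n)%N -> 0 < a -> 0 <= s ->
  a ^+ 2 <= 1 -> n%:R * (1 - a ^+ 2) <= (2 + n%:R * s) * `|1 - a ^- n|.
Proof.
move=> n2 a0 s0 a1; have n0 : 0 <= n%:R :> R by [].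
have ai0 : 0 <= a^-1 by rewrite invr_ge0 ltW.
have := exprn_ge_quadratic n2 ai0; rewrite !exprVn => h.
have a20 : 0 < a ^+ 2 by rewrite exprn_gt0.
have h2 : 1 - a ^+ 2 <= a ^- 2 - 1.
  rewrite -(ler_pM2l a20) !mulrBr mulfV ?gt_eqF// mulr1.
  have := sqr_ge0 (1 - a ^+ 2); move: (a ^+ 2) => A; nra.
have h3 : n%:R / 2 * (1 - a ^+ 2) <= a ^- n - 1.
  have : n%:R / 2 * (1 - a ^+ 2) <= n%:R / 2 * (a ^- 2 - 1).
    by rewrite ler_wpM2l// divr_ge0// ltW.
  move: h; move: (a ^- 2) (a ^- n) (a ^+ 2) => A B C; lra.
have h4 : 0 <= a ^- n - 1.
  by apply: (le_trans _ h3); rewrite mulr_ge0 ?subr_ge0// divr_ge0// ltW.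
rewrite distrC (ger0_norm h4).
have h5 : 0 <= n%:R * s * (a ^- n - 1) by rewrite !mulr_ge0.
by move: h3 h5; move: (a ^- n) (a ^+ 2) => B A; lra.
Qed.

Lemma deficit_ge_outside (n : nat) (a s m : R) : (2 <= n)%N -> 0 < a ->
  0 < m -> m <= a ^+ 2 - 1 -> m <= s ->
  n%:R * m <= (2 + n%:R * s) * `|1 - a ^- n|.
Proof.
move=> n2 a0 m0 mt ms.
have n0 : 0 < n%:R :> R by rewrite ltr0n (ltn_trans _ n2).
have := exprn_ge_quadratic n2 (ltW a0).
set q := a ^+ n => h.
have h1 : n%:R * m <= 2 * (q - 1).
  have : n%:R * m <= n%:R * (a ^+ 2 - 1) by rewrite ler_pM2l.
  by move: h; move: (a ^+ 2) => A; lra.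
have q1 : 1 < q.
  by rewrite -subr_gt0 -(pmulr_rgt0 _ (ltr0n R 2)) (lt_le_trans _ h1)// mulr_gt0.
have q0 : 0 < q by apply: lt_trans q1.
have -> : `|1 - q^-1| = (q - 1) / q.
  rewrite ger0_norm; first by field; rewrite gt_eqF.
  by rewrite subr_ge0 invf_le1// ltW.
rewrite mulrA ler_pdivlMr//.
have h2 : n%:R * m * q <= (2 + n%:R * m) * (q - 1).
  by move: h1; move: (n%:R * m) => nm; nra.
apply: (le_trans h2); rewrite ler_pM2r ?subr_gt0// lerD2l ler_pM2l//.
Qed.

Context (d : nat) (K : set 'rV[R]_d.+1) (b : R).
Local Notation mu := (@volm R d).
Local Notation Y := (cone_base K).
Hypothesis d0 : (0 < d)%N.
Hypothesis mK : measurable (K : set (borel_rV R d.+1)).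
Hypothesis K0 : forall x, K x -> 0 < x 0 0.
Hypothesis KZ : forall (h : R) x, 0 < h -> K x -> K (h *: x).
Hypothesis KD : forall x y, K x -> K y -> K (x + y).
Hypothesis b0 : 0 < b.
Hypothesis capfin : (vol (cone_cap K b) < +oo)%E.
Context (s lam r : R).
Hypothesis s0 : 0 < s.
Hypothesis lam01 : 0 < lam < 1.
Hypothesis r0 : 0 < r.

(** The coefficient with which the second moment of the base bounds the
    integral of |g| from below. *)
Definition contraction_gain (lam : R) : R := 2 * lam * (1 - lam) / (1 + lam ^- d).
Local Notation c := (contraction_gain lam).
Hypothesis crs : c * r ^+ 2 <= s.

Let n := d.+1.
Let Z : set 'rV[R]_d := Y `&` [set y | b ^+ 2 * dotp y y - (1 - b ^+ 2) <= s].
Let g (y : 'rV[R]_d) : R := b ^+ 2 * dotp y y - (1 - b ^+ 2).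

Let mg : measurable_fun setT (g : borel_rV R d -> R).
Proof.
by apply: measurable_funB => //; apply: measurable_funM => //; exact: measurable_dotp_self.
Qed.

Let mZ : measurable (Z : set (borel_rV R d)).
Proof.
apply: measurableI; first exact: measurable_cone_base.
exact: measurable_set_le.
Qed.

Let mY := measurable_cone_base mK.

Let gauge_sq y : (b * base_gauge y) ^+ 2 - 1 = g y.
Proof.
rewrite exprMn sqr_sqrtr ?addr_ge0 ?dotp_ge0// /g; ring.
Qed.

Let c0 : 0 < c.
Proof.
have /andP[l0 l1] := lam01.
by rewrite divr_gt0 ?mulr_gt0 ?subr_gt0// ltr_wpDr// invr_ge0 exprn_ge0// ltW.
Qed.

Let phi (y : 'rV[R]_d) : R := `|b ^+ n - base_gauge y ^- n| / n%:R.

Let phiE y : phi y = b ^+ n * `|1 - (b * base_gauge y) ^- n| / n%:R.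
Proof.
have bn : 0 < b ^+ n by rewrite exprn_gt0.
rewrite /phi; congr (_ / _); rewrite -[X in _ = X * _](ger0_norm (ltW bn)) -normrM.
by congr (`|_|); rewrite exprMn invfM mulrBr mulr1 mulrA mulfV ?mul1r// gt_eqF.
Qed.

Let bn0 : 0 < b ^+ n. Proof. by rewrite exprn_gt0. Qed.

Let scale_phi (y : 'rV[R]_d) m :
  n%:R * m <= (2 + n%:R * s) * `|1 - (b * base_gauge y) ^- n| ->
  b ^+ n * m <= (2 + n%:R * s) * phi y.
Proof.
have n0 : 0 < n%:R :> R by rewrite ltr0n.
rewrite phiE => h.
rewrite -(ler_pM2l n0) mulrCA; apply: (le_trans (ler_wpM2l (ltW bn0) h)).
rewrite le_eqVlt; apply/orP; left; apply/eqP.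
by move: (`|_|) => D; field; rewrite gt_eqF.
Qed.

Let a0 (y : 'rV[R]_d) : 0 < b * base_gauge y. Proof. by rewrite mulr_gt0// base_gauge_gt0. Qed.

Let phi_in y : Z y -> b ^+ n * `|g y| <= (2 + n%:R * s) * phi y.
Proof.
move=> [_ /= gs]; apply: scale_phi; have [g0|g0] := leP (g y) 0.
  rewrite ler0_norm// -gauge_sq opprB; apply: deficit_ge_inside => //; first exact: ltW.
  by rewrite -subr_le0 gauge_sq.
rewrite gtr0_norm//; apply: deficit_ge_outside => //; by rewrite gauge_sq.
Qed.

Let phi_out y : ~ Z y -> Y y -> b ^+ n * s <= (2 + n%:R * s) * phi y.
Proof.
move=> nZ Yy; apply: scale_phi; apply: deficit_ge_outside => //.
by rewrite gauge_sq; apply/ltW; rewrite ltNge; apply/negP => gs; apply: nZ.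
Qed.

Let phi_ge0 y : 0 <= phi y.
Proof. by rewrite divr_ge0. Qed.

Let mphi : measurable_fun setT (phi : borel_rV R d -> R).
Proof.
rewrite (_ : phi = (fun y => `|b ^+ n - base_gauge y ^- n| / n%:R))//.
have E (y : 'rV[R]_d) : base_gauge y ^- n = (1 + dotp y y) `^ (- (n%:R / 2)).
  rewrite powRN; congr (_^-1).
  rewrite /base_gauge -powR12_sqrt ?addr_ge0 ?dotp_ge0// -powR_mulrn ?powR_ge0//.
  by rewrite -powRrM mulrC.
under eq_fun do rewrite E.
apply: measurable_funM => //; apply: measurableT_comp => //.
apply: measurable_funB => //.
apply: (@measurableT_comp _ _ _ _ _ _ (fun z : R => z `^ (- (n%:R / 2)))).
  exact: measurable_powR.
by apply: measurable_funD => //; exact: measurable_dotp_self.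
Qed.

Let ZM y : Z y -> dotp y y <= (s + 1) / b ^+ 2.
Proof.
move=> [_ /= h]; have b20 : 0 < b ^+ 2 by rewrite exprn_gt0.
by rewrite ler_pdivlMr// mulrC; move: h (sqr_ge0 b); rewrite /g; move: (dotp y y) (b ^+ 2) => A B; lra.
Qed.

Let Zconv x y : Z x -> Z y -> Z (lam *: x + (1 - lam) *: y).
Proof.
move=> [Yx gx] [Yy gy]; split; first exact: cone_base_conv.
move: gx gy => /=; have /andP[l0 l1] := lam01.
rewrite !(dotpDl, dotpDr, dotpZl, dotpZr) (dotpC y x) => gx gy.
have h : 0 <= lam * (1 - lam) * (b ^+ 2 * dotp (x - y) (x - y)).
  by rewrite mulr_ge0 ?mulr_ge0 ?dotp_ge0 ?sqr_ge0 ?subr_ge0// ltW.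
move: h; rewrite dotpBl !dotpBr (dotpC y x) => h.
have l1' : 0 < 1 - lam by rewrite subr_gt0.
move: (ler_wpM2l (ltW l0) gx) (ler_wpM2l (ltW l1') gy).
by move: (dotp x x) (dotp y y) (dotp x y) h => X W V; lra.
Qed.

(** On the part Z of the base where g <= s the deficit dominates |g| and
    [quadratic_cell_bound] applies with radius r / b; on the rest it dominates
    the constant s, which is at least c r^2.  Both parts give the same multiple of
    the volume of the base, hence of the volume of the cone under the facet. *)
Lemma cone_cell_bound :
  ((c * r ^+ 2 * n%:R)%:E * vol (cone_cap K b) <=
   (2 + n%:R * s)%:E * vol (cone_diff K b) +
   (c * (1 + s) * (r ^+ d.+2 * (2 / d.+2%:R * kappa d)))%:E)%E.
Proof.
have n0 : 0 < n%:R :> R by rewrite ltr0n.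
have mYZ : measurable (Y `\` Z : set (borel_rV R d)) by exact: measurableD.
have ZY : Z `<=` Y by move=> y [].
have capE := vol_cone_cap mK K0 KZ b0.
have Yfin : (vol Y < +oo)%E.
  move: capfin; rewrite capE; have := @vol_ge0 R d Y.
  case: (vol Y) => [x|//|//] _; first by move=> _; exact: ltry.
  by rewrite gt0_muley// lte_fin divr_gt0.
have Zfin : (vol Z < +oo)%E by apply: le_lt_trans Yfin; exact: le_vol.
have Wfin : (vol (Y `\` Z) < +oo)%E.
  by apply: le_lt_trans Yfin; apply: le_vol => // y [].
pose v := fine (vol Z); pose w := fine (vol (Y `\` Z)).
have vE : vol Z = v%:E by rewrite /v fineK// ge0_fin_numE ?vol_ge0.
have wE : vol (Y `\` Z) = w%:E by rewrite /w fineK// ge0_fin_numE ?vol_ge0.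
have v0 : 0 <= v by rewrite fine_ge0// vol_ge0.
have w0 : 0 <= w by rewrite fine_ge0// vol_ge0.
have YE : vol Y = (v + w)%:E.
  rewrite EFinD -vE -wE [LHS](measureDI mu mY mZ) addeC.
  by congr (_ + _)%E; congr (mu _); rewrite setIC; apply/setIidl.
pose J := \int[mu]_(y in Z) `|g y|.
have tg : tame (T := borel_rV R d) Z (fun y => `|g y|).
  split; first exact: measurableT_comp.
  exists (b ^+ 2 * `|(s + 1) / b ^+ 2| + `|1 - b ^+ 2|) => y Zy.
  rewrite normr_id /g (le_trans (ler_normB _ _))// lerD2r normrM.
  rewrite (ger0_norm (sqr_ge0 b)) ler_wpM2l ?sqr_ge0// ger0_norm ?dotp_ge0//.
  by rewrite (le_trans (ZM Zy))// ler_norm.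
have J0 : 0 <= J by apply: Rintegral_ge0.
have JE : J%:E = (\int[mu]_(y in Z) (`|g y|)%:E)%E by exact: tame_intE.
have lower : ((b ^+ n * (J + s * w))%:E <= (2 + n%:R * s)%:E * vol (cone_diff K b))%E.
  rewrite (vol_cone_diff mK K0 KZ b0).
  have mphiE (D : set (borel_rV R d)) : measurable_fun D (fun y => (phi y)%:E).
    by apply/measurable_EFinP; exact: measurable_funTS.
  have ns0 : 0 <= 2 + n%:R * s by rewrite addr_ge0// mulr_ge0// ltW.
  have mphiE2 (D : set (borel_rV R d)) :
      measurable_fun D (fun y => ((2 + n%:R * s)%:E * (phi y)%:E)%E).
    by apply: measurable_funeM; exact: mphiE.
  have phi0 (y : 'rV[R]_d) : (0 <= (phi y)%:E)%E by rewrite lee_fin; exact: phi_ge0.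
  have phi2 (y : 'rV[R]_d) : (0 <= (2 + n%:R * s)%:E * (phi y)%:E)%E by rewrite mule_ge0.
  have mgE (D : set (borel_rV R d)) : measurable_fun D (fun y => (`|g y|)%:E).
    by apply/measurable_EFinP; apply: measurable_funTS; exact: measurableT_comp.
  have mgE2 (D : set (borel_rV R d)) :
      measurable_fun D (fun y => ((b ^+ n)%:E * (`|g y|)%:E)%E).
    by apply: measurable_funeM; exact: mgE.
  rewrite -(@ge0_integralZl _ _ _ mu _ mY _ (mphiE Y))//.
  have YU : Z `|` (Y `\` Z) = Y.
    apply/seteqP; split => y; first by case=> [|[]]//; exact: ZY.
    by move=> Yy; have [|] := pselect (Z y); [left|right].
  rewrite -[X in (_ <= \int[_]_(x in X) _)%E]YU.
  rewrite (@ge0_integral_setU _ _ _ mu Z (Y `\` Z))//; last first.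
    by apply/disj_setPS => y [? []].
  rewrite mulrDr EFinD; apply: leeD.
    rewrite EFinM JE -(@ge0_integralZl _ _ _ mu _ mZ _ (mgE Z))//; last first.
      by rewrite lee_fin ltW.
    apply: ge0_le_integral => //.
    by move=> y _; rewrite mule_ge0 ?lee_fin// ltW.
  rewrite mulrA EFinM -wE -(integral_cst mu mYZ).
  apply: ge0_le_integral => //.
  - by move=> y _; rewrite lee_fin mulr_ge0 ?ltW.
  - by move=> y [Yy nZy]; rewrite -!EFinM lee_fin; exact: phi_out.
apply: (@le_trans _ _ ((b ^+ n * (J + s * w))%:E +
    (c * (1 + s) * (r ^+ d.+2 * (2 / d.+2%:R * kappa d)))%:E)%E); last exact: leeD2r.
rewrite capE YE -!EFinM -EFinD lee_fin.
have /andP[l0 l1] := lam01.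
have rb0 : 0 < r / b by rewrite divr_gt0.
have := @quadratic_cell_bound R d Z _ mZ ZM b (1 - b ^+ 2) lam lam01 Zconv _ rb0.
rewrite -/v -/J => Q.
set C := 2 / d.+2%:R * kappa d in Q *.
have C0 : 0 <= C by rewrite mulr_ge0 ?divr_ge0//; exact/ltW/kappa_gt0.
set T := r ^+ d.+2 * C.
have T0 : 0 <= T by rewrite mulr_ge0// exprn_ge0// ltW.
have D0 : 0 < 1 + lam ^- d by rewrite ltr_wpDr// invr_ge0 exprn_ge0// ltW.
have h1 : c * (b ^+ 2 * ((r / b) ^+ 2 * v - (r / b) ^+ d.+2 * C)) <= J.
  rewrite -(ler_pM2l D0); apply: le_trans Q; rewrite le_eqVlt; apply/orP; left; apply/eqP.
  rewrite /contraction_gain; move: (_ - _ * C) D0 => X; move: (1 + lam ^- d) => D D0.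
  by field; rewrite gt_eqF.
have h2 : c * (r ^+ 2 * b ^+ n * v - b * T) <= b ^+ n * J.
  apply: le_trans (ler_wpM2l (ltW bn0) h1); rewrite le_eqVlt; apply/orP; left; apply/eqP.
  rewrite [RHS]mulrCA; congr (c * _).
  rewrite /T !exprMn !exprVn /n !exprS.
  have := gt_eqF b0; have := gt_eqF (exprn_gt0 d b0).
  by move: (b ^+ d) (r ^+ d) => bd rd h h'; field; rewrite h h'.
clearbody T.
have h3 : c * r ^+ 2 * b ^+ n * v <= b ^+ n * J + c * (1 + s) * T.
  have [v00|vn0] := eqVneq v 0.
    have bJ0 : 0 <= b ^+ n * J by rewrite mulr_ge0// ltW.
    have s1 : 0 <= 1 + s by rewrite addr_ge0// ltW.
    by rewrite v00 mulr0 addr_ge0// mulr_ge0// mulr_ge0// ltW.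
  have [y [_ /= Zy]] : Z !=set0.
    by apply/set0P; apply/eqP => Z0; move: vE; rewrite Z0 vol_set0 => -[] /esym/eqP; rewrite (negbTE vn0).
  (* a point of Z has b^2 <= b^2 (1 + |y|^2) <= 1 + s *)
  have bs : b <= 1 + s.
    rewrite -ler_sqr ?nnegrE ?(ltW b0)//; last by rewrite addr_ge0// ltW.
    have h : 0 <= b ^+ 2 * dotp y y by rewrite mulr_ge0 ?sqr_ge0 ?dotp_ge0.
    apply: (@le_trans _ _ (1 + s)); first by move: Zy h; rewrite /g; move: (dotp y y) (b ^+ 2) => A B; lra.
    by have := sqr_ge0 s; rewrite sqrrD expr1n mul1r; move: (s ^+ 2) s0 => s2; lra.
  have h4 : c * (b * T) <= c * ((1 + s) * T).
    by rewrite ler_wpM2l ?(ltW c0)// ler_wpM2r.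
  move: h2 h4; rewrite mulrBr !mulrA; move: (c * r ^+ 2 * b ^+ n * v) (b ^+ n * J) (c * b * T) (c * (1 + s) * T).
  by move=> A B E F; lra.
have h5 : c * r ^+ 2 * (b ^+ n * w) <= s * (b ^+ n * w).
  by rewrite ler_wpM2r// mulr_ge0// ltW.
rewrite (_ : c * r ^+ 2 * n%:R * (b ^+ d.+1 / d.+1%:R * (v + w)) =
    c * r ^+ 2 * b ^+ n * v + c * r ^+ 2 * (b ^+ n * w)).
  have -> : b ^+ n * (J + s * w) = b ^+ n * J + s * (b ^+ n * w) by ring.
  by rewrite addrAC; apply: lerD.
by move: n0 => /gt_eqF; rewrite /n; move: (d.+1%:R : R) (b ^+ d.+1) => k bk k0; field; rewrite k0.
Qed.

End ConeCell.

(** * Rotating a cone to standard position *)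

Section Rotation.
Context {R : realType}.

Lemma enorm_sq n (x : 'rV[R]_n) : enorm x ^+ 2 = dotp x x.
Proof. by rewrite /enorm sqr_sqrtr// dotp_ge0. Qed.

Lemma enorm_gt0 n (x : 'rV[R]_n) : (0 < enorm x) = (x != 0).
Proof. by rewrite /enorm sqrtr_gt0 dotp_gt0. Qed.

(** The Householder reflection exchanging u / |u| with the first basis vector. *)
Lemma exists_rotation n (u : 'rV[R]_n.+1) : u != 0 ->
  exists O : 'M[R]_n.+1, O *m O^T = 1%:M /\
    forall x : 'rV[R]_n.+1, (x *m O) 0 0 = dotp x u / enorm u.
Proof.
move=> u0; have nu0 : 0 < enorm u by rewrite enorm_gt0.
have [w wE] : exists w, w = (enorm u)^-1 *: u by eexists.
have ww : dotp w w = 1.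
  by rewrite wE dotpZl dotpZr -enorm_sq mulrA -invfM -expr2 mulVf// sqrf_eq0 gt_eqF.
have xw x : dotp x w = dotp x u / enorm u by rewrite wE dotpZr mulrC.
have [e eE] : exists e : 'rV[R]_n.+1, e = delta_mx 0 0 by eexists.
have xe (x : 'rV[R]_n.+1) : dotp x e = x 0 0.
  rewrite eE /dotp (bigD1 0)//= mxE !eqxx mulr1 big1 ?addr0// => i i0.
  by rewrite mxE (negbTE i0) andbF mulr0.
have [we|we] := eqVneq w e.
  exists 1%:M; split; first by rewrite trmx1 mulmx1.
  by move=> x; rewrite mulmx1 -xw we xe.
have [v vE] : exists v, v = w - e by eexists.
have v0 : 0 < dotp v v by rewrite dotp_gt0 vE subr_eq0.
pose O : 'M[R]_n.+1 := 1%:M - (2 / dotp v v) *: (v^T *m v).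
have OT : O^T = O by rewrite /O linearB/= linearZ/= trmx1 trmx_mul trmxK.
have xO (x : 'rV[R]_n.+1) : x *m O = x - (2 * dotp x v / dotp v v) *: v.
  rewrite mulmxBr mulmx1 -scalemxAr mulmxA; congr (_ - _).
  rewrite [x *m v^T]mx11_scalar mul_scalar_mx scalerA -dotp_mulmx; congr (_ *: _).
  by rewrite mulrAC.
exists O; split.
  rewrite OT; apply/row_matrixP => i; rewrite row_mul !rowE !xO mulmx1.
  set x := delta_mx 0 i.
  rewrite dotpBl dotpZl.
  rewrite -addrA -opprD -scalerDl -mulrDl; set k := (X in X *: v).
  suff -> : k = 0 by rewrite scale0r subr0.
  by rewrite /k; field; rewrite gt_eqF.
move=> x; rewrite xO -xw mxE [X in _ + X]mxE [X in - X]mxE.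
have ee : e 0 0 = 1 by rewrite eE mxE !eqxx.
have vv : dotp v v = -2 * (w 0 0 - 1).
  by rewrite vE dotpBl !dotpBr ww (dotpC e w) !xe ee; ring.
have w1 : w 0 0 - 1 != 0.
  by apply: contraTneq v0 => h; rewrite vv h mulr0 ltxx.
have -> : dotp x v = dotp x w - x 0 0 by rewrite vE dotpBr xe.
have -> : v 0 0 = w 0 0 - 1 by rewrite vE mxE [X in _ + X]mxE ee.
by rewrite vv; move: (w 0 0) w1 => a w1; field.
Qed.

End Rotation.

(** * The cones over the facets *)

Section RotatedCell.
Context {R : realType} (d : nat) (K : set 'rV[R]_d.+1) (u : 'rV[R]_d.+1).
Hypothesis d0 : (0 < d)%N.
Hypothesis mK : measurable (K : set (borel_rV R d.+1)).
Hypothesis K0 : forall x, K x -> 0 < dotp u x.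
Hypothesis KZ : forall (h : R) x, 0 < h -> K x -> K (h *: x).
Hypothesis KD : forall x y, K x -> K y -> K (x + y).
Hypothesis capfin : (vol (K `&` [set x : 'rV[R]_d.+1 | (dotp u x <= 1)%R]) < +oo)%E.
Hypothesis u0 : u != 0.

(** The same bound for a cone in general position, whose facet lies in the
    hyperplane {dotp u x = 1}: rotate u to the first axis. *)
Lemma rotated_cell_bound (s lam r : R) : 0 < s -> 0 < lam < 1 -> 0 < r ->
  contraction_gain d lam * r ^+ 2 <= s ->
  ((contraction_gain d lam * r ^+ 2 * d.+1%:R)%:E *
     vol (K `&` [set x : 'rV[R]_d.+1 | (dotp u x <= 1)%R]) <=
   (2 + d.+1%:R * s)%:E *
     vol (K `&` [set x : 'rV[R]_d.+1 | (dotp u x <= 1)%R != (dotp x x <= 1)%R]) +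
   (contraction_gain d lam * (1 + s) * (r ^+ d.+2 * (2 / d.+2%:R * kappa d)))%:E)%E.
Proof.
move=> s0 lam01 r0 crs.
have [Q [QQ Qu]] := exists_rotation u0.
have QQt : Q^T *m Q = 1%:M by exact: mulmx1C.
have nu0 : 0 < enorm u by rewrite enorm_gt0.
pose b := (enorm u)^-1.
have b0 : 0 < b by rewrite invr_gt0.
pose K' : set 'rV[R]_d.+1 := [set x | K (x *m Q^T)].
have mK' : measurable (K' : set (borel_rV R d.+1)).
  apply: (@measurable_setP _ _ (borel_rV R d.+1) (borel_rV R d.+1) (fun x => x *m Q^T) K) => //.
  exact: measurable_mulmx.
have x00 (x : 'rV[R]_d.+1) : x 0 0 = dotp u (x *m Q^T) / enorm u.
  by rewrite dotpC -Qu -mulmxA QQt mulmx1.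
have QT : Q^T *m (Q^T)^T = 1%:M by rewrite trmxK.
have K'0 x : K' x -> 0 < x 0 0 by move=> /K0 h; rewrite x00 divr_gt0.
have K'Z (h : R) x : 0 < h -> K' x -> K' (h *: x).
  by move=> h0 Kx; rewrite /K'/= -scalemxAl; exact: KZ.
have K'D x y : K' x -> K' y -> K' (x + y).
  by move=> Kx Ky; rewrite /K'/= mulmxDl; exact: KD.
have bE (x : 'rV[R]_d.+1) : (x 0 0 <= b) = (dotp u (x *m Q^T) <= 1).
  by rewrite x00 ler_pdivrMr// mulVf// gt_eqF.
have mu1 : measurable ([set x : 'rV[R]_d.+1 | (dotp u x <= 1)%R] : set (borel_rV R d.+1)).
  apply: measurable_set_le => //; apply: measurable_dotp => // i; exact: measurable_coord.
have m1 : measurable (K `&` [set x : 'rV[R]_d.+1 | (dotp u x <= 1)%R] : set (borel_rV R d.+1)).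
  exact: measurableI.
have capE : vol (cone_cap K' b) = vol (K `&` [set x : 'rV[R]_d.+1 | (dotp u x <= 1)%R]).
  rewrite -(vol_orthogonal QT m1); congr (vol _).
  by apply/seteqP; split => x; rewrite /cone_cap/K'/= bE.
have m2 : measurable (K `&` [set x : 'rV[R]_d.+1 | (dotp u x <= 1)%R != (dotp x x <= 1)%R]
    : set (borel_rV R d.+1)).
  apply: measurableI => //.
  rewrite (_ : [set x | _] = [set x : 'rV[R]_d.+1 | dotp u x <= 1] `+` @sqball R d.+1 1).
    by apply: measurableU; apply: measurableD => //; exact: measurable_sqball.
  apply/seteqP; split => x; rewrite /sqball/= /setY/=.
    by case: (_ <= 1); case: (_ <= 1) => //= _; [left|right].
  by case=> -[]; case: (_ <= 1); case: (_ <= 1).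
have diffE : vol (cone_diff K' b) =
    vol (K `&` [set x : 'rV[R]_d.+1 | (dotp u x <= 1)%R != (dotp x x <= 1)%R]).
  rewrite -(vol_orthogonal QT m2); congr (vol _).
  by apply/seteqP; split => x; rewrite /cone_diff/K'/= bE dotp_orthogonal.
rewrite -capE -diffE; apply: cone_cell_bound => //.
by rewrite capE.
Qed.

End RotatedCell.

Section PolytopeCells.
Context {R : realType} (d m : nat).
Local Notation n := d.+1.
Context (w : 'I_m -> 'rV[R]_n) (I : {set 'I_m}).

(** The cone over the i-th facet of the polytope cut out by the inequalities
    dotp (w j) x <= 1, with ties between facets broken by the index, so that
    cells are disjoint and remain convex. *)
Definition cell (i : 'I_m) : set 'rV[R]_n :=
  [set x | 0 < dotp (w i) x /\ forall j, j \in I ->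
     dotp (w j) x <= dotp (w i) x /\ ((j < i)%N -> dotp (w j) x < dotp (w i) x)].

Lemma measurable_linear (u : 'rV[R]_n) :
  measurable_fun setT (fun x : borel_rV R n => dotp u (x : 'rV[R]_n)).
Proof. by apply: measurable_dotp => // i; exact: measurable_coord. Qed.

Lemma measurable_cell i : measurable (cell i : set (borel_rV R n)).
Proof.
rewrite (_ : cell i = [set x | 0 < dotp (w i) x] `&`
  (\bigcap_(j in [set` I]) ([set x | dotp (w j) x <= dotp (w i) x] `&`
     (if (j < i)%N then [set x | dotp (w j) x < dotp (w i) x] else setT)))); last first.
  apply/seteqP; split => x [h1 h2]; split => // j jI; have [h3 h4] := h2 j jI.
    by split => //; case: ifPn => // /h4.
  by split => // ji; move: h4; rewrite ji.
apply: measurableI.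
  by apply: measurable_set_lt => //; exact: measurable_linear.
apply: fin_bigcap_measurable => // j _; apply: measurableI.
  by apply: measurable_set_le; exact: measurable_linear.
by case: ifPn => // _; apply: measurable_set_lt; exact: measurable_linear.
Qed.

Lemma cellZ i (h : R) x : 0 < h -> cell i x -> cell i (h *: x).
Proof.
move=> h0 [x0 xI]; split; first by rewrite dotpZr mulr_gt0.
move=> j jI; have [h1 h2] := xI j jI; rewrite !dotpZr; split.
  by rewrite ler_pM2l.
by move=> ji; rewrite ltr_pM2l// h2.
Qed.

Lemma cellD i x y : cell i x -> cell i y -> cell i (x + y).
Proof.
move=> [x0 xI] [y0 yI]; split; first by rewrite dotpDr addr_gt0.
move=> j jI; have [h1 h2] := xI j jI; have [h3 h4] := yI j jI.
by rewrite !dotpDr; split => [|ji]; [exact: lerD|rewrite ltrD ?h2 ?h4].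
Qed.

Lemma cell_inj i j x : i \in I -> j \in I -> cell i x -> cell j x -> i = j.
Proof.
move=> iI jI [_ xi] [_ xj]; apply/val_inj/eqP; rewrite eqn_leq.
have [h1 h2] := xi j jI; have [h3 h4] := xj i iI.
apply/andP; split; rewrite leqNgt; apply/negP.
  by move/h2; rewrite ltNge h3.
by move/h4; rewrite ltNge h1.
Qed.

Lemma cell_cover x i0 : i0 \in I -> 0 < dotp (w i0) x ->
  exists2 i, i \in I & cell i x.
Proof.
move=> i0I x0.
have [i1 i1I max1] := @arg_maxP _ _ _ i0 (mem I) (fun i => dotp (w i) x) i0I.
have {}max1 j : j \in I -> dotp (w j) x <= dotp (w i1) x by exact: max1.
pose Q := [pred i | (i \in I) && (dotp (w i) x == dotp (w i1) x)].
have Qi1 : Q i1 by rewrite /= (i1I : i1 \in I) eqxx.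
have [i /andP[iI /eqP ei] min1] := @arg_minnP _ i1 Q (fun i => nat_of_ord i) Qi1.
exists i => //; split; first by rewrite ei (lt_le_trans x0)// max1.
move=> j jI; split; first by rewrite ei; exact: max1.
move=> ji; rewrite lt_def {2}ei (max1 _ jI) andbT eq_sym.
apply/negP => /eqP e1; have := min1 j; rewrite /Q/= jI e1 ei eqxx => /(_ isT).
by rewrite leqNgt ji.
Qed.

End PolytopeCells.

Section SumOverCells.
Context {R : realType} (d m N : nat).
Local Notation n := d.+1.
Context (w : 'I_m -> 'rV[R]_n) (I : {set 'I_m}).
Let P : set 'rV[R]_n := [set x | forall j, j \in I -> dotp (w j) x <= 1].
Context (M : R).
Hypothesis d0 : (0 < d)%N.
Hypothesis PM : forall x, P x -> forall i, `|x 0 i| <= M.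
Hypothesis IN : (#|I| <= N)%N.
Local Notation D := (unit_ball R n).
Local Notation Delta := (vol (D `+` P)).
Local Notation C := (cell w I).
Local Notation mu := (@volm R n).

Lemma measurable_halfspaces : measurable (P : set (borel_rV R n)).
Proof.
rewrite (_ : P = \bigcap_(j in [set` I]) [set x | dotp (w j) x <= 1]); last first.
  by apply/seteqP; split => x h j; exact: h.
by apply: fin_bigcap_measurable => // j _; apply: measurable_set_le => //; exact: measurable_linear.
Qed.

Let mP := measurable_halfspaces.
Let mD := @measurable_unit_ball R n.

Let M0 : 0 <= M.
Proof.
have : P 0 by move=> j _; rewrite dotp0r.
by move=> /PM /(_ 0); rewrite mxE normr0.
Qed.

Let cap i := C i `&` [set x : 'rV[R]_n | (dotp (w i) x <= 1)%R].
Let diff i := C i `&` [set x : 'rV[R]_n | (dotp (w i) x <= 1)%R != (dotp x x <= 1)%R].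

Let cellP i x : i \in I -> C i x -> P x <-> dotp (w i) x <= 1.
Proof.
move=> iI [x0 xI]; split => [/(_ i iI)//|h j jI].
by apply: le_trans h; have [] := xI j jI.
Qed.

Let cap_sub i : i \in I -> cap i `<=` P.
Proof. by move=> iI x [Cx h]; apply/(cellP iI Cx). Qed.

Let diff_sub i : i \in I -> diff i `<=` D `+` P.
Proof.
move=> iI x [Cx /= h]; have E := cellP iI Cx; have ED := unit_ballP x.
have [Dx|nDx] := pselect (D x).
  left; split => //; move/ED: (Dx) => Dx1; rewrite Dx1 in h.
  by move=> /E h1; rewrite h1 in h.
right; split => //; apply/E; move: h; case: (_ <= 1) => //.
by case: (boolP (dotp x x <= 1)) => // /ED.
Qed.

Let mcell i : measurable (C i : set (borel_rV R n)).
Proof. exact: measurable_cell. Qed.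

Let mdiffset : measurable (D `+` P : set (borel_rV R n)).
Proof. by apply: measurableU; exact: measurableD. Qed.

Let mcap i : measurable (cap i : set (borel_rV R n)).
Proof.
by apply: measurableI => //; apply: measurable_set_le => //; exact: measurable_linear.
Qed.

Let diffE i : i \in I -> diff i = C i `&` (D `+` P).
Proof.
move=> iI; apply/seteqP; split => x; first by move=> h; split; [case: h|exact: (diff_sub iI)].
move=> [Cx h]; split => //=; have E := cellP iI Cx; have ED := unit_ballP x.
case: h => -[].
  by move=> /ED -> nP; apply/negP => /eqP h; apply: nP; apply/E; rewrite h.
by move=> /E -> nD; apply/negP => /eqP h; apply: nD; apply/ED; rewrite -h.
Qed.

Let mdiff i : i \in I -> measurable (diff i : set (borel_rV R n)).
Proof. by move=> iI; rewrite diffE//; exact: measurableI. Qed.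

Let trivC (F : 'I_m -> set 'rV[R]_n) : (forall i, F i `<=` C i) ->
  trivIset [set` I] F.
Proof.
move=> FC; apply/trivIsetP => i j /= iI jI ij; apply/seteqP; split => // x [Fi Fj].
by have := cell_inj iI jI (FC _ _ Fi) (FC _ _ Fj) => e; rewrite e eqxx in ij.
Qed.

(** A point of P on which no inequality is positive would span a ray in P,
    against boundedness. *)
Let cover : P `<=` [set x : 'rV[R]_n | dotp x x <= 0] `|` \big[setU/set0]_(i in I) cap i.
Proof.
move=> x Px; have [->|x0] := eqVneq x 0; first by left; rewrite /= dotp0l.
right; have [i0 i0I xi0] : exists2 i0, i0 \in I & 0 < dotp (w i0) x.
  apply: contrapT => h.
  have neg j : j \in I -> dotp (w j) x <= 0.
    by move=> jI; rewrite leNgt; apply/negP => h1; apply: h; exists j.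
  have [i xi] : exists i, x 0 i != 0.
    by apply: contrapT => h1; case/eqP: x0; apply/rowP => i; rewrite mxE;
      apply/eqP/negPn/negP => h2; apply: h1; exists i.
  have := PM (x := ((M + 1) / `|x 0 i|) *: x) _ i.
  rewrite mxE normrM ger0_norm ?divr_ge0 ?addr_ge0// divfK ?normr_eq0//.
  rewrite leNgt ltrDl ltr01 => /(_ _)/negP; apply => // j jI.
  rewrite dotpZr (@le_trans _ _ 0)// mulr_ge0_le0 ?neg// divr_ge0// addr_ge0//.
have [i iI Ci] := cell_cover i0I xi0.
rewrite -bigcup_pred; exists i => //; split => //.
exact: Px.
Qed.

(** Summing the cell bounds: the error terms contribute at most N times, the
    truncated cones fill P, and the volume of P is at least that of the ball
    minus the symmetric difference, which goes to the right-hand side. *)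
Lemma cells_sum_bound (s lam r : R) : 0 < s -> 0 < lam < 1 -> 0 < r ->
  contraction_gain d lam * r ^+ 2 <= s ->
  ((contraction_gain d lam * r ^+ 2 * n%:R * kappa n)%:E <=
   (2 + n%:R * s + contraction_gain d lam * r ^+ 2 * n%:R)%:E * Delta +
   (N%:R * (contraction_gain d lam * (1 + s) * (r ^+ d.+2 * (2 / d.+2%:R * kappa d))))%:E)%E.
Proof.
move=> s0 lam01 r0 crs; have /andP[l0 l1] := lam01.
set c := contraction_gain d lam in crs *.
have c0 : 0 < c.
  by rewrite divr_gt0 ?mulr_gt0 ?subr_gt0// ltr_wpDr// invr_ge0 exprn_ge0// ltW.
set T := c * (1 + s) * _.
have T0 : 0 <= T.
  apply: mulr_ge0; first by apply: mulr_ge0; [exact: ltW|rewrite addr_ge0// ltW].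
  apply: mulr_ge0; first by rewrite exprn_ge0// ltW.
  by apply: mulr_ge0; [rewrite divr_ge0|exact/ltW/kappa_gt0].
set A := c * r ^+ 2 * n%:R.
have A0 : 0 <= A by apply: mulr_ge0 => //; apply: mulr_ge0; [exact: ltW|exact: sqr_ge0].
have B0 : 0 <= 2 + n%:R * s by rewrite addr_ge0// mulr_ge0// ltW.
have volP : (vol P <= \sum_(i in I) vol (cap i))%E.
  rewrite -[leRHS](@measure_bigsetU_ord_cond _ _ _ mu m (mem I) cap)//; last first.
    by apply: trivC => i x [].
  have mU : measurable (\big[setU/set0]_(i in I) cap i : set (borel_rV R n)).
    by apply: bigsetU_measurable.
  have m0 : measurable ([set x : 'rV[R]_n | dotp x x <= 0] : set (borel_rV R n)).
    exact: measurable_sqball.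
  apply: (@le_trans _ _ (mu ([set x : 'rV[R]_n | dotp x x <= 0] `|` \big[setU/set0]_(i in I) cap i))).
    by apply: le_vol => //; exact: measurableU.
  apply: (le_trans (measureU2 _ m0 mU)).
  rewrite [X in (X + _ <= _)%E](_ : _ = 0%E).
    by rewrite add0e.
  have := @vol_sqball_sqrt R n 0 (lexx 0).
  by rewrite sqrtr0 expr0n/= mul0r.
have volD : (\sum_(i in I) vol (diff i) <= Delta)%E.
  rewrite -[leLHS](@measure_bigsetU_ord_cond _ _ _ mu m (mem I) diff)//; last first.
    by apply: trivC => i x [].
  apply: le_vol => //; first by apply: bigsetU_measurable.
  by rewrite -bigcup_pred => x [i /= iI]; exact: diff_sub.
have cellb i : i \in I -> (A%:E * vol (cap i) <= (2 + n%:R * s)%:E * vol (diff i) + T%:E)%E.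
  move=> iI; have [wi0|wi0] := eqVneq (w i) 0.
    have -> : cap i = set0.
      by apply/seteqP; split => // x [[]]; rewrite wi0 dotp0l ltxx.
    by rewrite vol_set0 mule0 adde_ge0// ?lee_fin// mule_ge0 ?vol_ge0// lee_fin.
  apply: rotated_cell_bound => //.
  - by move=> x [].
  - exact: cellZ.
  - exact: cellD.
  apply: (@vol_bounded_lty _ _ _ M); [exact: mcap|exact: M0|].
  by move=> x /(cap_sub iI); exact: PM.
have kP : ((kappa n)%:E <= vol P + Delta)%E.
  rewrite -kappaE; apply: le_trans (measureU2 mu mP mdiffset).
  apply: le_vol => //; first exact: measurableU.
  by move=> x Dx; have [Px|nPx] := pselect (P x); [left|right; left].
rewrite EFinM; apply: (le_trans (lee_wpmul2l _ kP)); first by rewrite lee_fin.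
rewrite ge0_muleDr ?vol_ge0// [X in (_ <= X * _ + _)%E]EFinD ge0_muleDl ?lee_fin//.
rewrite addeAC; apply: leeD => //.
apply: (le_trans (lee_wpmul2l _ volP)); first by rewrite lee_fin.
rewrite ge0_sume_distrr; last by move=> i _; exact: vol_ge0.
apply: (le_trans (lee_sum _ cellb)).
rewrite big_split; apply: leeD.
  apply: le_trans (lee_wpmul2l _ volD); last by rewrite lee_fin.
  by rewrite ge0_sume_distrr// => i _; exact: vol_ge0.
rewrite sumEFin lee_fin sumr_const -[T *+ _]mulr_natl; apply: ler_wpM2r => //.
by rewrite ler_nat.
Qed.

End SumOverCells.

(** * Facets and irredundant systems of inequalities *)

Section Facets.
Context {R : realType} (d : nat).
Local Notation n := d.+1.

(** The remaining columns of a rotation that sends u to the first axis. *)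
Lemma exists_tangent_frame (u : 'rV[R]_n) : u != 0 ->
  exists B : 'M[R]_(d, n), B *m B^T = 1%:M /\ B *m u^T = 0.
Proof.
move=> u0; have [Q [QQ Qu]] := exists_rotation u0.
have QtQ : Q^T *m Q = 1%:M by exact: mulmx1C.
exists (rowsub (lift ord0) Q^T); split.
  apply/matrixP => i j; rewrite [RHS]mxE -(inj_eq (@lift_inj _ (ord0 : 'I_n))).
  have := congr1 (fun M : 'M[R]_n => M (lift ord0 i) (lift ord0 j)) QtQ.
  rewrite [X in _ = X -> _]mxE => <-; rewrite !mxE.
  by apply: eq_bigr => k _; rewrite !mxE.
apply/matrixP => i j; rewrite ord1 [RHS]mxE.
have := Qu (row (lift ord0 i) Q^T).
rewrite rowE -mulmxA QtQ mulmx1 mxE eqxx/= => /esym/eqP.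
rewrite mulf_eq0 invr_eq0 [X in _ || X]gt_eqF ?enorm_gt0// orbF => /eqP.
rewrite /dotp -[RHS]/(0 : R) => <-; rewrite mxE; apply: eq_bigr => k _.
by rewrite -rowE !mxE.
Qed.

Lemma exists_common_pos (T : finType) (Q : T -> R -> Prop) :
  (forall j, exists2 e, 0 < e & forall e', 0 < e' -> e' <= e -> Q j e') ->
  exists2 e, 0 < e & forall j, Q j e.
Proof.
move=> h; have /choice[f fP] : forall j, exists e : R, 0 < e /\
    forall e' : R, 0 < e' -> e' <= e -> Q j e'.
  by move=> j; have [e ? ?] := h j; exists e.
exists (\big[Num.min/1]_j f j).
  by elim/big_ind : _ => // [x y x0 y0|j _]; [rewrite lt_min x0|case: (fP j)].
move=> j; have [f0 fQ] := fP j; apply: fQ; last exact: bigmin_le_cond.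
by elim/big_ind : _ => // [x y x0 y0|i _]; [rewrite lt_min x0|case: (fP i)].
Qed.

Lemma exists_step (a c : R) : a < 1 ->
  exists2 e, 0 < e & forall e', 0 < e' -> e' <= e -> a + e' * c <= 1.
Proof.
move=> a1; have c1 : 0 < 1 + `|c| by rewrite ltr_pwDl.
exists ((1 - a) / (1 + `|c|)); first by rewrite divr_gt0// subr_gt0.
move=> e e0; rewrite ler_pdivlMr// => h.
have : e * c <= e * `|c| by rewrite ler_pM2l// ler_norm.
by move: h e0; move: (`|c|) => C; lra.
Qed.

Lemma row_free_scale k (B : 'M[R]_(k, n)) (e : R) : e != 0 ->
  B *m B^T = 1%:M -> row_free (e *: B).
Proof.
move=> e0 BB; apply/row_freeP; exists (e^-1 *: B^T).
by rewrite -scalemxAl -scalemxAr BB scalerA mulfV// scale1r.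
Qed.

(** The vertices of a small simplex at q with edges e along the rows of B:
    witnesses for lower bounds on affine dimension. *)
Definition simplex_points k (q : 'rV[R]_n) (e : R) (B : 'M[R]_(k, n)) (i : 'I_k.+1) : 'rV[R]_n :=
  if unlift ord0 i is Some j then q + e *: row j B else q.

Lemma simplex_points_independent k (q : 'rV[R]_n) (e : R) (B : 'M[R]_(k, n)) :
  e != 0 -> B *m B^T = 1%:M -> affinely_independent (simplex_points q e B).
Proof.
move=> e0 BB; rewrite /affinely_independent.
rewrite (_ : \matrix_i _ = e *: B); first exact: row_free_scale.
apply/row_matrixP => i; rewrite rowK /simplex_points liftK unlift_none.
by rewrite addrC addKr linearZ.
Qed.

Context (m : nat) (w : 'I_m -> 'rV[R]_n).
Let P : set 'rV[R]_n := [set x | forall j, dotp (w j) x <= 1].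

(** The origin satisfies all inequalities strictly, so a small simplex fits. *)
Lemma affine_dim_halfspaces : affine_dim P n.
Proof.
split.
  pose B : 'M[R]_n := 1%:M.
  have [e e0 eP] : exists2 e, 0 < e & forall p : 'I_m * 'I_n,
      dotp (w p.1) 0 + e * dotp (w p.1) (row p.2 B) <= 1.
    apply: (@exists_common_pos _ (fun (p : 'I_m * 'I_n) e =>
      dotp (w p.1) 0 + e * dotp (w p.1) (row p.2 B) <= 1)) => p.
    by apply: exists_step; rewrite dotp0r.
  exists (simplex_points 0 e B); split.
    move=> i j; rewrite /simplex_points; case: unliftP => [k _|_].
      by rewrite dotpDr dotpZr; exact: (eP (j, k)).
    by rewrite dotp0r.
  by apply: simplex_points_independent; [rewrite gt_eqF|rewrite trmx1 mulmx1].
move=> [p [_]]; rewrite /affinely_independent /row_free => /eqP h.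
by have := rank_leq_col (\matrix_(i < n.+1) (p (lift ord0 i) - p ord0)); rewrite h ltnn.
Qed.

(** At a point where only the i-th inequality is tight, a small simplex in the
    hyperplane dotp (w i) x = 1 still fits in P; the face has no larger
    dimension because w i is orthogonal to all its directions. *)
Lemma facet_of_tight (i : 'I_m) (q : 'rV[R]_n) (I : {set 'I_m}) :
  (forall x, (forall j, j \in I -> dotp (w j) x <= 1) -> P x) ->
  dotp (w i) q = 1 -> (forall j, j \in I -> j != i -> dotp (w j) q < 1) ->
  facets P (face P (w i)).
Proof.
move=> IP qi qI; split; first by exists (w i).
exists d; split; last exact: affine_dim_halfspaces.
have wi0 : w i != 0 by apply/eqP => h; move: qi; rewrite h dotp0l => /eqP; rewrite eq_sym oner_eq0.
split.
  have [B [BB Bw]] := exists_tangent_frame wi0.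
  have wB k : dotp (w i) (row k B) = 0.
    by rewrite dotpC dotp_mulmx -row_mul Bw !mxE.
  have [e e0 eP] : exists2 e, 0 < e & forall p : 'I_m * 'I_d,
      p.1 \in I -> dotp (w p.1) q + e * dotp (w p.1) (row p.2 B) <= 1.
    apply: (@exists_common_pos _ (fun (p : 'I_m * 'I_d) e =>
      p.1 \in I -> dotp (w p.1) q + e * dotp (w p.1) (row p.2 B) <= 1)) => -[j k] /=.
    have [jI|jI] := boolP (j \in I); last by exists 1.
    have [->|ji] := eqVneq j i.
      by exists 1 => // e' _ _ _; rewrite wB mulr0 addr0 qi.
    by have [e e0 h] := exists_step (dotp (w j) (row k B)) (qI j jI ji); exists e => // e' h1 h2 _; exact: h.
  have qP : P q.
    apply: IP => j jI; have [->|ji] := eqVneq j i; first by rewrite qi.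
    by apply/ltW; exact: qI.
  exists (simplex_points q e B); split; last first.
    by apply: simplex_points_independent; [rewrite gt_eqF|].
  move=> k; have qk : dotp (w i) (simplex_points q e B k) = 1.
    rewrite /simplex_points; case: unliftP => [k' _|_] //.
    by rewrite dotpDr dotpZr wB mulr0 addr0.
  split; last by move=> y /(_ i); rewrite qk.
  rewrite /simplex_points; case: unliftP => [k' _|_] //.
  by apply: IP => j jI; rewrite dotpDr dotpZr; exact: (eP (j, k')).
move=> [p [pF]]; rewrite /affinely_independent; set A := \matrix_(_ < _) _ => Afree.
have Aunit : A \in unitmx by rewrite -row_free_unit.
have Aw : A *m (w i)^T = 0.
  apply/row_matrixP => k; rewrite row_mul rowK row0.
  apply/matrixP => a b; rewrite !ord1 -dotp_mulmx mxE dotpC dotpBr.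
  have [p1 m1] := pF (lift ord0 k); have [p0 m0] := pF ord0.
  by apply/eqP; rewrite subr_eq0 eq_le m0// m1.
have : (w i)^T = 0 by rewrite -(mulKmx Aunit (w i)^T) Aw mulmx0.
by move/(congr1 trmx); rewrite trmxK trmx0 => /eqP; rewrite (negbTE wi0).
Qed.

(** Take a subsystem of minimal size.  Dropping its i-th inequality admits a
    point outside P, and the segment from the origin to that point crosses the
    boundary where only the i-th inequality is tight.  So each inequality has
    its own facet, and there are at most N. *)
Lemma irredundant_system (N : nat) : (facets P #<= `I_N)%card ->
  exists I : {set 'I_m}, (#|I| <= N)%N /\
    P = [set x | forall j, j \in I -> dotp (w j) x <= 1].
Proof.
move=> fN.
pose Q (I : {set 'I_m}) := `[< forall x, (forall j, j \in I -> dotp (w j) x <= 1) -> P x >].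
have QT : Q [set: 'I_m]%SET by apply/asboolP => x h j; apply: h; rewrite inE.
have [I /asboolP IP Imin] := @arg_minnP _ _ Q (fun I => #|I|) QT.
exists I; split; last first.
  by apply/seteqP; split => x; [move=> h j _; exact: h|exact: IP].
have tight i : i \in I -> exists q, dotp (w i) q = 1 /\
    forall j, j \in I -> j != i -> dotp (w j) q < 1.
  move=> iI; have : ~ Q (I :\ i)%SET.
    by move=> /Imin; rewrite (cardsD1 i I) iI add1n ltnn.
  move=> nQ.
  have /existsNP[x /not_implyP[xI nPx]] :
      ~ forall x, (forall j, j \in (I :\ i)%SET -> dotp (w j) x <= 1) -> P x.
    by move=> h; apply: nQ; apply/asboolP.
  have wx : 1 < dotp (w i) x.
    rewrite ltNge; apply/negP => h; apply: nPx; apply: IP => j jI.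
    by have [->//|ji] := eqVneq j i; apply: xI; rewrite !inE ji.
  have wx0 : 0 < dotp (w i) x by apply: lt_trans wx.
  exists ((dotp (w i) x)^-1 *: x); split; first by rewrite dotpZr mulVf// gt_eqF.
  move=> j jI ji; rewrite dotpZr mulrC ltr_pdivrMr// mul1r.
  by apply: (@le_lt_trans _ _ 1) => //; apply: xI; rewrite !inE ji.
have /choice[q qP] : forall i, exists q, i \in I -> dotp (w i) q = 1 /\
    forall j, j \in I -> j != i -> dotp (w j) q < 1.
  move=> i; have [/tight[q h]|_] := boolP (i \in I); first by exists q.
  by exists 0.
have qPP i : i \in I -> P (q i).
  move=> iI; apply: IP => j jI; have [->|ji] := eqVneq j i; first by rewrite (qP i iI).1.
  by apply/ltW; exact: (qP i iI).2.
have faceI i : i \in I -> facets P (face P (w i)).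
  by move=> iI; have [h1 h2] := qP i iI; exact: (facet_of_tight IP h1 h2).
have faceinj i j : i \in I -> j \in I -> face P (w i) = face P (w j) -> i = j.
  move=> iI jI e; apply/eqP; apply/negPn/negP => ij.
  have [qi qiI] := qP i iI; have [qj _] := qP j jI.
  have : face P (w i) (q i).
    by split; [exact: qPP|move=> y /(_ i); rewrite qi].
  rewrite e => -[_ /(_ _ (qPP j jI))]; rewrite qj leNgt.
  by rewrite (qiI j jI)// eq_sym.
have [->//|I0] := posnP #|I|.
have [i0 i0I] : exists i0, i0 \in I by apply/card_gt0P.
pose f (k : nat) := face P (w (nth i0 (enum I) k)).
have fI k : (k < #|I|)%N -> nth i0 (enum I) k \in I.
  by move=> kI; rewrite -mem_enum mem_nth// -cardE.
have finj : {in `I_#|I| &, injective f}.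
  move=> k l; rewrite !inE/= => kI lI /(faceinj _ _ (fI _ kI) (fI _ lI)) /eqP.
  by rewrite nth_uniq ?enum_uniq -?cardE// => /eqP.
have : (`I_#|I| #<= facets P)%card.
  apply: (@card_le_trans _ _ _ (f @` `I_#|I|)).
    by rewrite (card_le_eqr (inj_card_eq finj)).
  by apply: subset_card_le => _ [k kI <-]; apply: faceI; exact: fI.
by move=> /card_le_trans /(_ fN); rewrite card_le_II.
Qed.

End Facets.

(** * Polytopes with or without the origin in the interior *)

Section PolytopeDichotomy.
Context {R : realType} (d N : nat).
Local Notation n := d.+1.
Local Notation leb := (@lebesgue_measure R).
Local Notation D := (unit_ball R n).

Lemma coord_le_norm k (x : 'rV[R]_k) i : `|x 0 i| <= `|x|.
Proof.
rewrite [X in _ <= X]mx_normrE.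
exact: (le_bigmax _ (fun ij : 'I_1 * 'I_k => `|x ij.1 ij.2|) (0, i)).
Qed.

Lemma bounded_set_coord k (P : set 'rV[R]_k) : bounded_set P ->
  exists M, forall x, P x -> forall i, `|x 0 i| <= M.
Proof.
move=> [M [_ h]]; exists (M + 1) => x Px i.
by apply: (le_trans (coord_le_norm x i)); apply: (h (M + 1)) => //; rewrite ltrDl.
Qed.

Lemma vol_hyperplane0 (A : set 'rV[R]_n) :
  vol (A `&` [set x : 'rV[R]_n | x 0 0 = 0]) = 0%E.
Proof.
rewrite vol_consrV.
rewrite (_ : (fun h => _) = (fun h : R => (h == 0)%:R%:E *
    vol [set y | A (consrV (0%R, y))])%E).
  apply/esym; transitivity (\int[leb]_(h in [set 0%R]) vol [set y | A (consrV (0%R, y))])%E.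
    by rewrite integral_set1.
  rewrite integral_mkcond; apply: eq_integral => h _; rewrite /patch.
  case: ifPn => [/set_mem ->|]; first by rewrite eqxx mul1e.
  by rewrite notin_setE/= => /eqP/negbTE ->; rewrite mul0e.
apply/funext => h; have [->|h0] := eqVneq h 0.
  rewrite mul1e; congr (vol _); apply/seteqP; split => y /=; first by case.
  by move=> ?; split => //; rewrite consrV0.
rewrite mul0e -(vol_set0 d); congr (vol _); apply/seteqP; split => y //= [_].
by rewrite consrV0/= => e; rewrite e eqxx in h0.
Qed.

(** Central symmetry: an open half-space bounded by a hyperplane through the
    centre contains half of the ball. *)
Lemma vol_half_ball (u : 'rV[R]_n) : u != 0 ->
  (((kappa n / 2 : R)%:E) <= vol (D `&` [set x : 'rV[R]_n | (0 < dotp u x)%R]))%E.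
Proof.
move=> u0; have mD := @measurable_unit_ball R n.
pose H := D `&` [set x : 'rV[R]_n | (0 < dotp u x)%R].
pose H' := D `&` [set x : 'rV[R]_n | (dotp u x < 0)%R].
pose H0 := D `&` [set x : 'rV[R]_n | dotp u x = 0].
have mu0 := @measurable_linear R d u.
have mH : measurable (H : set (borel_rV R n)).
  by apply: measurableI => //; exact: measurable_set_lt.
have mH' : measurable (H' : set (borel_rV R n)).
  by apply: measurableI => //; exact: measurable_set_lt.
have mH0 : measurable (H0 : set (borel_rV R n)).
  apply: measurableI => //.
  rewrite (_ : [set x | _] = [set x : 'rV[R]_n | dotp u x <= 0] `&` [set x : 'rV[R]_n | 0 <= dotp u x]).
    by apply: measurableI; exact: measurable_set_le.
  apply/seteqP; split => x /=; first by move=> ->.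
  by move=> [h1 h2]; apply/eqP; rewrite eq_le h1.
have HH' : vol H' = vol H.
  rewrite -(vol_opp mH); congr (vol _); apply/seteqP; split => x [h1 h2]; split.
  - by apply/unit_ballP; rewrite dotpNl dotpNr opprK; apply/unit_ballP.
  - by rewrite /= dotpNr oppr_gt0.
  - by move/unit_ballP: h1; rewrite dotpNl dotpNr opprK => /unit_ballP.
  - by move: h2; rewrite /= dotpNr oppr_gt0.
have H00 : vol H0 = 0%E.
  have [Q [QQ Qu]] := exists_rotation u0.
  have QQt : Q^T *m (Q^T)^T = 1%:M by rewrite trmxK; exact: mulmx1C.
  rewrite -(vol_orthogonal QQt mH0) -(vol_hyperplane0 D); congr (vol _).
  have E (x : 'rV[R]_n) : dotp u (x *m Q^T) = 0 <-> x 0 0 = 0.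
    have := Qu (x *m Q^T); rewrite -mulmxA (mulmx1C QQ) mulmx1 dotpC => ->.
    split => [->|/eqP]; first by rewrite mul0r.
    by rewrite mulf_eq0 invr_eq0 [X in _ || X]gt_eqF ?enorm_gt0// orbF => /eqP.
  apply/seteqP; split => x [/unit_ballP h1 /= h2]; split.
  - by apply/unit_ballP; move: h1; rewrite dotp_orthogonal.
  - exact/E.
  - by apply/unit_ballP; rewrite dotp_orthogonal.
  - exact/E.
have : (vol D <= vol H + vol H' + vol H0)%E.
  apply: (@le_trans _ _ (vol ((H `|` H') `|` H0))).
    apply: le_vol => //; first by apply: measurableU => //; exact: measurableU.
    by move=> x Dx; have [h|h|h] := ltgtP (dotp u x) 0; [left; right|left; left|right].
  apply: (le_trans (measureU2 (@volm R n) _ _)) => //; first exact: measurableU.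
  by apply: leeD => //; exact: measureU2.
rewrite H00 HH' adde0 kappaE; have := @vol_ge0 R n H.
have := @vol_bounded_lty R n H 1 mH ler01 _.
case: (vol H) => [x| |] //.
  move=> _ _; rewrite -EFinD !lee_fin => h; lra.
by move=> _ _ _; rewrite leey.
Qed.

(** If the origin is not interior, P misses an open half-space through the
    centre, which contains half of the ball.  Otherwise the right-hand sides
    can be normalized to 1 and the sum over cells applies. *)
Lemma polytope_dichotomy (P : set 'rV[R]_n) : (0 < d)%N ->
  polytopes_upto R n N P ->
  ((kappa n / 2 : R)%:E <= symdiff_vol D P)%E \/
  forall s lam r : R, 0 < s -> 0 < lam < 1 -> 0 < r ->
  contraction_gain d lam * r ^+ 2 <= s ->
  ((contraction_gain d lam * r ^+ 2 * n%:R * kappa n)%:E <=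
   (2 + n%:R * s + contraction_gain d lam * r ^+ 2 * n%:R)%:E * symdiff_vol D P +
   (N%:R * (contraction_gain d lam * (1 + s) * (r ^+ d.+2 * (2 / d.+2%:R * kappa d))))%:E)%E.
Proof.
move=> d0 [[bP [m [u [b [u0 PE]]]]] fN].
have [M PM] := bounded_set_coord bP.
have mP : measurable (P : set (borel_rV R n)).
  rewrite (_ : P = \bigcap_(i in [set` [set: 'I_m]%SET]) [set x | dotp (u i) x <= b i]); last first.
    rewrite PE; apply/seteqP; split => x h i; first by move=> _; exact: h.
    by apply: h; rewrite /= inE.
  by apply: fin_bigcap_measurable => // i _; apply: measurable_set_le => //; exact: measurable_linear.
have mD := @measurable_unit_ball R n.
have [[i bi]|bpos] := pselect (exists i, b i <= 0).
  left; apply: (le_trans (vol_half_ball (u0 i))); apply: le_vol.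
  - apply: measurableI => //; apply: measurable_set_lt => //; exact: measurable_linear.
  - by apply: measurableU; exact: measurableD.
  move=> x [Dx /= ux]; left; split => //; rewrite PE => /(_ i) h.
  by have := lt_le_trans ux (le_trans h bi); rewrite ltxx.
right; have {}bpos i : 0 < b i.
  by rewrite ltNge; apply/negP => h; apply: bpos; exists i.
pose w i := (b i)^-1 *: u i.
have PW : P = [set x | forall j, dotp (w j) x <= 1].
  by rewrite PE; apply/seteqP; split => x h i; have := h i;
    rewrite /w dotpZl ler_pdivrMl ?bpos// mulr1.
move: fN; rewrite PW => fN; have [I [IN PI]] := irredundant_system fN.
have PM' x : (forall j, j \in I -> dotp (w j) x <= 1) -> forall i, `|x 0 i| <= M.
  by move=> h; apply: PM; rewrite PW PI.
move=> s lam r s0 lam01 r0 crs; rewrite /symdiff_vol PI.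
exact: (@cells_sum_bound R d m N w I M).
Qed.

End PolytopeDichotomy.

(** * Choice of the parameters *)

Section Numerics.
Context {R : realType}.

(** e^-1 >= (1 - 1/64)^64, bounded below by six rounded squarings. *)
Lemma expR1_le : expR 1 <= 11 / 4 :> R.
Proof.
have h : 63 / 64 <= expR (- (1 / 64)) :> R.
  by have := expR_ge1Dx (- (1 / 64) : R); lra.
have h64 : (63 / 64) ^+ 64 <= expR (- 1) :> R.
  rewrite (_ : -1 = 64%:R * - (1 / 64) :> R); last by lra.
  by rewrite expRM_natl lerXn2r ?nnegrE ?expR_ge0//; lra.
have sq (a b : R) k : 0 <= a -> a <= (63 / 64) ^+ k -> b <= a ^+ 2 -> b <= (63 / 64) ^+ (k * 2).
  move=> a0 ak ba; rewrite exprM; apply: (le_trans ba).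
  by rewrite lerXn2r// nnegrE (le_trans a0).
have h1 : 63 / 64 <= (63 / 64) ^+ 1 :> R by rewrite expr1.
have h2 : 125 / 129 <= (63 / 64) ^+ (1 * 2) :> R by apply: (sq _ _ _ _ h1); [lra|rewrite expr2; lra].
have h4 : 123 / 131 <= (63 / 64) ^+ (1 * 2 * 2) :> R by apply: (sq _ _ _ _ h2); [lra|rewrite expr2; lra].
have h8 : 67 / 76 <= (63 / 64) ^+ (1 * 2 * 2 * 2) :> R by apply: (sq _ _ _ _ h4); [lra|rewrite expr2; lra].
have h16 : 136 / 175 <= (63 / 64) ^+ (1 * 2 * 2 * 2 * 2) :> R by apply: (sq _ _ _ _ h8); [lra|rewrite expr2; lra].
have h32 : 93 / 154 <= (63 / 64) ^+ (1 * 2 * 2 * 2 * 2 * 2) :> R by apply: (sq _ _ _ _ h16); [lra|rewrite expr2; lra].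
have h64' : 4 / 11 <= (63 / 64) ^+ (1 * 2 * 2 * 2 * 2 * 2 * 2) :> R by apply: (sq _ _ _ _ h32); [lra|rewrite expr2; lra].
have {h64 h64'} : 4 / 11 <= expR (- 1) :> R by apply: (le_trans h64').
rewrite expRN => h3.
have e0 : 0 < expR 1 :> R by exact: expR_gt0.
have : 4 / 11 * expR 1 <= 1 :> R by rewrite -ler_pdivlMr// div1r.
by move: (expR 1) => e; lra.
Qed.

Lemma expn_1Dx_le (d k : nat) : (0 < d)%N ->
  (1 + k%:R / d%:R) ^+ d <= expR 1 ^+ k :> R.
Proof.
move=> d0; have d0' : d%:R != 0 :> R by rewrite pnatr_eq0 -lt0n.
apply: (@le_trans _ _ (expR (k%:R / d%:R) ^+ d)).
  by rewrite lerXn2r ?nnegrE ?expR_ge0 ?expR_ge1Dx// addr_ge0// divr_ge0.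
rewrite -!expRM_natl mulr1.
by rewrite le_eqVlt; apply/orP; left; apply/eqP; congr expR; field.
Qed.

(** The squared radius of the comparison ball is N^(-2/d) times this constant;
    the factor 19/20 makes [rho_le] true and leaves room for the error terms. *)
Definition rho (d : nat) : R :=
  19 / 20 * (1 + 1 / d%:R) * (1 + 2 / d%:R).

Lemma rho_gt0 d : 0 < rho d.
Proof.
have h : 0 <= (d%:R : R)^-1 by rewrite invr_ge0.
by rewrite /rho; nra.
Qed.

(** Together with [kappaS_ge], this says that N balls of the comparison radius
    in dimension d have total volume at most n kappa_n.  As d grows the left
    side tends to 0 and the right side to 16, so only small d need their own
    computation. *)
Lemma rho_le (d : nat) : (0 < d)%N ->
  rho d ^+ d <= (4 * d.+1%:R / d.+2%:R) ^+ 2.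
Proof.
move=> d0; have [d9|] := leqP 9 d; last first.
  rewrite /rho; case: d d0 => [//|[|[|[|[|[|[|[|[|//]]]]]]]]] _ _; lra.
rewrite /rho 2!exprMn.
have h1 := expn_1Dx_le 1 d0; have h2 := expn_1Dx_le 2 d0.
have e0 := expR_ge0 (1 : R); have e1 := expR1_le.
have h3 : (19 / 20) ^+ d <= 631 / 1000 :> R.
  apply: (@le_trans _ _ ((19 / 20) ^+ 9)); last by lra.
  by apply: ler_wiXn2l => //; lra.
have h4 : (1 + 1 / d%:R) ^+ d <= 11 / 4 :> R by rewrite (le_trans h1)// expr1.
have h5 : (1 + 2 / d%:R) ^+ d <= (11 / 4) ^+ 2 :> R.
  apply: (le_trans h2); apply: lerXn2r; [exact: e0| |exact: e1].
  by rewrite nnegrE divr_ge0.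
have h6 : 40 / 11 <= 4 * d.+1%:R / d.+2%:R :> R.
  rewrite ler_pdivlMr ?ltr0n// -[d.+2%:R]natr1 -[d.+1%:R]natr1; have : 9%:R <= d%:R :> R by rewrite ler_nat.
  by move: (d%:R : R) => x; lra.
have h7 : (40 / 11) ^+ 2 <= (4 * d.+1%:R / d.+2%:R) ^+ 2 :> R.
  by rewrite lerXn2r// nnegrE divr_ge0// mulr_ge0.
have d1 : 0 <= 1 + 1 / d%:R :> R by rewrite addr_ge0// divr_ge0.
have d2 : 0 <= 1 + 2 / d%:R :> R by rewrite addr_ge0// divr_ge0.
apply: le_trans h7.
apply: (@le_trans _ _ (631 / 1000 * (11 / 4) * (11 / 4) ^+ 2)); last by lra.
have p1 : 0 <= (19 / 20) ^+ d :> R by rewrite exprn_ge0// divr_ge0.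
have p2 : 0 <= (1 + 1 / d%:R) ^+ d :> R by rewrite exprn_ge0.
have p3 : 0 <= (1 + 2 / d%:R) ^+ d :> R by rewrite exprn_ge0.
exact: (ler_pM (mulr_ge0 p1 p2) p3 (ler_pM p1 p2 h3 h4) h5).
Qed.

(** The choice lam = d/(d+1), which keeps lam^-d below e, squared radius
    rho * th^4 and truncation level s = th^3, where th^4 = N^(-2/d).  The first
    part is the condition c r^2 <= s; in the second, X stands for the volume of
    the symmetric difference and k for that of the ball.  Then
    A is about (19/10) (1 + 2/d) / (1 + E) th^4, of which the last term takes
    away the fraction 2/(d+2), and 19/10 / (1 + 11/4) > 1/2 leaves th^4 / 4. *)
Lemma parameters_ok (d : nat) (th k X E : R) : (0 < d)%N -> 0 < th -> th <= 1 / 1000 ->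
  d.+1%:R * th ^+ 2 <= 1 -> 0 < k -> 1 <= E -> E <= 11 / 4 ->
  let c := 2 * (d%:R / d.+1%:R) * (1 - d%:R / d.+1%:R) / (1 + E) in
  let A := c * (rho d * th ^+ 4) * d.+1%:R in
  A / d.+1%:R <= th ^+ 3 /\
  (A * k <= (2 + d.+1%:R * th ^+ 3 + A) * X + A * (1 + th ^+ 3) * (2 / d.+2%:R) * k ->
   th ^+ 4 / 4 * k <= X).
Proof.
move=> d0 th0 th1 nth k0 E1 E2 c A.
have dp : 0 < d%:R :> R by rewrite ltr0n.
have d1 : 1 <= d%:R :> R by rewrite ler1n.
have th3 : 0 < th ^+ 3 by rewrite exprn_gt0.
have th4 : 0 < th ^+ 4 by rewrite exprn_gt0.
have AE : A = 19 / 10 * (1 + 2 / d%:R) / (1 + E) * th ^+ 4.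
  rewrite /A /c /rho -[d.+1%:R]natr1; move: (d%:R : R) dp (th ^+ 4) => x x0 t.
  by field; rewrite ?gt_eqF//= ?addr_gt0//; lra.
have di : d%:R^-1 <= 1 :> R by rewrite invf_le1.
have di0 : 0 < (d%:R : R)^-1 by rewrite invr_gt0.
have Ei : (1 + E)^-1 <= 1 / 2 by rewrite -[X in _ <= X]invf_div divr1 lef_pV2 ?posrE; lra.
have Ei2 : 4 / 15 <= (1 + E)^-1 by rewrite -[X in X <= _]invf_div lef_pV2 ?posrE; lra.
have A0 : 0 < A.
  by rewrite AE mulr_gt0// divr_gt0; lra.
have A1 : A <= 57 / 20 * th ^+ 4.
  rewrite AE ler_pM2r//; move: Ei Ei2 di di0; move: ((1 + E)^-1) (d%:R^-1) => e x; nra.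
have th31 : th ^+ 3 <= th / 1000.
  have : th ^+ 2 <= 1 / 1000 by rewrite expr2; nra.
  by rewrite exprS; move: (th ^+ 2) => y h; nra.
have th41 : th ^+ 4 <= th ^+ 3 / 1000 by rewrite exprS; nra.
split.
  rewrite ler_pdivrMr ?ltr0n// -[d.+1%:R]natr1; apply: (le_trans A1).
  by move: (th ^+ 3) (th ^+ 4) th3 th4 th41 => a b; nra.
have ns : d.+1%:R * th ^+ 3 <= th.
  have := ler_wpM2r (ltW th0) nth; rewrite -mulrA -exprSr mul1r; exact.
clearbody A.
have key : th ^+ 4 / 4 * (2 + d.+1%:R * th ^+ 3 + A) <=
    A - A * (1 + th ^+ 3) * (2 / d.+2%:R).
  have -> : A - A * (1 + th ^+ 3) * (2 / d.+2%:R) =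
      19 / 10 * (1 - 2 * th ^+ 3 / d%:R) / (1 + E) * th ^+ 4.
    rewrite AE -[d.+2%:R]natr1 -[d.+1%:R]natr1; move: (d%:R : R) dp (th ^+ 4) (th ^+ 3) => x x0 t s.
    by field; rewrite ?gt_eqF//=; lra.
  rewrite [X in X <= _]mulrAC -mulrA [X in X <= _]mulrC ler_pM2r//.
  have h1 : 19 / 10 * (1 - 2 * th ^+ 3) * (4 / 15) <=
      19 / 10 * (1 - 2 * th ^+ 3 / d%:R) / (1 + E).
    have h2 : 2 * th ^+ 3 / d%:R <= 2 * th ^+ 3 by rewrite ler_piMr// mulr_ge0// ltW.
    have h3 : 0 <= 1 - 2 * th ^+ 3 by move: th31 th1; move: (th ^+ 3) => y; lra.
    apply: ler_pM => //; first by rewrite mulr_ge0.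
    by rewrite ler_pM2l// lerD2l lerN2.
  apply: le_trans h1.
  by move: ns A1 th31 th41 th1 th0; move: (d.+1%:R * th ^+ 3) (th ^+ 3) (th ^+ 4) => a b e; lra.
move=> h.
have B0 : 0 < 2 + d.+1%:R * th ^+ 3 + A by rewrite !addr_gt0// mulr_gt0.
rewrite -(ler_pM2l B0).
have := ler_wpM2r (ltW k0) key.
move: h; move: (2 + d.+1%:R * th ^+ 3 + A) => B h1 h2.
rewrite mulrA [B * _]mulrC; apply: (le_trans h2); rewrite mulrBl lerBlDr.
exact: h1.
Qed.

End Numerics.

Section PolytopeLowerBound.
Context {R : realType}.

(** With th = N^(-1/(2d)), the hypothesis N >= n^n gives n th^2 <= 1, so that
    the correction n s = n th^3 is at most th; and N kappa_d r^d <= n kappa_n by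
    [rho_le] and [kappaS_ge]. *)
Lemma symdiff_lower_bound (d N : nat) (P : set 'rV[R]_d.+1) : (0 < d)%N ->
  (d.+1 ^ d.+1 <= N)%N -> polytopes_upto R d.+1 N P ->
  N%:R `^ (- (2 / (d.+1%:R - 1))) <= (1 / 1000 : R) ^+ 4 ->
  ((N%:R `^ (- (2 / (d.+1%:R - 1))) / 4 * kappa d.+1 : R)%:E <=
    symdiff_vol (unit_ball R d.+1) P)%E.
Proof.
move=> d0 nN hP; pose x : R := N%:R; pose th := x `^ (- (1 / (2 * d%:R))).
have dp : 0 < d%:R :> R by rewrite ltr0n.
have N0 : (0 < N)%N by rewrite (leq_trans _ nN)// expn_gt0.
have x0 : 0 < x by rewrite ltr0n.
have th0 : 0 < th by rewrite powR_gt0.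
have -> : N%:R `^ (- (2 / (d.+1%:R - 1))) = th ^+ 4.
  rewrite /th -powR_mulrn ?powR_ge0// -powRrM; congr (_ `^ _).
  rewrite -[d.+1%:R]natr1; field; rewrite gt_eqF//.
have e0 : 0 <= 1 / 1000 :> R by lra.
have -> : (th ^+ 4 <= (1 / 1000) ^+ 4) = (th <= 1 / 1000).
  by apply: ler_pXn2r => //; rewrite nnegrE ltW.
move=> th1.
have xth : x * th ^+ (2 * d) = 1.
  rewrite /th -powR_mulrn ?powR_ge0// -powRrM.
  rewrite (_ : _ * (2 * d)%:R = - 1); last by rewrite natrM; field; rewrite gt_eqF.
  by rewrite powR_inv1 ?(ltW x0)// mulfV// gt_eqF.
have nth : d.+1%:R * th ^+ 2 <= 1.
  rewrite -(@expr_le1 _ d)//; last by rewrite mulr_ge0// sqr_ge0.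
  rewrite exprMn -exprM -[X in _ <= X]xth; apply: ler_wpM2r; first by rewrite exprn_ge0// ltW.
  by rewrite -natrX ler_nat (leq_trans _ nN)// leq_exp2l.
have k0 := @kappa_gt0 R d.+1.
have [half|bound] := polytope_dichotomy d0 hP.
  apply: le_trans half; rewrite lee_fin [X in _ <= X]mulrC ler_pM2r//.
  have : th ^+ 4 <= 1 by rewrite exprn_ile1// ?(ltW th0)//; lra.
  by move: (th ^+ 4) => t; lra.
pose lam : R := d%:R / d.+1%:R.
have d1p : 0 < d.+1%:R :> R by rewrite ltr0n.
have lam01 : 0 < lam < 1.
  by rewrite divr_gt0//= ltr_pdivrMr// mul1r ltr_nat.
pose E := lam ^- d.
have EE : E = (1 + 1 / d%:R) ^+ d.
  rewrite /E -exprVn invf_div; congr (_ ^+ _); rewrite -natr1; field.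
  by rewrite gt_eqF.
have E1 : 1 <= E by rewrite EE exprn_ege1// lerDl divr_ge0.
have E2 : E <= 11 / 4.
  by rewrite EE (le_trans (expn_1Dx_le 1 d0))// expr1 expR1_le.
pose r := Num.sqrt (rho d * th ^+ 4).
have rr : 0 < rho d * th ^+ 4 by rewrite mulr_gt0 ?rho_gt0// exprn_gt0.
have r0 : 0 < r by rewrite sqrtr_gt0.
have r2 : r ^+ 2 = rho d * th ^+ 4 by rewrite sqr_sqrtr// ltW.
have xr : x * r ^+ d <= 4 * d.+1%:R / d.+2%:R.
  rewrite -ler_sqr ?nnegrE; last 2 first.
  - by rewrite mulr_ge0 ?exprn_ge0 ?(ltW x0) ?(ltW r0).
  - by rewrite divr_ge0.
  apply: le_trans (@rho_le R d d0); rewrite exprMn -exprM mulnC exprM r2 exprMn.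
  rewrite -exprM mulrCA (_ : (4 * d)%N = (2 * d * 2)%N); last by rewrite mulnAC.
  by rewrite [in X in _ * X]exprM -exprMn xth expr1n mulr1.
have ck : 4 * d.+1%:R / d.+2%:R * kappa d <= d.+1%:R * kappa d.+1 :> R.
  have := ler_wpM2l (ltW d1p) (@kappaS_ge R d); apply: le_trans.
  by rewrite le_eqVlt; apply/orP; left; apply/eqP; ring.
have [p1 p2] := @parameters_ok R d th (kappa d.+1) 0 E d0 th0 th1 nth k0 E1 E2.
have s0 : 0 < th ^+ 3 by rewrite exprn_gt0.
have crs : contraction_gain d lam * r ^+ 2 <= th ^+ 3.
  apply: le_trans p1; rewrite /contraction_gain -/E r2 -/lam.
  by rewrite le_eqVlt; apply/orP; left; apply/eqP; rewrite mulfK// gt_eqF.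
have := bound _ _ _ s0 lam01 r0 crs.
have := @vol_ge0 R d.+1 (unit_ball R d.+1 `+` P).
rewrite /symdiff_vol; case: (vol _) => [X| |] //; last by move=> _ _; rewrite leey.
move=> _; rewrite -!EFinM -EFinD !lee_fin => h.
have [_] := @parameters_ok R d th (kappa d.+1) X E d0 th0 th1 nth k0 E1 E2; apply.
have cE : contraction_gain d lam = 2 * (d%:R / d.+1%:R) * (1 - d%:R / d.+1%:R) / (1 + E) by [].
rewrite -cE -r2; apply: (le_trans h); rewrite lerD2l.
have c0 : 0 <= contraction_gain d lam.
  have /andP[l0 l1] := lam01.
  by rewrite divr_ge0 ?mulr_ge0 ?subr_ge0 ?(ltW l0) ?(ltW l1)// addr_ge0// (le_trans _ E1).
move: (contraction_gain d lam) c0 => c c0.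
rewrite [r ^+ d.+2](_ : _ = r ^+ d * r ^+ 2); last by rewrite -exprD addn2.
have q0 : 0 <= c * (1 + th ^+ 3) * (r ^+ 2 * (2 / d.+2%:R)).
  apply: mulr_ge0; last by rewrite mulr_ge0 ?sqr_ge0 ?divr_ge0.
  by rewrite mulr_ge0// addr_ge0// ltW.
have ck2 : x * r ^+ d * kappa d <= d.+1%:R * kappa d.+1.
  by apply: le_trans ck; rewrite ler_wpM2r// ltW// kappa_gt0.
have := ler_wpM2l q0 ck2.
rewrite -/x; move: (r ^+ 2) (r ^+ d) (2 / d.+2%:R) (kappa d) (kappa d.+1) (th ^+ 3) (d.+1%:R : R).
move=> a b e f g i j h2; apply: le_trans (le_trans _ h2) _;
  by rewrite le_eqVlt; apply/orP; left; apply/eqP; ring.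
Qed.

End PolytopeLowerBound.

Section ErrorTerm.
Context {R : realType}.

(** When N^(-2/(n-1)) exceeds the threshold T, an error term -1/4 is of the
    allowed order and makes the bound trivial. *)
Lemma symdiff_bound_with_error :
  exists (C : R) (r : nat -> nat -> R),
    (forall n N : nat, (2 <= n)%N -> (n ^ n <= N)%N ->
       `|r n N| <= C * N%:R `^ (- (2 / (n%:R - 1)))) /\
    (forall (n N : nat) (P : set 'rV[R]_n), (2 <= n)%N -> (n ^ n <= N)%N ->
       polytopes_upto R n N P ->
       (((4^-1 + r n N) * N%:R `^ (- (2 / (n%:R - 1))))%:E
          * vol (unit_ball R n) <= symdiff_vol (unit_ball R n) P)%E).
Proof.
have [T TE] : exists T : R, T = (1 / 1000) ^+ 4 by eexists.
have e0 : 0 < 1 / 1000 :> R by lra.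
have T0 : 0 < T by rewrite TE; exact: exprn_gt0.
pose t n N : R := N%:R `^ (- (2 / (n%:R - 1))).
exists T^-1, (fun n N => if t n N <= T then 0 else - 4^-1); split.
  move=> n N _ _; rewrite -/(t n N).
  have t0 : 0 <= t n N by exact: powR_ge0.
  have [h|h] := leP (t n N) T; first by rewrite normr0 mulr_ge0// invr_ge0 ltW.
  rewrite normrN gtr0_norm ?invr_gt0// mulrC.
  by apply: (@le_trans _ _ 1); [lra | rewrite ler_pdivlMr// mul1r ltW].
case=> [//|d] N P d0 nN hP; rewrite -/(t d.+1 N); have [h|h] := leP (t d.+1 N) T; last first.
  by rewrite addrN mul0r mul0e vol_ge0.
rewrite addr0 kappaE -EFinM [4^-1 * _]mulrC.
by apply: symdiff_lower_bound => //; rewrite -TE.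
Qed.

End ErrorTerm.

(** * The unit ball as a smooth convex body *)

Section UnitBallBody.
Context {R : realType}.

Lemma continuous_dotp_self n : continuous (fun x : 'rV[R]_n => dotp x x).
Proof.
apply: continuous_big => [|i _]; first exact: add_continuous.
by move=> x; apply: (cvgM (@coord_continuous R 1 n 0 i x) (@coord_continuous R 1 n 0 i x)).
Qed.

Lemma closed_unit_ball n : closed (unit_ball R n).
Proof.
rewrite (_ : unit_ball R n = (fun x => dotp x x) @^-1` [set r | r <= 1]).
  by apply: preimage_closed; [move=> x _; exact: continuous_dotp_self|exact: closed_le].
by apply/seteqP; split => x /unit_ballP.
Qed.

Lemma interior_unit_ball n (x : 'rV[R]_n) : dotp x x < 1 -> (unit_ball R n)° x.
Proof.
move=> x1; suff : [set y : 'rV[R]_n | dotp y y < 1] `<=` (unit_ball R n)° by exact.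
rewrite -open_subsetE; first by move=> y /= y1; apply/unit_ballP; exact: ltW.
apply: (@open_comp _ _ (fun y : 'rV[R]_n => dotp y y) [set r | r < 1]).
  by move=> y _; exact: continuous_dotp_self.
exact: open_lt.
Qed.

Lemma bd_unit_ball n (x : 'rV[R]_n) : bd (unit_ball R n) x -> dotp x x = 1.
Proof.
rewrite /bd -(closure_id _).1; last exact: closed_unit_ball.
move=> [/unit_ballP x1 xi]; apply/eqP; rewrite eq_le x1 leNgt/=.
by apply/negP => /interior_unit_ball.
Qed.

Lemma convex_body_unit_ball d : convex_body (unit_ball R d.+1).
Proof.
split.
- apply: bounded_closed_compact; last exact: closed_unit_ball.
  exists 1; split => // M M1 x /unit_ballP x1; rewrite /= [X in X <= _]mx_normrE.
  apply/bigmax_leP; split => [|[i j] _ /=]; first by rewrite ltW// (lt_trans _ M1).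
  rewrite ord1; apply: le_trans (ltW M1); rewrite -(@ler_pXn2r _ 2)// ?nnegrE//.
  rewrite expr1n real_normK ?num_real//; apply: le_trans x1.
  exact: coord_le_dotp.
- move=> x y l; rewrite !inE => /unit_ballP xx /unit_ballP yy; apply/unit_ballP.
  have : 0 <= dotp ((x : 'rV[R]_d.+1) - y) ((x : 'rV[R]_d.+1) - y) by exact: dotp_ge0.
  rewrite /conv/= /unstable.onem !(dotpDl, dotpDr, dotpNl, dotpNr, dotpZl, dotpZr) (dotpC y x).
  have : 0 <= l%:num <= 1 by apply/andP.
  move: l%:num => t /andP[t0 t1] h.
  have t1' : 0 <= 1 - t by rewrite subr_ge0.
  have := mulr_ge0 (mulr_ge0 t0 t1') h.
  have := ler_wpM2l t0 xx; have := ler_wpM2l t1' yy.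
  by move: (dotp x x) (dotp y y) (dotp x y) => a b c; lra.
- by exists 0; apply: interior_unit_ball; rewrite dotp0l.
Qed.

(** Along any line the functions of interest are quadratic polynomials. *)
Lemma derive_quadratic n (f : 'rV[R]_n -> R) (a v : 'rV[R]_n) (l c : R) :
  (forall h, f (h *: v + a) - f a = h * (l + h * c)) ->
  derivable f a v /\ 'D_v f a = l.
Proof.
move=> H; have h : h^-1 *: ((f \o shift a) (h *: v) - f a) @[h --> 0^'] --> l.
  have -> : l = l + 0 * c by rewrite mul0r addr0.
  apply: cvg_trans (_ : (l + h * c) @[h --> 0^'] --> l + 0 * c).
    apply: near_eq_cvg; near=> h; rewrite /= H /GRing.scale/= mulKf//.
    by near: h; exact: nbhs_dnbhs_neq.
  apply: cvgD; first exact: cvg_cst.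
  by apply: cvgMl; exact: nbhs_dnbhs.
split; first by apply/cvg_ex; exists l.
exact: cvg_lim.
Unshelve. all: by end_near. Qed.

(** Its gradient at x is x and its Hessian is the identity. *)
Definition ball_equation n (x : 'rV[R]_n) : R := (dotp x x - 1) / 2.

Lemma ball_equation_derive n (x : 'rV[R]_n) i :
  derivable (@ball_equation n) x (delta_mx 0 i) /\
  pderiv i (@ball_equation n) x = x 0 i.
Proof.
apply: (@derive_quadratic _ _ _ _ _ (1 / 2)) => h.
have xe : dotp x (delta_mx 0 i) = x 0 i.
  rewrite /dotp (bigD1 i)//= mxE !eqxx mulr1 big1 ?addr0// => j /negbTE ji.
  by rewrite mxE ji andbF mulr0.
have ee : dotp (delta_mx 0 i : 'rV[R]_n) (delta_mx 0 i) = 1.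
  rewrite /dotp (bigD1 i)//= mxE !eqxx mulr1 big1 ?addr0// => j /negbTE ji.
  by rewrite mxE ji andbF mulr0.
rewrite /ball_equation !(dotpDl, dotpDr, dotpZl, dotpZr) (dotpC (delta_mx 0 i) x).
by rewrite xe ee; field.
Qed.

Lemma pderiv_ball_equation n i :
  pderiv i (@ball_equation n) = fun x => x 0 i.
Proof. by apply/funext => x; have [] := ball_equation_derive x i. Qed.

Lemma pderiv_coord n (x : 'rV[R]_n) i j :
  derivable (fun x : 'rV[R]_n => x 0 i) x (delta_mx 0 j) /\
  pderiv j (fun x : 'rV[R]_n => x 0 i) x = (i == j)%:R.
Proof.
apply: (@derive_quadratic _ _ _ _ _ 0) => h.
by rewrite !mxE !eqxx/= eq_sym; ring.
Qed.

Lemma C2_equation_unit_ball d (x : 'rV[R]_d.+1) : dotp x x = 1 ->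
  C2_equation (unit_ball R d.+1) x setT (@ball_equation d.+1).
Proof.
move=> x1; split => //.
- exact: openT.
- move=> y _; split.
  + exact: (cvgM (cvgD (@continuous_dotp_self _ y) (cvg_cst (-1 : R)))
      (cvg_cst (2^-1 : R))).
  + move=> i; split; first by have [] := ball_equation_derive y i.
    by rewrite pderiv_ball_equation; exact: coord_continuous.
  + move=> i j; rewrite pderiv_ball_equation; split.
      by have [] := pderiv_coord y i j.
    have -> : pderiv j (fun x : 'rV[R]_d.+1 => x 0 i) = cst (i == j)%:R.
      by apply/funext => z; have [] := pderiv_coord z i j.
    exact: cst_continuous.
- move=> y _; split.
    by move/unit_ballP => y1; rewrite /ball_equation pmulr_lle0// subr_le0.
  by rewrite /ball_equation pmulr_lle0// subr_le0 => y1; apply/unit_ballP.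
- have -> : grad (@ball_equation d.+1) x = x.
    by apply/rowP => i; rewrite mxE pderiv_ball_equation.
  by rewrite -dotp_gt0 x1.
Qed.

Lemma gauss_curvature_unit_ball d (x : 'rV[R]_d.+1) : dotp x x = 1 ->
  gauss_curvature (unit_ball R d.+1) x 1.
Proof.
move=> x1; have x0 : x != 0 by rewrite -dotp_gt0 x1.
have [B [BB Bx]] := exists_tangent_frame x0.
have gE : grad (@ball_equation d.+1) x = x.
  by apply/rowP => i; rewrite mxE pderiv_ball_equation.
exists setT, (@ball_equation d.+1), B; split => //.
- exact: C2_equation_unit_ball.
- by rewrite gE.
have -> : hess (@ball_equation d.+1) x = 1%:M.
  apply/matrixP => i j; rewrite !mxE pderiv_ball_equation.
  by have [_ ->] := pderiv_coord x i j.
by rewrite gE /enorm x1 sqrtr1 invr1 scale1r mulmx1 BB det1.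
Qed.

End UnitBallBody.

(** * Surface measure of the sphere *)

Section BallSurface.
Context {R : realType} (d : nat).
Local Notation n := d.+1.
Implicit Types (S : set 'rV[R]_n).

Definition direction (y : 'rV[R]_n) : 'rV[R]_n := (enorm y)^-1 *: y.

Definition sector S : set 'rV[R]_n :=
  [set y | [/\ y != 0, S (direction y) & dotp y y <= 1]].

Lemma directionZ (c : R) (y : 'rV[R]_n) : 0 < c -> direction (c *: y) = direction y.
Proof.
move=> c0; have cE : enorm (c *: y) = c * enorm y.
  rewrite /enorm dotpZl dotpZr mulrA -expr2 sqrtrM ?sqr_ge0// sqrtr_sqr.
  by rewrite ger0_norm// ltW.
by rewrite /direction cE scalerA invfM mulrAC mulVf ?mul1r// gt_eqF.
Qed.

Lemma measurable_direction :
  measurable_fun setT (direction : borel_rV R n -> borel_rV R n).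
Proof.
apply: measurable_fun_rV => i.
rewrite (_ : (fun _ => _) = (fun y : borel_rV R n =>
    (Num.sqrt (dotp (y : 'rV[R]_n) y)) `^ (-1) * (y : 'rV[R]_n) 0 i)); last first.
  by apply/funext => y; rewrite /direction mxE powR_inv1// sqrtr_ge0.
apply: measurable_funM; last exact: measurable_coord.
apply: (measurableT_comp (measurable_powR _)).
by apply: (measurableT_comp measurable_sqrt); exact: measurable_dotp_self.
Qed.

Lemma measurable_sector S : measurable (S : set (borel_rV R n)) ->
  measurable (sector S : set (borel_rV R n)).
Proof.
move=> mS; rewrite (_ : sector S = [set y : 'rV[R]_n | 0 < dotp y y] `&`
  (direction @^-1` S `&` sqball 1)).
  apply: measurableI.
    by apply: measurable_set_lt => //; exact: measurable_dotp_self.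
  apply: measurableI; last exact: measurable_sqball.
  by rewrite -[X in measurable X]setTI; exact: measurable_direction.
apply/seteqP; split => y /=; rewrite dotp_gt0; first by case.
by move=> [y0 [Sy y1]].
Qed.

(** The point of the ball nearest to an outer point y is y / |y|. *)
Lemma unit_ball_nearest (x y : 'rV[R]_n) : 1 < dotp y y ->
  unit_ball R n x ->
  (forall z, unit_ball R n z -> enorm (y - x) <= enorm (y - z)) <->
  x = direction y.
Proof.
move=> y1 /unit_ballP x1.
have y0 : 0 < dotp y y by rewrite (lt_trans _ y1).
have [a aE] : exists a, a = enorm y by eexists.
have a2 : dotp y y = a ^+ 2 by rewrite aE enorm_sq.
have a1 : 1 < a by rewrite aE -sqrtr1 ltr_sqrt.
have a0 : 0 < a by rewrite (lt_trans _ a1).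
have dE : direction y = a^-1 *: y by rewrite /direction aE.
have dd : dotp (direction y) (direction y) = 1.
  by rewrite dE dotpZl dotpZr a2 mulrA -expr2 -exprMn mulVf ?expr1n// gt_eqF.
have yd : dotp y (direction y) = a.
  by rewrite dE dotpZr a2 expr2 mulrA mulVf ?mul1r// gt_eqF.
have dist (z : 'rV[R]_n) : dotp (y - z) (y - z) = a ^+ 2 - 2 * dotp y z + dotp z z.
  by rewrite dotpBl !dotpBr (dotpC z y) a2; ring.
have near (z : 'rV[R]_n) : dotp (z - direction y) (z - direction y) =
    dotp z z - 2 * (dotp y z / a) + 1.
  rewrite dotpBl !dotpBr dd (dotpC (direction y)) dE dotpZr (dotpC z y).
  by rewrite mulrC; ring.
split=> [h|-> z /unit_ballP z1].
  have Dd : unit_ball R n (direction y) by apply/unit_ballP; rewrite dd.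
  have := h _ Dd; rewrite /enorm ler_sqrt ?dotp_ge0// !dist dd yd => h2.
  apply/eqP; rewrite -subr_eq0 -dotp_eq0 eq_le dotp_ge0 andbT near.
  have h3 : 1 + (dotp x x - 1) / a / 2 <= dotp y x / a.
    have -> : 1 + (dotp x x - 1) / a / 2 = (2 * a + (dotp x x - 1)) / 2 / a.
      by field; rewrite gt_eqF.
    by rewrite ler_pM2r ?invr_gt0//; lra.
  have h4 : dotp x x - 1 <= (dotp x x - 1) / a.
    by rewrite ler_pdivlMr//; move: (dotp x x) x1 => b; nra.
  move: h3 h4.
  by move: ((dotp x x - 1) / a) (dotp y x / a) (dotp x x) => u v b; lra.
rewrite /enorm ler_sqrt ?dotp_ge0// !dist dd yd.
have := dotp_ge0 (z - direction y); rewrite near => h.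
have h2 : 2 * dotp y z <= a * (dotp z z + 1).
  have : 2 * (dotp y z / a) <= dotp z z + 1 by lra.
  by rewrite mulrA ler_pdivrMr// [a * _]mulrC.
move: (dotp y z) (dotp z z) z1 h2 => u v; nra.
Qed.

(** The shell over S is a dilated sector minus the sector itself. *)
Lemma local_shell_unit_ball S (e : R) : 0 < e ->
  local_shell (unit_ball R n) S e =
  [set y | sector S ((1 + e)^-1 *: y + 0)] `\` sector S.
Proof.
move=> e0; have e1 : 0 < 1 + e by rewrite addr_gt0.
have ei : 0 < (1 + e)^-1 by rewrite invr_gt0.
have yE (y : 'rV[R]_n) : 0 < dotp y y -> enorm (y - direction y) = `|enorm y - 1|.
  move=> y0; rewrite -sqrtr_sqr /enorm; congr Num.sqrt.
  have s0 : 0 < enorm y by rewrite /enorm sqrtr_gt0.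
  rewrite /direction -{1 4}[y]scale1r -scalerBl dotpZl dotpZr -[dotp y y]enorm_sq.
  rewrite sqrtr_sqr ger0_norm ?(ltW s0)//.
  by move: (enorm y) s0 => s s0; field; rewrite gt_eqF.
have aE (y : 'rV[R]_n) : (enorm y <= 1 + e) = (dotp ((1 + e)^-1 *: y) ((1 + e)^-1 *: y) <= 1).
  rewrite dotpZl dotpZr mulrA -expr2 exprVn mulrC ler_pdivrMr ?exprn_gt0// mul1r.
  rewrite -enorm_sq ler_pXn2r// nnegrE ?sqrtr_ge0//; exact: ltW.
apply/seteqP; split => y /=.
  move=> [/unit_ballP/negP]; rewrite -ltNge => y1 [x [Dx Sx xn xe]].
  have y0 : 0 < dotp y y by rewrite (lt_trans _ y1).
  have s1 : 1 < enorm y by rewrite -sqrtr1 /enorm ltr_sqrt.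
  have xE := (unit_ball_nearest y1 Dx).1 xn; split; last first.
    by case=> _ _; rewrite leNgt y1.
  split; last 1 first.
  - rewrite addr0 -aE; move: xe; rewrite xE yE// ger0_norm ?subr_ge0 ?(ltW s1)//.
    by rewrite lerBlDl.
  - by rewrite addr0 scaler_eq0 negb_or gt_eqF//= -dotp_gt0.
  - by rewrite addr0 directionZ// -xE.
move=> [[]]; rewrite addr0 directionZ// scaler_eq0 negb_or => /andP[_ y0] Sy ye ny.
have y1 : 1 < dotp y y by rewrite ltNge; apply/negP => h; apply: ny.
have dd : dotp (direction y) (direction y) = 1.
  rewrite /direction dotpZl dotpZr -enorm_sq mulrA -expr2 -exprMn mulVf ?expr1n//.
  by rewrite gt_eqF// enorm_gt0.
have Dd : unit_ball R n (direction y) by apply/unit_ballP; rewrite dd.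
split; first by move/unit_ballP; rewrite leNgt y1.
exists (direction y); split => //; first exact: (unit_ball_nearest y1 Dd).2.
have s1 : 1 < enorm y by rewrite -sqrtr1 /enorm ltr_sqrt// (lt_trans _ y1).
rewrite yE ?dotp_gt0// ger0_norm ?subr_ge0 ?(ltW s1)// lerBlDl.
by rewrite aE.
Qed.

Lemma vol_local_shell_unit_ball S (e : R) : measurable (S : set (borel_rV R n)) ->
  0 < e -> vol (local_shell (unit_ball R n) S e) =
  (((1 + e) ^+ n - 1)%:E * vol (sector S))%E.
Proof.
move=> mS e0; have e1 : 0 < 1 + e by rewrite addr_gt0.
have ei : 0 < (1 + e)^-1 by rewrite invr_gt0.
have msec := measurable_sector mS.
have [A AE] : exists A : set 'rV[R]_n, A = [set y | sector S ((1 + e)^-1 *: y + 0)].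
  by eexists.
have mA : measurable (A : set (borel_rV R n)).
  rewrite AE; apply: (@measurable_setP _ _ (borel_rV R n) (borel_rV R n)
    (fun y => (1 + e)^-1 *: y + 0) (sector S)) => //.
  exact: measurable_scale_add.
have vA : vol A = (((1 + e) ^+ n)%:E * vol (sector S))%E.
  by rewrite AE (@vol_affine R n _ 0 (sector S) ei msec) exprVn invrK.
have fin : (vol (sector S) < +oo)%E.
  apply: le_lt_trans (vol_sqball_lty n 1); apply: le_vol => //.
    exact: measurable_sqball.
  by move=> y [].
have Afin : (vol A < +oo)%E.
  rewrite vA lte_mul_pinfty// lee_fin exprn_ge0//; exact: ltW.
rewrite local_shell_unit_ball// -AE.
have -> : vol (A `\` sector S) = (vol A - vol (A `&` sector S))%E.
  exact: (@measureD _ _ _ (@volm R n) A (sector S) mA msec Afin).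
rewrite setIidr; last first.
  rewrite AE => y [y0 Sy y1]; split; rewrite addr0 ?directionZ//.
    by rewrite scaler_eq0 negb_or gt_eqF.
  rewrite dotpZl dotpZr mulrA -expr2 exprVn mulrC ler_pdivrMr ?exprn_gt0// mul1r.
  by rewrite (le_trans y1)// exprn_ege1// lerDl ltW.
rewrite vA EFinB muleBl ?mul1e//.
  by rewrite ge0_fin_numE ?vol_ge0.
Qed.

(** The volume of the shell is ((1 + e)^n - 1) times that of the sector, and
    ((1 + e)^n - 1) / e tends to n. *)
Lemma surface_measure_unit_ball S : measurable (S : set (borel_rV R n)) ->
  surface_measure (unit_ball R n) S = (n%:R%:E * vol (sector S))%E.
Proof.
move=> mS; apply: cvg_lim => //.
have fin : vol (sector S) \is a fin_num.
  rewrite ge0_fin_numE ?vol_ge0//; apply: le_lt_trans (vol_sqball_lty n 1).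
  apply: le_vol; [exact: measurable_sector|exact: measurable_sqball|by move=> y []].
apply: (@cvg_trans _ (((\sum_(i < n) (1 + e) ^+ i)%:E * vol (sector S))%E @[e --> (0 : R)^'+])).
  apply: near_eq_cvg; near=> e.
  have e0 : 0 < e by near: e; exact: nbhs_right_gt.
  rewrite vol_local_shell_unit_ball// muleA -EFinM; congr (_%:E * _)%E.
  by rewrite subrX1 (addrC 1) addrK mulrA mulVf ?mul1r// gt_eqF.
apply: cvgeZr => //; apply: cvg_EFin; first by near=> e.
have -> : n%:R = \sum_(i < n) (1 + 0 : R) ^+ i.
  under eq_bigr do rewrite addr0 expr1n.
  by rewrite sumr_const card_ord.
apply: cvg_big => [|i _]; first exact: add_continuous.
apply: cvg_at_right_filter.
apply: (@continuous_comp _ _ _ (fun z : R => 1 + z) (fun z : R => z ^+ i));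
  last exact: exprn_continuous.
by apply: cvgD; [exact: cvg_cst|exact: cvg_id].
Unshelve. all: by end_near. Qed.

End BallSurface.

Section BoundaryIntegral.
Context {R : realType}.
Import HBNNSimple.

(** The integral against an arbitrary set function sees only its values on
    measurable sets, through simple functions. *)
Lemma eq_integral_measurable d (T : measurableType d) (mu nu : set T -> \bar R)
    (D : set T) (f : T -> \bar R) :
  (forall A, measurable A -> mu A = nu A) ->
  (\int[mu]_(x in D) f x = \int[nu]_(x in D) f x)%E.
Proof.
move=> h; have hs (g : {nnsfun T >-> R}) : sintegral mu g = sintegral nu g.
  rewrite /sintegral; apply: eq_fsbigr => x _; congr (_ * _)%E; apply: h.
  exact: measurable_sfunP.
by rewrite /integral; congr (_ - _)%E; congr ereal_sup; apply: eq_imagel => g _; exact: hs.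
Qed.

Definition sector_measure (d : nat) (A : set (borel_rV R d.+1)) : \bar R :=
  (d.+1%:R%:E * vol (sector A))%E.

Section SectorMeasure.
Variable d : nat.
Let sector0 : @sector_measure d set0 = 0%E.
Proof.
rewrite /sector_measure (_ : sector set0 = set0) ?vol_set0 ?mule0//.
by apply/seteqP; split => y // -[].
Qed.
Let sector_ge0 A : (0 <= @sector_measure d A)%E.
Proof. by rewrite mule_ge0// ?lee_fin// vol_ge0. Qed.
Let sector_sigma : semi_sigma_additive (@sector_measure d).
Proof.
move=> F mF tF mU; rewrite /sector_measure.
have -> : sector (\bigcup_k F k) = \bigcup_k sector (F k).
  apply/seteqP; split => y; first by move=> [y0 [k _ Fk] y1]; exists k.
  by move=> [k _ [y0 Fk y1]]; split => //; exists k.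
have tS : trivIset setT (fun k => sector (F k)).
  apply/trivIsetP => i j _ _ ij; apply/seteqP; split => y // -[[y0 Fi _] [_ Fj _]].
  by have /trivIsetP/(_ i j I I ij) := tF; rewrite -subset0 => /(_ (direction y)); apply.
have mS k : measurable (sector (F k) : set (borel_rV R d.+1)) by exact: measurable_sector.
have h := @measure_sigma_additive _ _ _ (@volm R d.+1) _ mS tS.
rewrite (_ : (fun k => _) = (fun k => d.+1%:R%:E *
    \sum_(0 <= i < k) (@volm R d.+1 (sector (F i))))%E); last first.
  by apply/funext => k; rewrite ge0_sume_distrr// => i _; exact: vol_ge0.
exact: cvgeZl.
Qed.
HB.instance Definition _ := isMeasure.Build _ _ _ (@sector_measure d)
  sector0 sector_ge0 sector_sigma.
End SectorMeasure.

(** The surface measure of the sphere coincides on Borel sets with a measure of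
    total mass n kappa_n. *)
Lemma boundary_integral_unit_ball d (f : 'rV[R]_d.+1 -> R) : f = cst 1 ->
  0 <= boundary_integral (unit_ball R d.+1) f <= d.+1%:R * kappa d.+1.
Proof.
move=> ->; rewrite /boundary_integral.
have mbd : measurable (bd (unit_ball R d.+1) : set (borel_rV R d.+1)).
  apply: measurableD.
    rewrite -(closure_id _).1; last exact: closed_unit_ball.
    exact: measurable_unit_ball.
  by apply: open_measurable_rV; exact: open_interior.
rewrite (@eq_integral_measurable _ _ _ (@sector_measure d)); last first.
  by move=> A mA; exact: surface_measure_unit_ball.
have := @integral_cst _ _ _ (@sector_measure d) _ mbd 1%E.
rewrite mul1e /= => ->; rewrite /sector_measure.
have h : (vol (sector (bd (unit_ball R d.+1))) <= (kappa d.+1)%:E)%E.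
  rewrite -kappaE; apply: le_vol; [exact: measurable_sector|exact: measurable_unit_ball|].
  by move=> y [_ _ y1]; apply/unit_ballP.
have := @vol_ge0 R d.+1 (sector (bd (unit_ball R d.+1))); move: h.
case: (vol _) => [v| |]//; rewrite !lee_fin => h v0.
by rewrite /= mulr_ge0//= ler_pM2l// ltr0n.
Qed.

End BoundaryIntegral.

(** * The lower bound for ldiv *)

Section LdivBound.
Context {R : realType}.

(** The Gaussian bound at squared radius u = n / 2, which optimizes it. *)
Lemma kappa_le_gauss (n : nat) : (0 < n)%N ->
  kappa n <= (2 * pi * expR 1 / n%:R : R) `^ (n%:R / 2).
Proof.
move=> n0; have np : 0 < n%:R :> R by rewrite ltr0n.
have [u uE] : exists u : R, u = n%:R / 2 by eexists.
have u0 : 0 < u by rewrite uE divr_gt0.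
have pi0 := @pi_gt0 R; have e0 := @expR_gt0 R 1.
have := @vol_sqball_le_gauss R n u.
rewrite vol_sqball_sqrt ?(ltW u0)// lee_fin.
have sqrtX (a : R) : 0 <= a -> Num.sqrt a ^+ n = a `^ (n%:R / 2).
  move=> a0; rewrite -powR12_sqrt// -powR_mulrn ?powR_ge0// -powRrM.
  by rewrite mulrC.
rewrite !sqrtX ?(ltW u0) ?(ltW pi0)//.
have -> : expR u = expR 1 `^ (n%:R / 2).
  by rewrite /powR gt_eqF// expRK mulr1 uE.
rewrite -powRM ?(ltW e0) ?(ltW pi0)//.
have -> : expR 1 * pi = u * (2 * pi * expR 1 / n%:R) :> R.
  by rewrite uE; field; rewrite gt_eqF.
rewrite powRM ?(ltW u0)//; last by rewrite divr_ge0// !mulr_ge0// ltW.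
by rewrite ler_pM2l// powR_gt0.
Qed.

Lemma symdiff_scaled_bound (d : nat) : (0 < d)%N ->
  \forall N \near \oo, ((kappa d.+1 / 4 : R)%:E <=
    (N%:R `^ (2 / (d.+1%:R - 1)))%:E *
    ereal_inf [set symdiff_vol P (unit_ball R d.+1) | P in polytopes_upto R d.+1 N])%E.
Proof.
move=> d0; have dp : 0 < d%:R :> R by rewrite ltr0n.
have [T TE] : exists T : R, T = (1 / 1000) ^+ 4 by eexists.
have e0 : 0 < 1 / 1000 :> R by lra.
have T0 : 0 < T by rewrite TE; exact: exprn_gt0.
have d1E : d.+1%:R - 1 = d%:R :> R by rewrite -natr1 addrK.
near=> N.
have nN : (d.+1 ^ d.+1 <= N)%N by near: N; exact: nbhs_infty_ge.
have N0 : 0 < N%:R :> R by rewrite ltr0n (leq_trans _ nN)// expn_gt0.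
have tT : N%:R `^ (- (2 / (d.+1%:R - 1))) <= T.
  rewrite d1E powRN -[T]invrK lef_pV2 ?posrE ?invr_gt0 ?powR_gt0//.
  have h : (T^-1) `^ (d%:R / 2) <= N%:R by near: N; exact: nbhs_infty_ger.
  have q0 : 0 <= 2 / d%:R :> R by rewrite divr_ge0.
  have -> : T^-1 = ((T^-1) `^ (d%:R / 2)) `^ (2 / d%:R).
    rewrite -powRrM (_ : _ * _ = 1) ?powRr1 ?invr_ge0 ?(ltW T0)//.
    by field; rewrite gt_eqF.
  by apply: (ge0_ler_powR q0); rewrite ?nnegrE ?powR_ge0 ?(ltW N0).
have [t tE] : exists t : R, t = N%:R `^ (- (2 / (d.+1%:R - 1))) by eexists.
have t0 : 0 < t by rewrite tE powR_gt0.
have -> : N%:R `^ (2 / (d.+1%:R - 1)) = t^-1 by rewrite tE powRN invrK.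
have -> : (kappa d.+1 / 4 : R)%:E = (t^-1%:E * (t / 4 * kappa d.+1)%:E)%E.
  by rewrite -EFinM; congr (_%:E); field; rewrite gt_eqF.
apply: lee_wpmul2l; first by rewrite lee_fin invr_ge0 ltW.
apply: le_ereal_inf_tmp => _ [P hP <-].
rewrite /symdiff_vol setYC tE.
by apply: symdiff_lower_bound => //; rewrite -TE.
Unshelve. all: by end_near. Qed.

(** Ludwig's limit for the unit ball is at least kappa_n / 4, whence
    c >= (2n)^-1 (n kappa_n)^(-2/(n-1)).  The Gaussian bound for kappa_n turns
    this into the stated expression. *)
Lemma ldiv_lower_bound (d : nat) (c : R) : (0 < d)%N -> is_ldiv d.+1 c ->
  (4 * pi * expR 1)^-1 * (2 * pi * expR 1 * d.+1%:R) `^ (- (1 / d%:R)) <= c.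
Proof.
move=> d0 [c0 /(_ (unit_ball R d.+1) (fun=> 1))].
have dp : 0 < d%:R :> R by rewrite ltr0n.
have d1E : d.+1%:R - 1 = d%:R :> R by rewrite -natr1 addrK.
have np : 0 < d.+1%:R :> R by rewrite ltr0n.
have k0 := @kappa_gt0 R d.+1.
have bC2 : C2_boundary (unit_ball R d.+1).
  move=> x /bd_unit_ball x1; exists setT, (@ball_equation R d.+1).
  exact: C2_equation_unit_ball.
have bcurv x : bd (unit_ball R d.+1) x ->
    gauss_curvature (unit_ball R d.+1) x 1 /\ 0 < (1 : R).
  by move/bd_unit_ball => x1; split => //; exact: gauss_curvature_unit_ball.
move/(_ (@convex_body_unit_ball R d) bC2 bcurv).
set BI := boundary_integral _ _ => /cvge_to_ge/(_ (symdiff_scaled_bound d0)).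
rewrite lee_fin.
have /andP[B0 B1] : 0 <= BI <= d.+1%:R * kappa d.+1.
  by apply: boundary_integral_unit_ball; apply/funext => x; rewrite powR1.
clearbody BI; rewrite d1E => h.
have [p pE] : exists p : R, p = 2 / d%:R by eexists.
have p0 : 0 < p by rewrite pE divr_gt0.
have M0 : 0 < d.+1%:R * kappa d.+1 :> R by rewrite mulr_gt0.
have h1 : kappa d.+1 / 4 <= 2^-1 * c * (d.+1%:R * kappa d.+1) `^ (1 + p).
  apply: (le_trans h); rewrite ler_pM2l ?mulr_gt0//.
  have -> : (d.+1%:R + 1) / d%:R = 1 + p :> R.
    by rewrite pE -[d.+1%:R]natr1; field; rewrite gt_eqF.
  by apply: ge0_ler_powR => //; rewrite ?nnegrE ?addr_ge0 ?(ltW p0) ?(ltW M0).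
have h2 : 1 <= 2 * c * d.+1%:R * (d.+1%:R * kappa d.+1) `^ p.
  move: h1; rewrite powRD; last by rewrite gt_eqF ?addr_gt0.
  rewrite powRr1 ?(ltW M0)//.
  have -> : 2^-1 * c * (d.+1%:R * kappa d.+1 * (d.+1%:R * kappa d.+1) `^ p) =
      kappa d.+1 / 4 * (2 * c * d.+1%:R * (d.+1%:R * kappa d.+1) `^ p).
    by move: (_ `^ p) => q; field.
  by rewrite -{1}[kappa d.+1 / 4]mulr1 ler_pM2l// divr_gt0.
have [A AE] : exists A : R, A = 2 * pi * expR 1 by eexists.
have A0 : 0 < A by rewrite AE !mulr_gt0 ?pi_gt0 ?expR_gt0.
have -> : 4 * pi * expR 1 = 2 * A by rewrite AE; ring.
rewrite -AE.
have h3 : (d.+1%:R * kappa d.+1) `^ p <= A / d.+1%:R * (A * d.+1%:R) `^ (1 / d%:R).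
  apply: (@le_trans _ _ ((d.+1%:R * (A / d.+1%:R) `^ (d.+1%:R / 2)) `^ p)).
    apply: ge0_ler_powR; rewrite ?nnegrE ?(ltW p0) ?(ltW M0)//.
      by rewrite mulr_ge0// powR_ge0.
    by rewrite ler_pM2l// AE kappa_le_gauss.
  rewrite powRM ?powR_ge0// -powRrM.
  have Ad : 0 < A / d.+1%:R by rewrite divr_gt0.
  have -> : d.+1%:R / 2 * p = 1 + 1 / d%:R.
    by rewrite pE -[d.+1%:R]natr1; field; rewrite gt_eqF.
  rewrite powRD; last by rewrite gt_eqF ?addr_gt0 ?divr_gt0.
  rewrite powRr1 ?(ltW Ad)// mulrCA ler_pM2l//.
  have -> : p = (1 / d%:R) + (1 / d%:R) by rewrite pE; field; rewrite gt_eqF.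
  rewrite powRD; last by rewrite gt_eqF// addr_gt0 ?divr_gt0.
  rewrite -mulrA -!powRM ?(ltW A0) ?(ltW Ad)//.
    by rewrite le_eqVlt; apply/orP; left; apply/eqP; congr (_ `^ _); field; rewrite gt_eqF.
  by rewrite mulr_ge0// ltW.
have Q0 : 0 < (A * d.+1%:R) `^ (1 / d%:R) by rewrite powR_gt0// mulr_gt0.
rewrite powRN -invfM -[X in X <= _]mul1r ler_pdivrMr ?mulr_gt0//.
apply: (le_trans h2); rewrite -mulrA.
have := ler_wpM2l (mulr_ge0 (mulr_ge0 (ler0n R 2) (ltW c0)) (ltW np)) h3.
rewrite -mulrA => h4; apply: (le_trans h4).
rewrite le_eqVlt; apply/orP; left; apply/eqP.
by move: (_ `^ _) => q; field; rewrite gt_eqF.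
Qed.

End LdivBound.

Section Asymptotics.
Context {R : realType}.

(** x^(-1/d) >= 1 - ln x / d, and ln x = 2 ln (sqrt x) <= 2 sqrt x. *)
Lemma powR_root_ge (A : R) (d : nat) : (0 < d)%N -> 0 < A ->
  1 - 4 * Num.sqrt (A / d.+1%:R) <= (A * d.+1%:R) `^ (- (1 / d%:R)).
Proof.
move=> d0 A0; have dp : 0 < d%:R :> R by rewrite ltr0n.
have np : 0 < d.+1%:R :> R by rewrite ltr0n.
have [s sE] : exists s, s = Num.sqrt (A / d.+1%:R) by eexists.
have s0 : 0 < s by rewrite sE sqrtr_gt0 divr_gt0.
have An : A * d.+1%:R = (s * d.+1%:R) ^+ 2.
  rewrite exprMn sE sqr_sqrtr ?divr_ge0 ?(ltW A0)//; field; rewrite gt_eqF//.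
have q0 : 0 < s * d.+1%:R by rewrite mulr_gt0.
rewrite -sE An /powR gt_eqF ?exprn_gt0//.
apply: le_trans (expR_ge1Dx _); rewrite lerD2l.
rewrite lnXn// mulNr lerN2 -[ln _ *+ 2]mulr_natl.
have ln1 := ltW (ln_sublinear q0).
apply: (@le_trans _ _ (1 / d%:R * (2 * (s * d.+1%:R)))).
  by rewrite ler_pM2l ?divr_gt0// ler_pM2l.
have d2 : d.+1%:R <= 2 * d%:R :> R.
  have : 1 <= d%:R :> R by rewrite ler1n.
  by rewrite -natr1; lra.
rewrite div1r mulrC ler_pdivrMr//.
have := ler_wpM2l (ltW s0) d2; move: (d.+1%:R : R) (d%:R : R) => a b; lra.
Qed.

Lemma cvg_sqrt_div (A : R) :
  Num.sqrt (A / n%:R) @[n --> \oo] --> (0 : R).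
Proof.
have h : A / n.+1%:R @[n --> \oo] --> (0 : R).
  by rewrite -[0 : R](mulr0 A); apply: cvgM; [exact: cvg_cst|exact: cvg_harmonic].
have := cvg_comp _ _ h (@sqrt_continuous R 0).
by rewrite sqrtr0 -[X in _ -> X]cvg_shiftS.
Qed.

End Asymptotics.

Unset Implicit Arguments.
Set Strict Implicit.
Set Printing Implicit Defensive.

Theorem theorem2p3 (R : realType) :
  (exists (C : R) (r : nat -> nat -> R),
     (forall n N : nat, (2 <= n)%N -> (n ^ n <= N)%N ->
        `|r n N| <= C * N%:R `^ (- (2 / (n%:R - 1)))) /\
     (forall (n N : nat) (P : set 'rV[R]_n), (2 <= n)%N -> (n ^ n <= N)%N ->
        polytopes_upto R n N P ->
        (((4^-1 + r n N) * N%:R `^ (- (2 / (n%:R - 1))))%:E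
           * vol (unit_ball R n) <= symdiff_vol (unit_ball R n) P)%E)) /\
  (forall ldiv : nat -> R,
     (forall n : nat, (2 <= n)%N -> is_ldiv n (ldiv n.-1)) ->
     exists eps : nat -> R,
       eps n @[n --> \oo] --> (0 : R) /\
       forall n : nat, (2 <= n)%N ->
         (4 * pi * expR 1)^-1 + eps n <= ldiv n.-1).
Proof.
split; first exact: symdiff_bound_with_error.
move=> ldiv hl; pose A : R := 2 * pi * expR 1; pose B : R := (4 * pi * expR 1)^-1.
have A0 : 0 < A by rewrite !mulr_gt0 ?pi_gt0 ?expR_gt0.
have B0 : 0 < B by rewrite invr_gt0 !mulr_gt0 ?pi_gt0 ?expR_gt0.
exists (fun n => - (4 * B) * Num.sqrt (A / n%:R)); split.
  rewrite -[0 : R](mulr0 (- (4 * B))); apply: cvgM; first exact: cvg_cst.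
  exact: cvg_sqrt_div.
case=> [//|d] d0; apply: le_trans (ldiv_lower_bound d0 (hl d.+1 d0)).
rewrite -/A -/B; have := ler_wpM2l (ltW B0) (powR_root_ge d0 A0).
by apply: le_trans; rewrite mulrBr mulr1 mulrA [B * 4]mulrC mulNr.
Qed.
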